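(* Suppose that, for every infinite dimensional algebraically irreducible representation $\pi$ of $\ell^1(\Sigma)$, the closed subset $X_\pi$ of $X$ is metrizable (this is certainly the case if $X$ is metrizable or $X=\mathrm{Per}(\sigma)$). Then: (1) $\Pi_{\ell^1}(\infty)=\Pi_{\ell^1}(\mathrm{Aper}(\sigma))$, and hence $\Pi_{\ell^1}=\Pi_{\ell^1}(X)$; (2) A primitive ideal is a maximal primitive ideal if and only if it is associated with a minimal orbit closure.
   Context: $X$ is a non-empty compact Hausdorff space, $\sigma:X\to X$ is a homeomorphism, $\Sigma=(X,\sigma)$, and $\mathbb{Z}$ acts on $X$ via $n\mapsto\sigma^n$. $\mathrm{Per}(\sigma)$ and $\mathrm{Aper}(\sigma)$ are the sets of points with finite, respectively infinite, orbit. $\overline{\mathfrak{o}}$ denotes the closure of an orbit $\mathfrak{o}$. A minimal orbit closure is a minimal element, under inclusion, of the set of all closures of orbits in $X$. $\mathbb{T}$ is the unit circle in $\mathbb{C}$. $C(X)$ carries the supremum norm and $\alpha(f)=f\circ\sigma^{-1}$. $\ell^1(\Sigma)$ is the Banach space of all $a:\mathbb{Z}\to C(X)$ with $\|a\|=\sum_n\|a(n)\|<\infty$, with multiplication $(aa')(n)=\sum_{k\in\mathbb{Z}}a(k)\,\alpha^k(a'(n-k))$. Elements are written $a=\sum_nf_n\delta^n$ with $f_n=a(n)$, where $\delta(1)=1$ and $\delta(m)=0$ for $m\ne1$; $C(X)$ embeds via $f\mapsto f\delta^0$. A representation of an algebra $A$ on a complex vector space $E$ is algebraically irreducible if $\pi(A)E\ne\{0\}$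 and the only invariant subspaces are $\{0\}$ and $E$; a primitive ideal is the kernel of such a representation. For an algebraically irreducible representation $\pi$ of $\ell^1(\Sigma)$ on $E$, there is a Banach space norm on $E$ making $\pi$ a continuous representation by bounded operators; hence $\{f\in C(X):\pi(f)=0\}$ is a proper closed $\alpha$-invariant ideal of $C(X)$, and $X_\pi$ is the unique closed subset of $X$ (non-empty and $\sigma$-invariant) such that $\{f\in C(X):\pi(f)=0\}=\{f\in C(X):f|_{X_\pi}=0\}$. For $x\in\mathrm{Per}(\sigma)$ of period $p$ with orbit $\mathfrak{o}=\overline{\mathfrak{o}}$, and $\lambda\in\mathbb{T}$, $P_{\overline{\mathfrak{o}},\lambda}$ is the kernel of the algebraically irreducible representation $\pi_{x,\lambda}$ on $\mathbb{C}^p$ (basis $e_0,\dots,e_{p-1}$) given by $\pi_{x,\lambda}(f)e_j=f(\sigma^jx)e_j$ for $f\in C(X)$, $\pi_{x,\lambda}(\delta)e_j=e_{j+1}$ for $0\le j\le p-2$, $\pi_{x,\lambda}(\delta)e_{p-1}=\lambda e_0$; it depends only on $\overline{\mathfrak{o}}$ and $\lambda$. For $x\in\mathrm{Aper}(\sigma)$ with orbit closure $\overline{\mathfrak{o}}$, $P_{\overline{\mathfrak{o}}}$ is the kernel of the algebraically irreducible contractive representation $\pi_x^1$ on $\ell^1(\mathbb{Z})$ with $\pi_x^1(f)e_k=f(\sigma^kx)e_k$, $\pi_x^1(\delta)e_k=e_{k+1}$ ($k\in\mathbb{Z}$); it depends only on $\overline{\mathfrak{o}}$ and equals $\{\sum_nf_n\delta^n:f_n|_{\overline{\mathfrak{o}}}=0\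 \forall n\}$. The ideals $P_{\overline{\mathfrak{o}},\lambda}$ and $P_{\overline{\mathfrak{o}}}$ are said to be associated with the orbit closure $\overline{\mathfrak{o}}$. $\Pi_{\ell^1}$ is the set of all primitive ideals of $\ell^1(\Sigma)$; $\Pi_{\ell^1}(\infty)$ is the set of kernels of infinite dimensional algebraically irreducible representations; $\Pi_{\ell^1}(\mathrm{Per}(\sigma))$ is the set of all $P_{\overline{\mathfrak{o}},\lambda}$ with $\mathfrak{o}\subset\mathrm{Per}(\sigma)$ an orbit and $\lambda\in\mathbb{T}$; $\Pi_{\ell^1}(\mathrm{Aper}(\sigma))$ is the set of all $P_{\overline{\mathfrak{o}}}$ with $\mathfrak{o}\subset\mathrm{Aper}(\sigma)$ an orbit; $\Pi_{\ell^1}(X)=\Pi_{\ell^1}(\mathrm{Per}(\sigma))\cup\Pi_{\ell^1}(\mathrm{Aper}(\sigma))$. A maximal primitive ideal is a maximal element of $\Pi_{\ell^1}$ under inclusion. *)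

(* Defs.v *)
From HB Require Import structures.
From mathcomp Require Import all_boot all_order all_algebra.
From mathcomp Require Import all_classical all_reals all_analysis.
From mathcomp Require Import complex.

Set Implicit Arguments.
Unset Strict Implicit.
Unset Printing Implicit Defensive.

Import Order.TTheory GRing.Theory Num.Theory.
Import numFieldNormedType.Exports.

Local Open Scope classical_set_scope.
Local Open Scope ring_scope.
Local Open Scope complex_scope.

(* R[i] with its norm topology, as a normed space over itself. *)
#[warning="-redundant-canonical-projection", non_forgetful_inheritance]
HB.instance Definition _ (R : realType) := NormedModule.copy R[i] R[i]^o.

(* The homeomorphism is carried together with its inverse. *)
Record dynsys := DynSys {
  dyn_space :> topologicalType;
  dyn_nonempty : [set: dyn_space] !=set0;
  dyn_compact : compact [set: dyn_space];
  dyn_hausdorff : hausdorff_space dyn_space;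
  dyn_map : dyn_space -> dyn_space;
  dyn_inv : dyn_space -> dyn_space;
  dyn_mapK : cancel dyn_map dyn_inv;
  dyn_invK : cancel dyn_inv dyn_map;
  dyn_map_continuous : continuous dyn_map;
  dyn_inv_continuous : continuous dyn_inv
}.

Section Dynamics.
Variable S : dynsys.
Implicit Types (x : S) (n : int) (Y : set S).

Definition dyn_iter n x : S :=
  match n with
  | Posz k => iter k (@dyn_map S) x
  | Negz k => iter k.+1 (@dyn_inv S) x
  end.

Definition dyn_orbit x : set S := range (dyn_iter^~ x).

Definition Per : set S := [set x | finite_set (dyn_orbit x)].
Definition Aper : set S := [set x | infinite_set (dyn_orbit x)].

Definition has_period x (p : nat) : Prop :=
  [/\ (0 < p)%N, dyn_iter p x = x &
      forall q : nat, (0 < q < p)%N -> dyn_iter q x <> x].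

Definition orbit_closure Y : Prop := exists x, Y = closure (dyn_orbit x).

Definition minimal_orbit_closure Y : Prop :=
  orbit_closure Y /\
  forall Z : set S, orbit_closure Z -> Z `<=` Y -> Z = Y.

Lemma dyn_iter_continuous n : continuous (dyn_iter n).
Proof.
have iterC f k : continuous f -> continuous (iter k f : S -> S).
  move=> cf; elim: k => [|k IH] x /=; first exact: cvg_id.
  by apply: (@continuous_comp _ _ _ (iter k f) f); [exact: IH|exact: cf].
case: n => k.
  exact: (iterC _ k (@dyn_map_continuous S)).
exact: (iterC _ k.+1 (@dyn_inv_continuous S)).
Qed.

End Dynamics.

Arguments dyn_iter {S} n x.
Arguments dyn_orbit {S} x.
Arguments Per {S}.
Arguments Aper {S}.

(* The topology of T is induced by a metric; d >= 0 follows from the axioms. *)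
Definition metrizable (R : realType) (T : topologicalType) : Prop :=
  exists d : T -> T -> R,
    [/\ forall x y, d x y = 0 <-> x = y,
        forall x y, d x y = d y x,
        forall x y z, d x z <= d x y + d y z &
        forall x (A : set T),
          nbhs x A <-> exists2 e : R, 0 < e & [set y | d x y < e] `<=` A].

Section RealNorm.
Variables (R : realType) (V : normedModType R[i]).

(* The norm of a normed R[i]-module takes values in R[i]; this is the same
   number as an element of R. *)
Definition rnorm (v : V) : R := complex.Re `|v|.

Lemma rnormE v : (rnorm v)%:C = `|v|.
Proof. by apply: RRe_real; exact: normr_real. Qed.

Lemma rnorm_ge0 v : 0 <= rnorm v.
Proof. by rewrite -ler0c rnormE. Qed.

Lemma rnormD u v : rnorm (u + v) <= rnorm u + rnorm v.
Proof. by rewrite -lecR rmorphD /= !rnormE ler_normD. Qed.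

Lemma rnormZ (c : R[i]) v : rnorm (c *: v) = complex.Re `|c| * rnorm v.
Proof.
by apply: complexI; rewrite rmorphM /= !rnormE normrZ.
Qed.

Lemma rnorm0 : rnorm 0 = 0.
Proof. by apply: complexI; rewrite rnormE normr0. Qed.

Lemma rnorm_eq0 v : rnorm v = 0 -> v = 0.
Proof. by move=> v0; apply/normr0_eq0; rewrite -rnormE v0. Qed.

Lemma rnorm_continuous : continuous rnorm.
Proof.
move=> v; apply/cvgrPdist_lt => e e0.
have eC0 : 0 < e%:C :> R[i] by rewrite ltcR.
near=> w.
have : `|v - w| < e%:C by near: w; apply: cvgr_dist_lt eC0; exact: cvg_id.
rewrite -rnormE ltcR; apply: le_lt_trans.
rewrite ler_norml; apply/andP; split.
  rewrite lerNl opprB lerBlDr (_ : rnorm (v - w) = rnorm (w - v)).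
    by rewrite (le_trans _ (rnormD _ _))// subrK.
  by rewrite /rnorm distrC.
by rewrite lerBlDr (le_trans _ (rnormD _ _))// subrK.
Unshelve. all: by end_near. Qed.

End RealNorm.


Section CFun.
Variables (R : realType) (S : dynsys).

Definition cfun := continuousType S R[i].

HB.instance Definition _ := Choice.on cfun.

Implicit Types (f g h : cfun) (c : R[i]).

Definition mk_cfun (f : S -> R[i]) (cf : continuous f) : cfun := mkcts cf.

Lemma cfunP f g : f =1 g -> f = g.
Proof. by move/continuousEP. Qed.

Lemma cfun_continuous f : continuous f.
Proof. exact: cts_fun. Qed.

Lemma cfun_cst_subproof c : continuous (fun _ : S => c).
Proof. by move=> x; exact: cvg_cst. Qed.
Lemma cfun_add_subproof f g : continuous (fun x => f x + g x).
Proof. by move=> x; apply: cvgD; exact: cfun_continuous. Qed.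
Lemma cfun_opp_subproof f : continuous (fun x => - f x).
Proof. by move=> x; apply: cvgN; exact: cfun_continuous. Qed.
Lemma cfun_mul_subproof f g : continuous (fun x => f x * g x).
Proof. by move=> x; apply: cvgM; exact: cfun_continuous. Qed.

Definition cfun_cst c : cfun := mk_cfun (@cfun_cst_subproof c).
Definition cfun_add f g : cfun := mk_cfun (@cfun_add_subproof f g).
Definition cfun_opp f : cfun := mk_cfun (@cfun_opp_subproof f).
Definition cfun_mul f g : cfun := mk_cfun (@cfun_mul_subproof f g).
Definition cfun_scale c f : cfun := cfun_mul (cfun_cst c) f.

Lemma cfun_addA : associative cfun_add.
Proof. by move=> f g h; apply: cfunP => x; exact: addrA. Qed.
Lemma cfun_addC : commutative cfun_add.
Proof. by move=> f g; apply: cfunP => x; exact: addrC. Qed.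
Lemma cfun_add0 : left_id (cfun_cst 0) cfun_add.
Proof. by move=> f; apply: cfunP => x; exact: add0r. Qed.
Lemma cfun_addN : left_inverse (cfun_cst 0) cfun_opp cfun_add.
Proof. by move=> f; apply: cfunP => x; exact: addNr. Qed.

HB.instance Definition _ :=
  GRing.isZmodule.Build cfun cfun_addA cfun_addC cfun_add0 cfun_addN.

Lemma cfun_mulA : associative cfun_mul.
Proof. by move=> f g h; apply: cfunP => x; exact: mulrA. Qed.
Lemma cfun_mulC : commutative cfun_mul.
Proof. by move=> f g; apply: cfunP => x; exact: mulrC. Qed.
Lemma cfun_mul1 : left_id (cfun_cst 1) cfun_mul.
Proof. by move=> f; apply: cfunP => x; exact: mul1r. Qed.
Lemma cfun_mulD : left_distributive cfun_mul cfun_add.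
Proof. by move=> f g h; apply: cfunP => x; exact: mulrDl. Qed.
Lemma cfun_1neq0 : cfun_cst 1 != cfun_cst 0.
Proof.
have [x _] := @dyn_nonempty S.
by apply/eqP => /(congr1 (fun f : cfun => f x))/eqP; rewrite /= oner_eq0.
Qed.

HB.instance Definition _ := GRing.Zmodule_isComNzRing.Build cfun
  cfun_mulA cfun_mulC cfun_mul1 cfun_mulD cfun_1neq0.

Lemma cfun_scaleA b c f : cfun_scale b (cfun_scale c f) = cfun_scale (b * c) f.
Proof. by apply: cfunP => x; exact: mulrA. Qed.
Lemma cfun_scale1 : left_id 1 cfun_scale.
Proof. by move=> f; apply: cfunP => x; exact: mul1r. Qed.
Lemma cfun_scaleDr : right_distributive cfun_scale +%R.
Proof. by move=> c f g; apply: cfunP => x; exact: mulrDr. Qed.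
Lemma cfun_scaleDl f : {morph cfun_scale^~ f : a b / a + b}.
Proof. by move=> a b; apply: cfunP => x; exact: mulrDl. Qed.

HB.instance Definition _ := GRing.Zmodule_isLmodule.Build R[i] cfun
  cfun_scaleA cfun_scale1 cfun_scaleDr cfun_scaleDl.

Definition sup_norm f : R := sup (range (fun x => rnorm (f x))).

Lemma sup_norm_has_sup f : has_sup (range (fun x => rnorm (f x))).
Proof.
split; first by have [x _] := @dyn_nonempty S; exists (rnorm (f x)), x.
have cf : continuous (fun x => rnorm (f x)).
  move=> x; apply: (@continuous_comp _ _ _ f (@rnorm R R[i])).
    exact: cfun_continuous.
  exact: rnorm_continuous.
have /compact_bounded[M [_ Mf]] :
    compact (range (fun x => rnorm (f x))).
  apply: continuous_compact; last exact: dyn_compact.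
  exact: continuous_subspaceT.
exists (M + 1) => _ [x _ <-]; apply: le_trans (ler_norm _) _.
by apply: (Mf (M + 1)); [rewrite ltrDl|exists x].
Qed.

Lemma sup_norm_ub f x : rnorm (f x) <= sup_norm f.
Proof. by apply: sup_upper_bound; [exact: sup_norm_has_sup|exists x]. Qed.

Lemma sup_norm_le f (M : R) : (forall x, rnorm (f x) <= M) -> sup_norm f <= M.
Proof.
move=> fM; apply: ge_sup; first by have [] := sup_norm_has_sup f.
by move=> _ [x _ <-].
Qed.

Lemma sup_norm_ge0 f : 0 <= sup_norm f.
Proof.
have [x _] := @dyn_nonempty S.
exact: le_trans (rnorm_ge0 _) (sup_norm_ub f x).
Qed.

Lemma sup_normD f g : (sup_norm (f + g))%:C <= (sup_norm f)%:C + (sup_norm g)%:C.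
Proof.
rewrite -rmorphD lecR; apply: sup_norm_le => x.
by rewrite (le_trans (rnormD _ _))// lerD// sup_norm_ub.
Qed.

Lemma sup_normZ c f : (sup_norm (c *: f))%:C = `|c| * (sup_norm f)%:C.
Proof.
have le b g : sup_norm (b *: g) <= rnorm b * sup_norm g.
  apply: sup_norm_le => x; rewrite [leLHS](_ : _ = rnorm b * rnorm (g x)).
    by rewrite ler_wpM2l ?rnorm_ge0 ?sup_norm_ub.
  exact: (@rnormZ R R[i]).
rewrite -rnormE -rmorphM; congr (_%:C); apply/eqP; rewrite eq_le le/=.
have [->|c0] := eqVneq c 0; first by rewrite rnorm0 mul0r sup_norm_ge0.
have := le c^-1 (c *: f); rewrite scalerA mulVf// scale1r.
have rc0 : 0 < rnorm c by rewrite -ltcR rnormE normr_gt0.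
rewrite -(ler_pM2l rc0) mulrA (_ : rnorm c * rnorm c^-1 = 1) ?mul1r//.
by apply: complexI; rewrite rmorphM/= !rnormE -normrM divff// normr1.
Qed.

Lemma sup_norm_eq0 f : (sup_norm f)%:C = 0 -> f = 0.
Proof.
move=> /complexI f0; apply: cfunP => x; apply: rnorm_eq0.
by apply/eqP; rewrite eq_le rnorm_ge0 -f0 sup_norm_ub.
Qed.

HB.instance Definition _ :=
  Lmodule_isNormed.Build R[i] cfun sup_normD sup_normZ sup_norm_eq0.

Lemma rnorm_cfunE f : rnorm f = sup_norm f.
Proof. by []. Qed.

End CFun.

Section Ell1.
Variables (R : realType) (V : normedModType R[i]).
Implicit Types (u v : int -> V).

Definition ell1_mass u : \bar R := (\esum_(n in setT) (rnorm (u n))%:E)%E.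

Lemma ell1_mass_ge0 u : (0 <= ell1_mass u)%E.
Proof. by apply: esum_ge0 => n _; rewrite lee_fin rnorm_ge0. Qed.

Lemma ell1_massD u v : (ell1_mass (u + v)%R <= ell1_mass u + ell1_mass v)%E.
Proof.
rewrite /ell1_mass -esumD; try by move=> n _; rewrite lee_fin rnorm_ge0.
by apply: le_esum => n _; rewrite -EFinD lee_fin rnormD.
Qed.

Lemma esum_mull (T : choiceType) (c : R) (f : T -> \bar R) : 0 <= c ->
  (forall t, 0 <= f t)%E ->
  (\esum_(t in setT) (c%:E * f t) <= c%:E * \esum_(t in setT) f t)%E.
Proof.
move=> c0 f0; apply: ge_ereal_sup => _ [X [finX XT] <-].
rewrite -ge0_mule_fsumr//; apply: lee_wpmul2l; first by rewrite lee_fin.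
by apply: ereal_sup_ubound; exists X.
Qed.

Lemma ell1_massZ (c : R[i]) u :
  (ell1_mass (c *: u)%R <= (rnorm c)%:E * ell1_mass u)%E.
Proof.
rewrite (le_trans _ (esum_mull _ _)) ?rnorm_ge0//; last first.
  by move=> n; rewrite lee_fin rnorm_ge0.
by apply: le_esum => n _; rewrite -EFinM lee_fin rnormZ.
Qed.

Lemma ell1_mass0 : ell1_mass 0 = 0%E.
Proof. by rewrite /ell1_mass esum1// => n _; rewrite rnorm0. Qed.

Lemma ell1_mass_ub u n : ((rnorm (u n))%:E <= ell1_mass u)%E.
Proof.
rewrite -(esum_set1 (t := n) (a := fun m => (rnorm (u m))%:E)) ?lee_fin ?rnorm_ge0//.
rewrite [leRHS](esumID [set n]).
  by rewrite setTI leeDl// esum_ge0// => m _; rewrite lee_fin rnorm_ge0.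
by move=> m _; rewrite lee_fin rnorm_ge0.
Qed.

Definition ell1_pred : {pred int -> V} := fun u => (ell1_mass u < +oo)%E.

Lemma ell1_submod_closed : submod_closed ell1_pred.
Proof.
split; first by rewrite unfold_in ell1_mass0 ltry.
move=> c u v; rewrite !unfold_in => u1 v1.
apply: le_lt_trans (ell1_massD _ _) _; rewrite lte_add_pinfty//.
apply: le_lt_trans (ell1_massZ _ _) _.
rewrite ltey_eq fin_numM// ge0_fin_numE//; exact: ell1_mass_ge0.
Qed.

HB.instance Definition _ :=
  GRing.isSubmodClosed.Build R[i] (int -> V) ell1_pred ell1_submod_closed.

Record ell1 := Ell1 { ell1_fun :> int -> V; ell1_in : ell1_fun \in ell1_pred }.

HB.instance Definition _ := [isSub for ell1_fun].
HB.instance Definition _ := [Choice of ell1 by <:].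
HB.instance Definition _ := [SubChoice_isSubLmodule of ell1 by <:].

Implicit Types (a b : ell1).

Lemma ell1P a b : a =1 b -> a = b.
Proof. by move=> /funext ab; apply: val_inj. Qed.

Lemma ell1_fin a : ell1_mass a \is a fin_num.
Proof. by rewrite ge0_fin_numE ?ell1_mass_ge0//; exact: ell1_in. Qed.

Definition ell1_norm a : R := fine (ell1_mass a).

Lemma ell1_normE a : (ell1_norm a)%:E = ell1_mass a.
Proof. by rewrite fineK// ell1_fin. Qed.

Lemma ell1_norm_ge0 a : 0 <= ell1_norm a.
Proof. by rewrite -lee_fin ell1_normE ell1_mass_ge0. Qed.

Lemma ell1_normD a b :
  (ell1_norm (a + b))%:C <= (ell1_norm a)%:C + (ell1_norm b)%:C.
Proof.
rewrite -rmorphD lecR -lee_fin EFinD !ell1_normE.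
exact: ell1_massD.
Qed.

Lemma ell1_normZ (c : R[i]) a :
  (ell1_norm (c *: a))%:C = `|c| * (ell1_norm a)%:C.
Proof.
have le d b : ell1_norm (d *: b) <= rnorm d * ell1_norm b.
  by rewrite -lee_fin EFinM !ell1_normE; exact: ell1_massZ.
rewrite -rnormE -rmorphM; congr (_%:C); apply/eqP; rewrite eq_le le/=.
have [->|c0] := eqVneq c 0; first by rewrite rnorm0 mul0r ell1_norm_ge0.
have := le c^-1 (c *: a); rewrite scalerA mulVf// scale1r.
have rc0 : 0 < rnorm c by rewrite -ltcR rnormE normr_gt0.
rewrite -(ler_pM2l rc0) mulrA (_ : rnorm c * rnorm c^-1 = 1) ?mul1r//.
by apply: complexI; rewrite rmorphM/= !rnormE -normrM divff// normr1.
Qed.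

Lemma ell1_norm_eq0 a : (ell1_norm a)%:C = 0 -> a = 0.
Proof.
move=> /complexI a0; apply: ell1P => n; apply: rnorm_eq0.
apply/eqP; rewrite eq_le rnorm_ge0 -a0 -lee_fin ell1_normE.
by rewrite ell1_mass_ub.
Qed.

HB.instance Definition _ :=
  Lmodule_isNormed.Build R[i] ell1 ell1_normD ell1_normZ ell1_norm_eq0.

Lemma ell1_single_subproof (n : int) (v : V) :
  (fun m => if m == n then v else 0) \in ell1_pred.
Proof.
rewrite unfold_in /ell1_mass (esumID [set n]).
  rewrite setTI [X in (_ + X)%E]esum1 => [|m [_ /eqP/negbTE /= ->]].
    by rewrite addr0 esum_set1 ?eqxx ?ltry// lee_fin rnorm_ge0.
  by rewrite rnorm0.
by move=> m _; rewrite lee_fin rnorm_ge0.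
Qed.

Definition ell1_single (n : int) (v : V) : ell1 :=
  Ell1 (ell1_single_subproof n v).

(* The sum over Z, split as k >= 0 and k < 0 (Negz k stands for -(k + 1));
   for the absolutely summable families it is applied to in the complete space
   C(X), both series converge. *)
Definition zsum u : V :=
  limn (series (fun k => u (Posz k))) + limn (series (fun k => u (Negz k))).

(* point = 0 covers the conventional value of lim on divergent sequences, so
   that completeness of V is not needed here. *)
Lemma rnorm_lim_series (w : nat -> V) : point = 0 :> V ->
  ((rnorm (limn (series w)))%:E <= \esum_(k in setT) (rnorm (w k))%:E)%E.
Proof.
move=> pt0; set s := (\esum_(_ in _) _)%E.
have w0 k : (0 <= (rnorm (w k))%:E)%E by rewrite lee_fin rnorm_ge0.
have s0 : (0 <= s)%E by apply: esum_ge0.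
have [cw|/dvgP->] := pselect (cvgn (series w)); last by rewrite pt0 rnorm0.
have ub n : ((rnorm (series w n))%:E <= s)%E.
  rewrite /s -nneseries_esumT//.
  apply: le_trans (nneseries_lim_ge (P := xpredT) (m := 0%N) n _) => //.
  rewrite sumEFin lee_fin /series/=.
  elim/big_ind2 : _ => [|x1 x2 y1 y2 h1 h2|//]; first by rewrite rnorm0.
  by rewrite (le_trans (rnormD _ _))// lerD.
have [sfin|] := boolP (s \is a fin_num); last first.
  by rewrite ge0_fin_numE// -leNgt leye_eq => /eqP ->; rewrite leey.
have cr : rnorm (series w n) @[n --> \oo] --> rnorm (limn (series w)).
  by apply: continuous_cvg => //; exact: rnorm_continuous.
rewrite -(fineK sfin) lee_fin -(cvg_lim _ cr)//.
apply: limr_le; first by apply/cvg_ex; eexists; exact: cr.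
by apply: nearW => n; rewrite -lee_fin (fineK sfin).
Qed.

Lemma rnorm_zsum u : point = 0 :> V -> ((rnorm (zsum u))%:E <= ell1_mass u)%E.
Proof.
move=> pt0; have u0 k : (0 <= (rnorm (u k))%:E)%E by rewrite lee_fin rnorm_ge0.
apply: (@le_trans _ _ ((rnorm (limn (series (fun k => u (Posz k)))))%:E +
  (rnorm (limn (series (fun k => u (Negz k)))))%:E)%E).
  by rewrite -EFinD lee_fin rnormD.
rewrite /ell1_mass (esumID (range Posz))// !setTI.
apply: leeD; apply: le_trans (rnorm_lim_series _ pt0) _.
  rewrite (reindex_esum setT (range Posz) Posz)//.
  by split => // k l _ _ [].
rewrite (reindex_esum setT (~` range Posz) Negz)//.
split; first by move=> k _ [].
  by move=> k l _ _ [].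
by case=> k /= nk; [exfalso; apply: nk; exists k|exists k].
Qed.

End Ell1.

Section CrossedProduct.
Variables (R : realType) (S : dynsys).
Local Notation CX := (cfun R S).
Local Notation A := (ell1 CX).
Implicit Types (f g : CX) (a b : A).

Lemma alpha_subproof (k : int) f :
  continuous (fun x : S => f (dyn_iter (- k) x)).
Proof.
move=> x; apply: (@continuous_comp _ _ _ (dyn_iter (- k)) f).
  exact: dyn_iter_continuous.
exact: cfun_continuous.
Qed.

(* alpha k is the k-th power of f |-> f \o sigma^-1. *)
Definition alpha (k : int) f : CX := mk_cfun (@alpha_subproof k f).

Definition conv a b (n : int) : CX := zsum (fun k => a k * alpha k (b (n - k))).

Lemma rnorm_mul f g : rnorm (f * g) <= rnorm f * rnorm g.
Proof.
rewrite !rnorm_cfunE; apply: sup_norm_le => x.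
rewrite [leLHS](_ : _ = rnorm (f x) * rnorm (g x)).
  by apply: ler_pM; rewrite ?rnorm_ge0// sup_norm_ub.
exact: (@rnormZ R R[i]).
Qed.

Lemma rnorm_alpha (k : int) f : rnorm (alpha k f) <= rnorm f.
Proof. by rewrite !rnorm_cfunE; apply: sup_norm_le => x; exact: (sup_norm_ub f). Qed.

Lemma conv_in a b : conv a b \in @ell1_pred R CX.
Proof.
pose F (n k : int) := ((rnorm (a k))%:E * (rnorm (b (n - k)))%:E)%E.
have F0 n k : (0 <= F n k)%E by rewrite /F -EFinM lee_fin mulr_ge0// rnorm_ge0.
rewrite unfold_in; apply: (@le_lt_trans _ _
    (\esum_(n in setT) \esum_(k in setT) F n k)%E).
  apply: le_esum => n _; apply: le_trans (rnorm_zsum _ _) _ => //.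
  apply: le_esum => k _; rewrite /F -EFinM lee_fin.
  by rewrite (le_trans (rnorm_mul _ _))// ler_wpM2l ?rnorm_ge0// rnorm_alpha.
have swap : (\esum_(n in setT) \esum_(k in setT) F n k =
             \esum_(k in setT) \esum_(n in setT) F n k)%E.
  rewrite !esum_esum//.
  rewrite (reindex_esum (setT `*`` (fun=> setT)) _ (fun p => (p.2, p.1)))//.
  split => //; first by move=> [? ?] [? ?] _ _ [-> ->].
  by move=> [n k] _; exists (k, n).
rewrite swap; apply: (@le_lt_trans _ _
    (\esum_(k in setT) (ell1_mass b * (rnorm (a k))%:E))%E).
  apply: le_esum => k _; rewrite /F muleC.
  apply: le_trans (esum_mull _ _) _; rewrite ?rnorm_ge0//.
    by move=> n; rewrite lee_fin rnorm_ge0.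
  apply: lee_wpmul2l; first by rewrite lee_fin rnorm_ge0.
  rewrite [leRHS](reindex_esum setT setT (fun n => n - k))//.
  split => // [n m _ _ /addIr//|n _]; exists (n + k) => //.
  by rewrite addrK.
rewrite -(ell1_normE b).
apply: le_lt_trans (esum_mull _ _) _; rewrite ?ell1_norm_ge0//.
  by move=> n; rewrite lee_fin rnorm_ge0.
by rewrite -[X in (_ * X)%E](ell1_normE a) -EFinM ltry.
Qed.

Definition ell1_mul a b : A := Ell1 (conv_in a b).

Definition delta : A := ell1_single 1 (1 : CX).
Definition cfun_emb f : A := ell1_single 0 f.

Section Representations.
Variable E : lmodType R[i].

Definition representation (pi : A -> E -> E) : Prop :=
  [/\ forall a, linear (pi a),
      forall v, linear (pi^~ v) &
      forall a b v, pi (ell1_mul a b) v = pi a (pi b v)].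

Definition subspace_of (F : set E) : Prop :=
  F 0 /\ forall (c : R[i]) u v, F u -> F v -> F (c *: u + v).

Definition invariant_set (pi : A -> E -> E) (F : set E) : Prop :=
  forall a v, F v -> F (pi a v).

Definition alg_irreducible (pi : A -> E -> E) : Prop :=
  [/\ representation pi,
      exists a v, pi a v <> 0 &
      forall F, subspace_of F -> invariant_set pi F -> F = [set 0] \/ F = setT].

Definition finite_dimensional : Prop :=
  exists (n : nat) (e : 'I_n -> E),
    forall v, exists c : 'I_n -> R[i], v = \sum_(i < n) c i *: e i.

Definition rep_ker (pi : A -> E -> E) : set A :=
  [set a | forall v, pi a v = 0].

(* Y is the closed set X_pi: the f in C(X) killed by pi are exactly those
   vanishing on Y. Closedness makes Y unique (Urysohn). *)
Definition rep_support (pi : A -> E -> E) (Y : set S) : Prop :=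
  closed Y /\
  forall f, (forall v, pi (cfun_emb f) v = 0) <-> (forall x, Y x -> f x = 0).

End Representations.

Definition bounded_rep (E : normedModType R[i]) (pi : A -> E -> E) : Prop :=
  exists M : R[i], forall a v, `|pi a v| <= M * `|a| * `|v|.

Definition contractive_rep (E : normedModType R[i]) (pi : A -> E -> E) : Prop :=
  forall a v, `|pi a v| <= `|a| * `|v|.

Definition basis_vec (p : nat) (j : 'I_p) : 'cV[R[i]]_p := delta_mx j 0.

(* C(X), delta and delta^-1 generate a dense subalgebra, and pi(1) = 1 forces
   the value of pi at delta^-1, so boundedness makes pi unique. Basis vectors are
   numbered from 0: the last two clauses are pi(delta) e_i = e_(i+1) for i < p - 1
   and pi(delta) e_(p-1) = lambda e_0. *)
Definition is_pi_per (p : nat) (x : S) (lambda : R[i])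
    (pi : A -> 'cV[R[i]]_p -> 'cV[R[i]]_p) : Prop :=
  [/\ representation pi, bounded_rep pi,
      forall f (j : 'I_p),
        pi (cfun_emb f) (basis_vec j) = f (dyn_iter j x) *: basis_vec j,
      forall i j : 'I_p, j = i.+1 :> nat ->
        pi delta (basis_vec i) = basis_vec j &
      forall i j : 'I_p, i.+1 = p -> j = 0%N :> nat ->
        pi delta (basis_vec i) = lambda *: basis_vec j].

Definition is_P_per (x : S) (lambda : R[i]) (I : set A) : Prop :=
  exists (p : nat) (pi : A -> 'cV[R[i]]_p -> 'cV[R[i]]_p),
    [/\ has_period x p, is_pi_per x lambda pi & I = rep_ker pi].

Local Notation ell1Z := (ell1 R[i]).

Definition basis_vecZ (k : int) : ell1Z := ell1_single k (1 : R[i]).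

Definition is_pi_aper (x : S) (pi : A -> ell1Z -> ell1Z) : Prop :=
  [/\ representation pi, contractive_rep pi,
      forall f (k : int), pi (cfun_emb f) (basis_vecZ k) =
        f (dyn_iter k x) *: basis_vecZ k &
      forall k : int, pi delta (basis_vecZ k) = basis_vecZ (k + 1)].

Definition is_P_aper (x : S) (I : set A) : Prop :=
  exists2 pi, is_pi_aper x pi & I = rep_ker pi.

Definition Pi_all : set (set A) :=
  [set I | exists (E : lmodType R[i]) (pi : A -> E -> E),
    alg_irreducible pi /\ I = rep_ker pi].

Definition Pi_infty : set (set A) :=
  [set I | exists (E : lmodType R[i]) (pi : A -> E -> E),
    [/\ alg_irreducible pi, ~ finite_dimensional E & I = rep_ker pi]].

Definition Pi_Per : set (set A) :=
  [set I | exists x lambda, [/\ Per x, `|lambda| = 1 & is_P_per x lambda I]].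

Definition Pi_Aper : set (set A) :=
  [set I | exists x, Aper x /\ is_P_aper x I].

Definition infinite_supports_metrizable : Prop :=
  forall (E : lmodType R[i]) (pi : A -> E -> E) (Y : set S),
    alg_irreducible pi -> ~ finite_dimensional E -> rep_support pi Y ->
    metrizable R Y.

Definition Pi_X : set (set A) := Pi_Per `|` Pi_Aper.

Definition maximal_primitive (I : set A) : Prop :=
  Pi_all I /\ forall J, Pi_all J -> I `<=` J -> J = I.

Definition associated (I : set A) (Y : set S) : Prop :=
  (exists x lambda, [/\ Per x, Y = closure (dyn_orbit x), `|lambda| = 1 &
                        is_P_per x lambda I]) \/
  (exists x, [/\ Aper x, Y = closure (dyn_orbit x) & is_P_aper x I]).

End CrossedProduct.

Arguments Pi_all {R S}.
Arguments Pi_infty {R S}.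
Arguments Pi_Per {R S}.
Arguments Pi_Aper {R S}.
Arguments Pi_X {R S}.

(* Main.v *)
(* Let pi be an algebraically irreducible representation on E and X_pi its hull.
   Although pi is not assumed continuous, a vector fixed by pi(a) forces
   |a| >= 1, because otherwise 1 - a is invertible; hence annihilators of vectors
   are closed, and relations may be checked on the monomials f delta^n.  This
   makes X_pi topologically transitive.

   If X_pi is finite it is a periodic orbit of length p.  Then delta^p is central
   in the image, hence a scalar lambda by an elementary Gelfand-Mazur argument,
   and pi is equivalent to pi_(x, lambda).  If E is finite dimensional, X_pi is
   finite.  So an infinite dimensional pi has an infinite X_pi, and when X_pi is
   metrizable Baire's theorem gives a point x with dense orbit, which must be
   aperiodic.  Sandwiching a in ker(pi) between bump functions at a point y of
   the orbit shows a(0)(y) = 0, so ker(pi) consists of the a whose coefficients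
   all vanish on X_pi, which is the kernel of pi_x^1.

   For (2), pi_(x, lambda) contains all matrix units, so its kernel is a maximal
   ideal; the other inclusions of primitive ideals are decided by their hulls. *)
Require Import Defs.
From mathcomp Require Import all_boot all_order all_algebra.
From mathcomp Require Import all_classical all_reals all_analysis.
From mathcomp Require Import complex generic_quotient fraction finmap.
From mathcomp Require Import ring lra zify.

Set Implicit Arguments.
Unset Strict Implicit.
Unset Printing Implicit Defensive.

Import Order.TTheory GRing.Theory Num.Theory.
Import numFieldNormedType.Exports.

Local Open Scope classical_set_scope.
Local Open Scope ring_scope.
Local Open Scope complex_scope.

(** * Completeness and absolutely summable families *)

(** The module [E] is a bare vector space, and this shapes the proof. An identity between bounded
    maps into a normed space passes from monomials to the whole algebra by continuity
    ([bounded_lin_eq]). In [E] it must first be rewritten as [pi (L a) w = 0] with [L] bounded from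
    the algebra to itself; then [irr_bounded_lin0] applies. The centrality of delta^p and the
    intertwiner with pi_(x, lambda) are both obtained in this form.

    For the same reason there is no normed algebra of operators in which to take a spectrum. If
    delta^p had no eigenvector, its rational functions would form a field; the size of p/q is then
    measured by the norms of algebra elements that carry q w to p w, for a fixed vector w.

    Metrizability of X_pi enters through countability: it yields countably many open sets such that
    visiting all of them makes an orbit dense. If every point is periodic, the powers of sigma
    supply a countable family of their own, and Baire's theorem in compact Hausdorff spaces shows
    that X_pi is finite. *)

Section RNorm.
Variables (R : realType) (V : normedModType R[i]).
Implicit Types (u v : V).

Lemma rnormN v : rnorm (- v) = rnorm v.
Proof. by rewrite /rnorm normrN. Qed.

Lemma rnorm_distC u v : rnorm (u - v) = rnorm (v - u).
Proof. by rewrite -rnormN opprB. Qed.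

Lemma rnormB u v : rnorm (u - v) <= rnorm u + rnorm v.
Proof. by rewrite (le_trans (rnormD _ _))// rnormN. Qed.

Lemma rnorm_sum (I : Type) (r : seq I) (P : pred I) (F : I -> V) :
  rnorm (\sum_(i <- r | P i) F i) <= \sum_(i <- r | P i) rnorm (F i).
Proof.
elim/big_ind2 : _ => [|a b c d ab cd|//]; first by rewrite rnorm0.
by rewrite (le_trans (rnormD _ _))// lerD.
Qed.

Lemma rnorm_gt0 v : v != 0 -> 0 < rnorm v.
Proof.
move=> v0; rewrite lt_neqAle rnorm_ge0 andbT eq_sym.
by apply: contra_neq v0; exact: rnorm_eq0.
Qed.

(** Positive elements of [R[i]] are real, so convergence can be tested with radii in [R]. *)
Lemma cvg_rnormP (T : Type) (F : set_system T) (FF : Filter F) (f : T -> V) (l : V) :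
  f @ F --> l <-> forall e : R, 0 < e -> \forall t \near F, rnorm (l - f t) < e.
Proof.
split=> [/cvgrPdist_lt fl e e0|fl].
  have : 0 < e%:C :> R[i] by rewrite ltcR.
  by move/fl; apply: filterS => t; rewrite -rnormE ltcR.
apply/cvgrPdist_lt => e e0.
have -> : e = (complex.Re e)%:C by rewrite RRe_real// gtr0_real.
have /fl : 0 < complex.Re e by rewrite -ltcR RRe_real// gtr0_real.
by apply: filterS => t; rewrite -rnormE ltcR.
Qed.

Lemma near_rnorm v (e : R) : 0 < e -> \forall w \near v, rnorm (v - w) < e.
Proof. by move: e; apply/cvg_rnormP; exact: cvg_id. Qed.

End RNorm.

Lemma crnormM (R : realType) (a b : R[i]) : rnorm (a * b) = rnorm a * rnorm b.
Proof. exact: (@rnormZ R R[i]). Qed.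

Lemma rnormZE (R : realType) (V : normedModType R[i]) (c : R[i]) (v : V) :
  rnorm (c *: v) = rnorm c * rnorm v.
Proof. exact: rnormZ. Qed.

Lemma rnorm_real (R : realType) (a : R) : rnorm (a%:C) = `|a|.
Proof. by apply: complexI; rewrite rnormE normc_def /= expr0n/= addr0 sqrtr_sqr. Qed.

Lemma rnorm1 (R : realType) : rnorm (1 : R[i]) = 1.
Proof. by apply: complexI; rewrite rnormE normr1. Qed.

Lemma rnorm_eq1 (R : realType) (c : R[i]) : (`|c| = 1) <-> rnorm c = 1.
Proof. by rewrite -rnormE; split => [/complexI|->]. Qed.

Lemma crnorm_le (R : realType) (a b : R) : rnorm (a +i* b) <= `|a| + `|b|.
Proof.
have -> : a +i* b = a%:C + 'i * b%:C by simpc.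
rewrite (le_trans (rnormD _ _))// crnormM !rnorm_real lerD2l.
have -> : rnorm ('i%C : R[i]) = 1.
  by apply: complexI; rewrite rnormE normc_def /= expr0n expr1n /= add0r sqrtr1.
by rewrite mul1r.
Qed.

Lemma Re_le_rnorm (R : realType) (c : R[i]) : `|complex.Re c| <= rnorm c.
Proof.
case: c => a b /=; rewrite -lecR rnormE normc_def lecR /= -sqrtr_sqr ler_wsqrtr//.
by rewrite lerDl sqr_ge0.
Qed.

Lemma Im_le_rnorm (R : realType) (c : R[i]) : `|complex.Im c| <= rnorm c.
Proof.
case: c => a b /=; rewrite -lecR rnormE normc_def lecR /= -sqrtr_sqr ler_wsqrtr//.
by rewrite lerDr sqr_ge0.
Qed.

Section Completeness.
Variable R : realType.

Definition rnorm_bounded (V : normedModType R[i]) (u : nat -> V) :=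
  exists M : R, forall n, \sum_(k < n) rnorm (u k) <= M.

(* R[i] has no canonical complete structure, so completeness is a predicate. *)
Definition abs_complete (V : normedModType R[i]) :=
  forall u : nat -> V, rnorm_bounded u -> cvgn (series u).

Definition rnorm_tail (V : normedModType R[i]) (u : nat -> V) (n : nat) : R :=
  limn (series (fun k => rnorm (u k))) - series (fun k => rnorm (u k)) n.

Section Tail.
Variables (V : normedModType R[i]) (u : nat -> V).
Hypothesis ub : rnorm_bounded u.

Lemma rnorm_bounded_cvg : cvgn (series (fun k => rnorm (u k))).
Proof.
have [M uM] := ub.
apply: nondecreasing_is_cvgn.
  by apply/nondecreasing_seqP => n; rewrite seriesSr lerDl rnorm_ge0.
by exists M => _ [n _ <-]; rewrite /series/= big_mkord.
Qed.

Lemma rnorm_tail_cvg0 : rnorm_tail u n @[n --> \oo] --> (0 : R).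
Proof.
rewrite -(subrr (limn (series (fun k => rnorm (u k))))).
by apply: cvgB; [exact: cvg_cst|exact: rnorm_bounded_cvg].
Qed.

Lemma rnorm_tail_small (e : R) : 0 < e -> \forall n \near \oo, rnorm_tail u n < e.
Proof.
move=> e0; have /cvgrPdist_lt/(_ _ e0) := rnorm_tail_cvg0.
by apply: filterS => n; rewrite sub0r normrN => /ltr_normlW.
Qed.

Lemma rnorm_sum_tail n m : (n <= m)%N ->
  \sum_(n <= k < m) rnorm (u k) <= rnorm_tail u n.
Proof.
move=> nm; rewrite /rnorm_tail lerBrDl /series /= -big_cat_nat//=.
apply: (@nondecreasing_cvgn_le _ (series (fun k => rnorm (u k)))).
  by apply/nondecreasing_seqP => k; rewrite seriesSr lerDl rnorm_ge0.
exact: rnorm_bounded_cvg.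
Qed.

Lemma rnorm_tail_ge0 n : 0 <= rnorm_tail u n.
Proof. by rewrite (le_trans _ (rnorm_sum_tail (leqnn n)))// big_geq. Qed.

Lemma rnorm_lim_le (W : normedModType R[i]) (w : nat -> W) (l : W) (b : R) :
  w @ \oo --> l -> (\forall n \near \oo, rnorm (w n) <= b) -> rnorm l <= b.
Proof.
move=> wl wb; apply/ler_addgt0Pr => e e0.
move/cvg_rnormP : wl => /(_ _ e0) we; near \oo => n.
rewrite -(subrK (w n) l) (le_trans (rnormD _ _))// addrC lerD//.
  by near: n.
by apply: ltW; near: n.
Unshelve. all: by end_near. Qed.

(** The bound depends only on the dominating [u]; this uniformity turns pointwise limits into norm
    limits in C(X) and in column spaces. *)
Lemma rnorm_series_tail (W : normedModType R[i]) (w : nat -> W) l n :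
  (forall k, rnorm (w k) <= rnorm (u k)) -> series w @ \oo --> l ->
  rnorm (l - series w n) <= rnorm_tail u n.
Proof.
move=> wu wl; apply: (@rnorm_lim_le _ (fun m => series w m - series w n)).
  by apply: cvgB => //; exact: cvg_cst.
near=> m; have nm : (n <= m)%N by near: m; exact: nbhs_infty_ge.
rewrite sub_series_geq// (le_trans (rnorm_sum _ _ _))//.
by rewrite (le_trans _ (rnorm_sum_tail nm))// ler_sum.
Unshelve. all: by end_near. Qed.

End Tail.

Lemma complex_abs_complete : abs_complete R[i].
Proof.
move=> u [M uM].
have cv (p : R[i] -> R) : (forall c, `|p c| <= rnorm c) -> cvgn (series (p \o u)).
  move=> pu; apply: normed_cvg; change (cvgn (series (fun k => `|p (u k)|))).
  apply: nondecreasing_is_cvgn.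
    by apply/nondecreasing_seqP => n; rewrite seriesSr lerDl.
  exists M => _ [n _ <-]; rewrite /series/= big_mkord.
  by rewrite (le_trans _ (uM n))// ler_sum.
have /cvg_ex[a ua] := cv _ (@Re_le_rnorm R).
have /cvg_ex[b ub] := cv _ (@Im_le_rnorm R).
apply/cvg_ex; exists (a +i* b); apply/cvg_rnormP => e e0.
have e20 : 0 < e / 2 by rewrite divr_gt0.
move/cvgrPdist_lt : ua => /(_ _ e20) ua.
move/cvgrPdist_lt : ub => /(_ _ e20) ub.
near=> n.
have -> : series u n = (series (@complex.Re R \o u) n) +i* (series (@complex.Im R \o u) n).
  by rewrite /series/= -!(raddf_sum (@complex.Re R)) -!(raddf_sum (@complex.Im R)); case: (\sum_(_ <= _ < _) _).
rewrite [_ - _](_ : _ = (a - series (@complex.Re R \o u) n) +i* (b - series (@complex.Im R \o u) n)); last by simpc.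
rewrite (le_lt_trans (crnorm_le _ _))// (splitr e) ltrD//; by near: n.
Unshelve. all: by end_near. Qed.

End Completeness.

Lemma rnorm_bounded_le (R : realType) (V W : normedModType R[i]) (u : nat -> V)
    (w : nat -> W) :
  (forall k, rnorm (w k) <= rnorm (u k)) -> rnorm_bounded u -> rnorm_bounded w.
Proof.
by move=> wu [M uM]; exists M => n; rewrite (le_trans _ (uM n))// ler_sum.
Qed.

Section CfunComplete.
Variables (R : realType) (S : dynsys).
Local Notation CX := (cfun R S).

Lemma cfun_sumE (I : Type) (r : seq I) (P : pred I) (F : I -> CX) x :
  (\sum_(i <- r | P i) F i) x = \sum_(i <- r | P i) F i x.
Proof. by elim/big_rec2 : _ => // i a b _ <-. Qed.

Lemma cfunDE (f g : CX) x : (f + g) x = f x + g x. Proof. by []. Qed.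
Lemma cfunNE (f : CX) x : (- f) x = - f x. Proof. by []. Qed.
Lemma cfunBE (f g : CX) x : (f - g) x = f x - g x. Proof. by []. Qed.
Lemma cfunME (f g : CX) x : (f * g) x = f x * g x. Proof. by []. Qed.
Lemma cfunZE c (f : CX) x : (c *: f) x = c * f x. Proof. by []. Qed.
Lemma cfun1E x : (1 : CX) x = 1. Proof. by []. Qed.
Lemma cfun0E x : (0 : CX) x = 0. Proof. by []. Qed.
Definition cfunE := (cfunDE, cfunNE, cfunME, cfunZE, cfun1E, cfun0E).

Lemma rnorm_eval (f : CX) x : rnorm (f x) <= rnorm f.
Proof. exact: sup_norm_ub. Qed.

Lemma cfun_abs_complete : abs_complete CX.
Proof.
move=> u ub; pose w x k := u k x.
have wu x k : rnorm (w x k) <= rnorm (u k) by exact: rnorm_eval.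
have wc x : cvgn (series (w x)).
  by apply: complex_abs_complete; exact: rnorm_bounded_le (wu x) ub.
pose l x := limn (series (w x)).
have sE n x : series u n x = series (w x) n by rewrite /series/= cfun_sumE.
have lt n x : rnorm (l x - series u n x) <= rnorm_tail u n.
  by rewrite sE; apply: rnorm_series_tail => //; exact: wc.
have lc : continuous l.
  move=> x; apply/cvg_rnormP => e e0.
  have e40 : 0 < e / 4 by rewrite divr_gt0.
  near \oo => n.
  have nt : rnorm_tail u n < e / 4 by near: n; exact: rnorm_tail_small.
  have /cvg_rnormP/(_ _ e40) := @cfun_continuous R S (series u n) x.
  apply: filterS => y xy.
  have -> : l x - l y = (l x - series u n x) + (series u n x - series u n y)
                      + (series u n y - l y).
    by ring.
  rewrite (le_lt_trans (rnormD _ _))//.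
  rewrite (le_lt_trans (lerD (rnormD _ _) (lexx _)))//.
  have h1 := le_lt_trans (lt n x) nt; have h2 := le_lt_trans (lt n y) nt.
  rewrite (rnorm_distC (series u n y)).
  have := ltrD (ltrD h1 xy) h2; move/lt_trans; apply; lra.
apply/cvg_ex; exists (mk_cfun lc); apply/cvg_rnormP => e e0.
have := rnorm_tail_small ub e0; apply: filterS => n; apply: le_lt_trans.
by rewrite rnorm_cfunE; apply: sup_norm_le => x; exact: lt.
Unshelve. all: by end_near. Qed.

End CfunComplete.

Section Ell1Theory.
Variables (R : realType) (V : normedModType R[i]).
Implicit Types (u : int -> V) (a b : ell1 V).

Lemma rnorm_ell1E a : rnorm a = ell1_norm a.
Proof. by []. Qed.

Lemma ell1_mass_le u (M : R) :
  (forall s : seq int, uniq s -> \sum_(n <- s) rnorm (u n) <= M) ->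
  (ell1_mass u <= M%:E)%E.
Proof.
move=> uM; apply: ge_ereal_sup => _ [X [finX _] <-].
by rewrite fsbig_finite// sumEFin lee_fin; apply: uM; exact: fset_uniq.
Qed.

Lemma ell1_norm_le a (M : R) :
  (forall s : seq int, uniq s -> \sum_(n <- s) rnorm (a n) <= M) ->
  rnorm a <= M.
Proof. by move/ell1_mass_le; rewrite -ell1_normE lee_fin. Qed.

Lemma ell1_sum_le a (s : seq int) : uniq s -> \sum_(n <- s) rnorm (a n) <= rnorm a.
Proof.
move=> us; rewrite rnorm_ell1E -lee_fin ell1_normE -sumEFin.
apply: ereal_sup_ubound; exists [set` s].
  by split => //; exact: finite_seq.
by rewrite -fsbig_seq.
Qed.

Lemma ell1_sum_dominated (u : int -> V) (M : R) :
  (forall s : seq int, uniq s -> \sum_(n <- s) rnorm (u n) <= M) ->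
  exists2 a : ell1 V, a =1 u & rnorm a <= M.
Proof.
move=> uM.
have up : u \in @ell1_pred R V.
  by rewrite unfold_in (le_lt_trans (ell1_mass_le uM))// ltry.
by exists (Ell1 up) => //; exact: ell1_norm_le.
Qed.

Lemma rnorm_ell1_eval a n : rnorm (a n) <= rnorm a.
Proof. by have := @ell1_sum_le a [:: n] isT; rewrite big_seq1. Qed.

Lemma ell1_sumE (I : Type) (r : seq I) (P : pred I) (F : I -> ell1 V) n :
  (\sum_(i <- r | P i) F i) n = \sum_(i <- r | P i) F i n.
Proof. by elim/big_rec2 : _ => // i a b _ <-. Qed.

Lemma ell1_abs_complete : abs_complete V -> abs_complete (ell1 V).
Proof.
move=> cV u ub; pose w n k := u k n.
have wu n k : rnorm (w n k) <= rnorm (u k) by exact: rnorm_ell1_eval.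
have wc n : cvgn (series (w n)).
  by apply: cV; exact: rnorm_bounded_le (wu n) ub.
pose l n := limn (series (w n)).
have sE k n : series u k n = series (w n) k by rewrite /series/= ell1_sumE.
(* On finitely many coordinates the limit commutes with the sum; as the bound does not depend on
   [s], it becomes a bound in the norm of [ell1]. *)
have lt k s : uniq s -> \sum_(n <- s) rnorm (l n - series u k n) <= rnorm_tail u k.
  move=> us; pose S m := \sum_(n <- s) rnorm (series u m n - series u k n).
  have Sc : S @ \oo --> \sum_(n <- s) rnorm (l n - series u k n).
    rewrite /S; apply: cvg_big => [|n _]; first exact: (@add_continuous R^o).
    apply: continuous_cvg; first exact: rnorm_continuous.
    apply: cvgB; last exact: cvg_cst.
    by under eq_cvg do rewrite sE; exact: wc.
  rewrite -(cvg_lim _ Sc)//; apply: limr_le; first by apply/cvg_ex; eexists; exact: Sc.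
  near=> m; have km : (k <= m)%N by near: m; exact: nbhs_infty_ge.
  have -> : S m = \sum_(n <- s) rnorm ((series u m - series u k) n) by [].
  rewrite (le_trans (ell1_sum_le _ us))// sub_series_geq//.
  by rewrite (le_trans (rnorm_sum _ _ _))// rnorm_sum_tail.
(* The empty partial sum [k = 0] turns [lt] into a bound on [l] itself, which places [l] in
   [ell1]. *)
have [a al aM] : exists2 a : ell1 V, a =1 l & rnorm a <= rnorm_tail u 0.
  apply: ell1_sum_dominated => s us; rewrite (le_trans _ (lt 0%N s us))//.
  by apply: ler_sum => n _; rewrite sE /series/= big_geq// subr0.
apply/cvg_ex; exists a; apply/cvg_rnormP => e e0.
have := rnorm_tail_small ub e0; apply: filterS => k; apply: le_lt_trans.
apply: ell1_norm_le => s us; apply: le_trans (lt k s us).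
by apply: ler_sum => n _; rewrite -al.
Unshelve. all: by end_near. Qed.

End Ell1Theory.

(** * Density of finite sums of monomials *)

Section Density.
Variables (R : realType) (V : normedModType R[i]).
Implicit Types (a b : ell1 V).

Lemma ell1_singleE n (v : V) m : ell1_single n v m = if m == n then v else 0.
Proof. by []. Qed.

Lemma ell1_sum_singleE a (s : seq int) m : uniq s ->
  (\sum_(n <- s) ell1_single n (a n)) m = if m \in s then a m else 0.
Proof.
move=> us; rewrite ell1_sumE; case: ifPn => ms.
  rewrite (bigD1_seq m)//= eqxx big1 ?addr0// => n nm.
  by rewrite eq_sym (negbTE nm).
rewrite big1_seq// => n /= ns; case: eqP => // mn.
by rewrite mn ns in ms.
Qed.

Lemma ell1_single_linear n : linear (@ell1_single R V n).
Proof.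
move=> c u v; apply: ell1P => m.
have -> : (c *: ell1_single n u + ell1_single n v) m =
          c *: ell1_single n u m + ell1_single n v m by [].
by rewrite !ell1_singleE; case: eqP => // _; rewrite scaler0 addr0.
Qed.

Lemma rnorm_single n (v : V) : rnorm (ell1_single n v) = rnorm v.
Proof.
apply/eqP; rewrite eq_le; apply/andP; split.
  apply: ell1_norm_le => s us; have [ns|ns] := boolP (n \in s).
    rewrite (bigD1_seq n)//= eqxx big1 ?addr0// => m mn.
    by rewrite (negbTE mn) rnorm0.
  rewrite big1_seq ?rnorm_ge0// => m /= ms.
  by case: eqP => [mn|_]; [rewrite -mn ms in ns|rewrite rnorm0].
by have := rnorm_ell1_eval (ell1_single n v) n; rewrite ell1_singleE eqxx.
Qed.

(** Once [s] carries all but [e] of the norm, the mass outside any larger [t] is at most [e].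
    Quantifying over [t] lets later arguments force the index 0 into the finite set. *)
Lemma ell1_approx a (e : R) : 0 < e -> exists2 s : seq int, uniq s &
  forall t, uniq t -> {subset s <= t} ->
    rnorm (a - \sum_(n <- t) ell1_single n (a n)) <= e.
Proof.
move=> e0.
have [s us se] : exists2 s : seq int, uniq s &
    rnorm a - e <= \sum_(n <- s) rnorm (a n).
  apply: contrapT => /forall2NP h.
  have : rnorm a <= rnorm a - e.
    apply: ell1_norm_le => s us; case: (h s) => [/(_ us)[]|/negP].
    by rewrite -ltNge => /ltW.
  by rewrite leNgt ltrBlDr ltrDl e0.
exists s => // t ut st.
have sub : \sum_(n <- s) rnorm (a n) <= \sum_(n <- t) rnorm (a n).
  rewrite [leRHS](bigID (mem s))/= -[X in _ <= X + _]big_filter.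
  rewrite [X in _ <= X + _](perm_big s); last first.
    apply: uniq_perm => [||n]; rewrite ?filter_uniq//.
    by rewrite mem_filter /=; case: (boolP (n \in s)) => // /st ->.
  by rewrite lerDl sumr_ge0// => n _; exact: rnorm_ge0.
apply: ell1_norm_le => r ur.
have dE n : rnorm ((a - \sum_(n <- t) ell1_single n (a n)) n) =
    if n \in t then 0 else rnorm (a n).
  have -> : (a - \sum_(n <- t) ell1_single n (a n)) n =
    a n - (\sum_(n <- t) ell1_single n (a n)) n by [].
  by rewrite ell1_sum_singleE//; case: ifP; rewrite ?subrr ?rnorm0 ?subr0.
under eq_bigr do rewrite dE.
rewrite (bigID (mem t))/= big1 ?add0r => [|n ->//].
rewrite (eq_bigr (fun n => rnorm (a n))) => [|n /negbTE ->//].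
rewrite -big_filter; have : uniq ([seq n <- r | n \notin t] ++ t).
  rewrite cat_uniq filter_uniq// ut andbT /=; apply/hasPn => n nt /=.
  by rewrite mem_filter /= nt.
move/(ell1_sum_le a); rewrite big_cat/=; move: se sub; lra.
Qed.

Lemma ell1_dense (M : set (ell1 V)) a :
  M 0 -> (forall b c, M b -> M c -> M (b + c)) ->
  (forall b, (forall e : R, 0 < e -> exists2 c, M c & rnorm (b - c) <= e) -> M b) ->
  (forall n, M (ell1_single n (a n))) -> M a.
Proof.
move=> M0 MD Mcl Ma; apply: Mcl => e /(ell1_approx a)[s us /(_ s us)]; move=> h.
exists (\sum_(n <- s) ell1_single n (a n)); last by apply: h.
by elim/big_ind : _ => // n _; exact: Ma.
Qed.

(** The crude constant [C] serves as continuity; density then improves it to the constant [K] valid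
    on monomials. *)
Lemma ell1_seminorm_le (N : ell1 V -> R) (C K : R) :
  0 <= K -> (forall a b, N (a + b) <= N a + N b) ->
  (forall a, N a <= C * rnorm a) ->
  (forall n v, N (ell1_single n v) <= K * rnorm v) ->
  forall a, N a <= K * rnorm a.
Proof.
move=> K0 ND NC NK a; apply/ler_addgt0Pr => e e0.
have C0 : 0 < `|C| + 1 by rewrite ltr_wpDl.
have [s us /(_ s us) h] := ell1_approx a (divr_gt0 e0 C0).
have {h} := h (fun=> id); set b := \sum_(n <- s) _ => h.
rewrite -[X in N X](subrK b a) (le_trans (ND _ _))// addrC lerD//.
  apply: (@le_trans _ _ (\sum_(n <- s) K * rnorm (a n))); last first.
    by rewrite -mulr_sumr ler_wpM2l// ell1_sum_le.
  rewrite /b; elim: s {us b h} => [|n s IH].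
    by rewrite !big_nil (le_trans (NC 0))// rnorm0 mulr0.
  by rewrite !big_cons (le_trans (ND _ _))// lerD.
rewrite (le_trans (NC _))// (@le_trans _ _ ((`|C| + 1) * rnorm (a - b)))//.
  by rewrite ler_wpM2r ?rnorm_ge0// (le_trans (ler_norm C))// lerDl.
by rewrite mulrC -ler_pdivlMr.
Qed.

Section Bounded.
Variable W : normedModType R[i].

Definition bounded_lin (L : ell1 V -> W) :=
  linear L /\ exists K : R, forall a, rnorm (L a) <= K * rnorm a.

Lemma bounded_lin_comb (c : R[i]) (L1 L2 : ell1 V -> W) :
  bounded_lin L1 -> bounded_lin L2 -> bounded_lin (fun a => c *: L1 a + L2 a).
Proof.
move=> [l1 [K1 b1]] [l2 [K2 b2]]; split=> [d a b|].
  by rewrite l1 l2 !scalerDr !scalerA (mulrC c) addrACA.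
exists (rnorm c * K1 + K2) => a; rewrite mulrDl (le_trans (rnormD _ _))// lerD//.
by rewrite rnormZE -mulrA ler_wpM2l ?rnorm_ge0.
Qed.

Lemma bounded_lin0 (L : ell1 V -> W) : bounded_lin L ->
  (forall n v, L (ell1_single n v) = 0) -> forall a, L a = 0.
Proof.
move=> [lL [K LK]] Ls a.
have L0 : L 0 = 0 by have := lL (-1) 0 0; rewrite !scaleN1r !addNr.
have LD b c : L (b + c) = L b + L c by have := lL 1 b c; rewrite !scale1r.
apply: (@ell1_dense (fun b => L b = 0)) => //.
- by move=> b c Lb Lc; rewrite LD Lb Lc addr0.
- move=> b bM; apply: rnorm_eq0; apply/eqP; rewrite eq_le rnorm_ge0 andbT.
  apply/ler_addgt0Pr => e e0; rewrite add0r.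
  have K0 : 0 < `|K| + 1 by rewrite ltr_wpDl.
  have [c Lc bc] := bM (e / (`|K| + 1)) (divr_gt0 e0 K0).
  have -> : L b = L (b - c) by have := LD (b - c) c; rewrite subrK Lc addr0.
  rewrite (le_trans (LK _))// (@le_trans _ _ ((`|K| + 1) * rnorm (b - c)))//.
    rewrite ler_wpM2r ?rnorm_ge0// (le_trans (ler_norm K))// lerDl//.
  by rewrite mulrC -ler_pdivlMr.
Qed.

(** Multilinear identities, such as associativity of convolution, follow by applying this once per
    variable. *)
Lemma bounded_lin_eq (L1 L2 : ell1 V -> W) : bounded_lin L1 -> bounded_lin L2 ->
  (forall n v, L1 (ell1_single n v) = L2 (ell1_single n v)) -> L1 =1 L2.
Proof.
move=> b1 b2 L12 a; apply/eqP; rewrite -subr_eq0 addrC -scaleN1r; apply/eqP.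
by apply: (bounded_lin0 (bounded_lin_comb (-1) b2 b1)) => n v; rewrite L12 scaleN1r addNr.
Qed.

End Bounded.
End Density.

Lemma bounded_lin_sum (R : realType) (V W : normedModType R[i]) (n : nat)
    (L : 'I_n -> ell1 V -> W) :
  (forall j, bounded_lin (L j)) -> bounded_lin (fun a => \sum_j L j a).
Proof.
move=> bL; split=> [c a b|].
  rewrite scaler_sumr -big_split; apply: eq_bigr => j _.
  by have [lL _] := bL j; rewrite lL.
have [K LK] := choice (fun j => proj2 (bL j)); exists (\sum_j K j) => a.
rewrite (le_trans (rnorm_sum _ _ _))// mulr_suml; apply: ler_sum => j _.
exact: LK.
Qed.

Lemma bounded_lin_scale (R : realType) (V W : normedModType R[i])
    (L : ell1 V -> R[i]) (w : W) :
  bounded_lin L -> bounded_lin (fun a => L a *: w).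
Proof.
move=> [lL [K LK]]; split=> [c a b|]; first by rewrite lL scalerDl scalerA.
by exists (K * rnorm w) => a; rewrite rnormZE mulrAC ler_wpM2r ?rnorm_ge0.
Qed.

Lemma bounded_lin_comp (R : realType) (V V' W : normedModType R[i])
    (L : ell1 V -> ell1 V') (L' : ell1 V' -> W) :
  bounded_lin L -> bounded_lin L' -> bounded_lin (L' \o L).
Proof.
move=> [lL [K LK]] [lL' [K' LK']]; split=> [c a b|/=]; first by rewrite /= lL lL'.
exists (`|K'| * K) => a /=; rewrite (le_trans (LK' _))//.
rewrite (@le_trans _ _ (`|K'| * rnorm (L a)))//.
  by rewrite ler_wpM2r ?rnorm_ge0// ler_norm.
by rewrite -mulrA ler_wpM2l.
Qed.

(** * Summation over the integers *)

Section Zsum.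
Variables (R : realType) (V : normedModType R[i]).
Hypothesis cV : abs_complete V.
Implicit Types (a b : ell1 V).

Definition zpartial (u : int -> V) (n : nat) : V :=
  \sum_(k < n) u (Posz k) + \sum_(k < n) u (Negz k).

(** The window from [-n] to [n - 1] as one duplicate-free list, so that [ell1_sum_le] applies to
    both halves at once. *)
Lemma zpartial_seq n : exists2 s : seq int, uniq s &
  forall (W : zmodType) (F : int -> W),
  \sum_(k < n) F (Posz k) + \sum_(k < n) F (Negz k) = \sum_(k <- s) F k.
Proof.
exists (map Posz (iota 0 n) ++ map Negz (iota 0 n)).
  rewrite cat_uniq !map_inj_uniq ?iota_uniq ?andbT//=; try by move=> ? ? [].
  by apply/hasPn => _ /mapP[k _ ->]; apply/negP => /mapP[].
move=> W F; rewrite big_cat !big_map /=.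
rewrite -(big_mkord xpredT (fun k => F (Posz k))).
by rewrite -(big_mkord xpredT (fun k => F (Negz k))) /index_iota subn0.
Qed.

Lemma zpartial_cvg a : zpartial a @ \oo --> zsum a.
Proof.
have zE : zpartial a = fun n => series (fun k => a (Posz k)) n +
                       series (fun k => a (Negz k)) n.
  by apply/funext => n; rewrite /zpartial /series/= !big_mkord.
have h n : \sum_(k < n) rnorm (a (Posz k)) + \sum_(k < n) rnorm (a (Negz k)) <= rnorm a.
  by have [s us sE] := zpartial_seq n; rewrite (sE R (fun k => rnorm (a k))); exact: ell1_sum_le.
have s0 (f : nat -> int) n : 0 <= \sum_(k < n) rnorm (a (f k)).
  by apply: sumr_ge0 => k _; exact: rnorm_ge0.
rewrite zE; apply: cvgD; apply: cV; exists (rnorm a) => n.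
  by rewrite (le_trans _ (h n))// lerDl s0.
by rewrite (le_trans _ (h n))// lerDr s0.
Qed.

Lemma zsum_linear c a b : zsum (c *: a + b : ell1 V) = c *: zsum a + zsum b.
Proof.
have h1 := @zpartial_cvg (c *: a + b).
have h2 : zpartial (c *: a + b : ell1 V) @ \oo --> c *: zsum a + zsum b.
  have -> : zpartial (c *: a + b : ell1 V) = fun n => c *: zpartial a n + zpartial b n.
    apply/funext => n; rewrite /zpartial scalerDr !scaler_sumr addrACA -!big_split.
    by [].
  by apply: cvgD; [apply: cvgZr|]; exact: zpartial_cvg.
exact: (@cvg_unique _ (@norm_hausdorff _ V) _ _ _ _ h1 h2).
Qed.

Lemma rnorm_zsum_le a : rnorm (zsum a) <= rnorm a.
Proof.
apply: (rnorm_lim_le (@zpartial_cvg a)); apply: nearW => n.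
rewrite (le_trans (rnormD _ _))//.
rewrite (le_trans (lerD (rnorm_sum _ _ _) (rnorm_sum _ _ _)))//.
by have [s us sE] := zpartial_seq n; rewrite (sE R (fun k => rnorm (a k))); exact: ell1_sum_le.
Qed.

Lemma zpartial_single n (v : V) m : (`|n| < m)%N -> zpartial (ell1_single n v) m = v.
Proof.
have kE (k : nat) (f : nat -> int) (fi : injective f) : (k < m)%N ->
    \sum_(j < m) ell1_single (f k) v (f j) = v.
  move=> km; rewrite (bigD1 (Ordinal km))//= eqxx big1 ?addr0// => j jk.
  by rewrite (inj_eq fi) -(inj_eq val_inj) in jk *; rewrite (negbTE jk).
rewrite /zpartial; case: n => n nm.
  rewrite (kE n Posz) => [|? ? []|//]//; first by rewrite big1 ?addr0.
rewrite (kE n Negz) => [|? ? []|]//; last exact: ltnW.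
by rewrite big1 ?add0r.
Qed.

Lemma zsum_single n (v : V) : zsum (ell1_single n v) = v.
Proof.
have h1 := @zpartial_cvg (ell1_single n v).
have h2 : zpartial (ell1_single n v) @ \oo --> v.
  apply: cvg_near_cst; near=> m; rewrite /zpartial.
  have nm : (`|n| < m)%N by near: m; exact: nbhs_infty_gt.
  exact: zpartial_single.
exact: (@cvg_unique _ (@norm_hausdorff _ V) _ _ _ _ h1 h2).
Unshelve. all: by end_near. Qed.

End Zsum.

Section Zint.
Variables (R : realType) (V W : normedModType R[i]).
Hypothesis cW : abs_complete W.
Variables (Phi : int -> V -> W) (M : R).
Hypothesis linPhi : forall k, linear (Phi k).
Hypothesis PhiM : forall k v, rnorm (Phi k v) <= M * rnorm v.

Lemma zint_summable (a : ell1 V) : exists2 b : ell1 W,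
  b =1 (fun k => Phi k (a k)) & rnorm b <= M * rnorm a.
Proof.
apply: ell1_sum_dominated => s us.
apply: (@le_trans _ _ (\sum_(n <- s) M * rnorm (a n))); first exact: ler_sum.
rewrite -mulr_sumr; have [M0|M0] := leP 0 M.
  by rewrite ler_wpM2l// ell1_sum_le.
(* A negative [M] forces every vector of [V] to be zero, and both sides vanish. *)
have v0 (v : V) : rnorm v = 0.
  apply/eqP; rewrite eq_le rnorm_ge0 andbT -(ler_nM2l M0) mulr0.
  exact: le_trans (rnorm_ge0 _) (PhiM 0 v).
have -> : rnorm a = 0.
  apply/eqP; rewrite eq_le rnorm_ge0 andbT; apply: ell1_norm_le => t _.
  by rewrite big1.
by rewrite big1 ?mulr0.
Qed.

(** Integration of [a] against a uniformly bounded family of linear maps; convolution by a fixed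
    right factor and the representation of a covariant pair are both of this kind. *)
Definition zint (a : ell1 V) : W := zsum (fun k => Phi k (a k)).

Lemma zint_le a : rnorm (zint a) <= M * rnorm a.
Proof.
have [b ba bM] := zint_summable a.
rewrite /zint -(funext ba); exact: le_trans (rnorm_zsum_le cW b) bM.
Qed.

Lemma zint_linear : linear zint.
Proof.
move=> c a b; have [a' /funext aE _] := zint_summable a.
have [b' /funext bE _] := zint_summable b.
rewrite /zint -aE -bE -(zsum_linear cW); congr zsum; apply/funext => k.
have -> : (c *: a' + b' : ell1 W) k = c *: a' k + b' k by [].
by rewrite aE bE -linPhi.
Qed.

Lemma zint_bounded : bounded_lin zint.
Proof. by split; [exact: zint_linear|exists M; exact: zint_le]. Qed.

Lemma zint_single n v : zint (ell1_single n v) = Phi n v.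
Proof.
rewrite /zint -[RHS](zsum_single cW n); congr zsum; apply/funext => k.
rewrite !ell1_singleE; case: eqP => [->//|_].
by have := linPhi k (-1) 0 0; rewrite !scaleN1r !addNr.
Qed.

End Zint.

(** * The Banach algebra *)

Notation "a ** b" := (ell1_mul a b) (at level 40, left associativity) : ring_scope.

Section Iterates.
Variable S : dynsys.
Implicit Types (x : S) (m n : int).

Lemma dyn_iterD1 n x : dyn_iter (n + 1) x = dyn_map (dyn_iter n x).
Proof.
case: n => [k|[|k]].
- by rewrite -PoszD addn1.
- by rewrite /= dyn_invK.
- have -> : Negz k.+1 + 1 = Negz k by rewrite !NegzE; lia.
  by rewrite /= dyn_invK.
Qed.

Lemma dyn_iterB1 n x : dyn_iter (n - 1) x = dyn_inv (dyn_iter n x).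
Proof. by rewrite -[in RHS](subrK 1 n) dyn_iterD1 dyn_mapK. Qed.

Lemma dyn_iterD m n x : dyn_iter (m + n) x = dyn_iter m (dyn_iter n x).
Proof.
elim: m => [|m IH|m IH]; first by rewrite add0r.
  have -> : m.+1%:Z + n = (m%:Z + n) + 1 by lia.
  by rewrite dyn_iterD1 IH -dyn_iterD1; congr (dyn_iter _ _); lia.
have -> : - m.+1%:Z + n = (- m%:Z + n) - 1 by lia.
by rewrite dyn_iterB1 IH -dyn_iterB1; congr (dyn_iter _ _); lia.
Qed.

Lemma dyn_iterK n : cancel (dyn_iter n : S -> S) (dyn_iter (- n)).
Proof. by move=> x; rewrite -dyn_iterD addNr. Qed.

Lemma dyn_iterNK n : cancel (dyn_iter (- n) : S -> S) (dyn_iter n).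
Proof. by move=> x; rewrite -dyn_iterD subrr. Qed.

End Iterates.

(** * Convolution and the Neumann series *)

Section Algebra.
Variables (R : realType) (S : dynsys).
Local Notation CX := (cfun R S).
Local Notation A := (ell1 CX).
Implicit Types (f g : CX) (a b c : A) (k m n : int).

Lemma alphaE k f x : alpha k f x = f (dyn_iter (- k) x).
Proof. by []. Qed.

Lemma alpha_linear k : linear (@alpha R S k).
Proof. by move=> c f g; apply: cfunP. Qed.

Lemma alphaM k f g : alpha k (f * g) = alpha k f * alpha k g.
Proof. exact: cfunP. Qed.

Lemma alpha1 k : alpha k (1 : CX) = 1.
Proof. exact: cfunP. Qed.

Lemma alpha_0 k : alpha k (0 : CX) = 0.
Proof. exact: cfunP. Qed.

Lemma alpha_id f : alpha 0 f = f.
Proof. exact: cfunP. Qed.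

Lemma alpha_comp m n f : alpha m (alpha n f) = alpha (m + n) f.
Proof. by apply: cfunP => x; rewrite !alphaE opprD addrC dyn_iterD. Qed.

Lemma cfun_mul_linearl g : linear (fun f : CX => f * g).
Proof. by move=> c f f'; apply: cfunP => x; rewrite !cfunE mulrDl mulrA. Qed.

Let Phi b n k (f : CX) : CX := f * alpha k (b (n - k)).

Let Phi_linear b n k : linear (Phi b n k).
Proof. exact: cfun_mul_linearl. Qed.

Let Phi_le b n k f : rnorm (Phi b n k f) <= rnorm b * rnorm f.
Proof.
rewrite (le_trans (rnorm_mul _ _))// mulrC ler_wpM2r ?rnorm_ge0//.
by rewrite (le_trans (rnorm_alpha _ _))// rnorm_ell1_eval.
Qed.

Lemma ell1_mul_linearl b : linear (fun a : A => a ** b).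
Proof.
move=> c a a'; apply: ell1P => n.
exact: (zint_linear (@cfun_abs_complete R S) (@Phi_linear b n) (@Phi_le b n)).
Qed.

Lemma ell1_single_mulE m f b n : (ell1_single m f ** b) n = f * alpha m (b (n - m)).
Proof. exact: (zint_single (@cfun_abs_complete R S) (@Phi_linear b n)). Qed.

Lemma rnorm_ell1_mul a b : rnorm (a ** b) <= rnorm a * rnorm b.
Proof.
apply: ell1_norm_le => s us; rewrite mulrC; move: a.
(* The crude constant counts [rnorm b] once for each coordinate in [s]; the sharp one comes from
   monomials. *)
apply: (@ell1_seminorm_le _ _ _ (\sum_(n <- s) rnorm b)); first exact: rnorm_ge0.
- move=> a a'; rewrite -big_split/=; apply: ler_sum => n _.
  change (rnorm (((a + a') ** b) n) <= rnorm ((a ** b) n) + rnorm ((a' ** b) n)).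
  have -> : (a + a') ** b = a ** b + a' ** b.
    by have := ell1_mul_linearl b 1 a a'; rewrite !scale1r.
  exact: rnormD.
- move=> a; rewrite mulr_suml; apply: ler_sum => n _.
  exact: (zint_le (@cfun_abs_complete R S) (@Phi_le b n)).
- move=> k f; under eq_bigr do rewrite ell1_single_mulE.
  apply: (@le_trans _ _ (\sum_(n <- s) rnorm f * rnorm (b (n - k)))).
    apply: ler_sum => n _; rewrite (le_trans (rnorm_mul _ _))//.
    by rewrite ler_wpM2l ?rnorm_ge0// rnorm_alpha.
  rewrite -mulr_sumr mulrC ler_wpM2r ?rnorm_ge0//.
  rewrite -(big_map (fun n => n - k) xpredT (fun n => rnorm (b n))).
  by apply: ell1_sum_le; rewrite map_inj_uniq//; exact: addIr.
Qed.

Lemma ell1_mul_boundedl b : bounded_lin (fun a : A => a ** b).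
Proof.
split; first exact: ell1_mul_linearl.
by exists (rnorm b) => a; rewrite mulrC rnorm_ell1_mul.
Qed.

Lemma ell1_mul_linearr a : linear (fun b : A => a ** b).
Proof.
move=> c b b'; move: a; apply: bounded_lin_eq => [||m f].
- exact: ell1_mul_boundedl.
- exact: bounded_lin_comb (ell1_mul_boundedl _) (ell1_mul_boundedl _).
apply: ell1P => n.
change ((ell1_single m f ** (c *: b + b')) n =
   c *: (ell1_single m f ** b) n + (ell1_single m f ** b') n).
rewrite !ell1_single_mulE.
have -> : (c *: b + b' : A) (n - m) = c *: b (n - m) + b' (n - m) by [].
by rewrite alpha_linear mulrDr; congr (_ + _); apply: cfunP => x; rewrite !cfunE mulrCA.
Qed.

Lemma ell1_mul_boundedr a : bounded_lin (fun b : A => a ** b).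
Proof.
split; first exact: ell1_mul_linearr.
by exists (rnorm a) => b; exact: rnorm_ell1_mul.
Qed.

Lemma ell1_single_mul m n f g :
  ell1_single m f ** ell1_single n g = ell1_single (m + n) (f * alpha m g).
Proof.
apply: ell1P => k; rewrite ell1_single_mulE !ell1_singleE subr_eq (addrC n).
by case: eqP => // _; rewrite alpha_0 mulr0.
Qed.

Lemma ell1_mulA a b c : a ** (b ** c) = a ** b ** c.
Proof.
move: a; apply: bounded_lin_eq => [||m f]; first exact: ell1_mul_boundedl.
  exact: (bounded_lin_comp (ell1_mul_boundedl b) (ell1_mul_boundedl c)).
move: b; apply: bounded_lin_eq => [||n g].
- exact: (bounded_lin_comp (ell1_mul_boundedl c) (ell1_mul_boundedr _)).
- exact: (bounded_lin_comp (ell1_mul_boundedr _) (ell1_mul_boundedl c)).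
move: c; apply: bounded_lin_eq => [||k h].
- exact: (bounded_lin_comp (ell1_mul_boundedr _) (ell1_mul_boundedr _)).
- exact: ell1_mul_boundedr.
by rewrite !ell1_single_mul alphaM alpha_comp addrA mulrA.
Qed.

Definition ell1_one : A := ell1_single 0 (1 : CX).

Lemma ell1_mul1l a : ell1_one ** a = a.
Proof. by apply: ell1P => n; rewrite ell1_single_mulE mul1r alpha_id subr0. Qed.

Lemma ell1_mul1r a : a ** ell1_one = a.
Proof.
move: a; apply: bounded_lin_eq => [||m f]; first exact: ell1_mul_boundedl.
  by split => //; exists 1 => a; rewrite mul1r.
by rewrite ell1_single_mul alpha1 mulr1 addr0.
Qed.

Lemma ell1_mulDl a b c : (a + b) ** c = a ** c + b ** c.
Proof. by have := ell1_mul_linearl c 1 a b; rewrite !scale1r. Qed.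

Lemma ell1_mulDr a b c : a ** (b + c) = a ** b + a ** c.
Proof. by have := ell1_mul_linearr a 1 b c; rewrite !scale1r. Qed.

Lemma ell1_mul0l a : 0 ** a = 0.
Proof. by have := ell1_mul_linearl a (-1) 0 0; rewrite !scaleN1r !addNr. Qed.

Lemma ell1_mul0r a : a ** 0 = 0.
Proof. by have := ell1_mul_linearr a (-1) 0 0; rewrite !scaleN1r !addNr. Qed.

Lemma ell1_mulZr (c : R[i]) a b : a ** (c *: b) = c *: (a ** b).
Proof. by have := ell1_mul_linearr a c b 0; rewrite ell1_mul0r !addr0. Qed.

Lemma ell1_mulBr a b c : a ** (b - c) = a ** b - a ** c.
Proof. by rewrite ell1_mulDr -scaleN1r ell1_mulZr scaleN1r. Qed.

Lemma rnorm_one : rnorm ell1_one = 1.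
Proof.
rewrite rnorm_single rnorm_cfunE; apply/eqP; rewrite eq_le; apply/andP; split.
  by apply: sup_norm_le => x; rewrite cfun1E rnorm1.
have [x _] := @dyn_nonempty S; apply: le_trans (sup_norm_ub (1 : CX) x).
by rewrite cfun1E rnorm1.
Qed.

Lemma rnorm_delta n : rnorm (ell1_single n (1 : CX)) = 1.
Proof. by rewrite rnorm_single -(rnorm_single 0) rnorm_one. Qed.

Fixpoint ell1_pow a (n : nat) : A := if n is n'.+1 then ell1_pow a n' ** a else ell1_one.

Lemma rnorm_pow a (n : nat) : rnorm (ell1_pow a n) <= rnorm a ^+ n.
Proof.
elim: n => [|n IH] /=; first by rewrite rnorm_one.
by rewrite exprSr (le_trans (rnorm_ell1_mul _ _))// ler_wpM2r ?rnorm_ge0.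
Qed.

(** Neumann series. The bound on [b] is kept because the Gelfand-Mazur argument asks for it in its
    hypothesis [BV]. *)
Lemma ell1_left_inverse a (r : R) : rnorm a <= r -> r < 1 ->
  exists2 b, b ** (ell1_one - a) = ell1_one & rnorm b <= (1 - r)^-1.
Proof.
move=> ar r1; have r0 : 0 <= r := le_trans (rnorm_ge0 _) ar.
have r10 : 0 < 1 - r by rewrite subr_gt0.
have sumle (n : nat) : \sum_(k < n) rnorm (ell1_pow a k) <= (1 - r)^-1.
  apply: (@le_trans _ _ (\sum_(k < n) r ^+ k)).
    apply: ler_sum => k _; rewrite (le_trans (rnorm_pow _ _))//.
    by rewrite lerXn2r// nnegrE rnorm_ge0.
  rewrite -[leRHS]mul1r ler_pdivlMr// mulrC -opprB mulNr -subrX1 opprB.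
  by rewrite lerBlDr lerDl exprn_ge0.
have ub : rnorm_bounded (ell1_pow a) by exists (1 - r)^-1.
have /cvg_ex[b sb] := ell1_abs_complete (@cfun_abs_complete R S) ub.
exists b; last first.
  apply: (rnorm_lim_le sb); apply: nearW => n.
  rewrite /series/= big_mkord; exact: le_trans (rnorm_sum _ _ _) (sumle n).
have tel (n : nat) : series (ell1_pow a) n ** (ell1_one - a) = ell1_one - ell1_pow a n.
  elim: n => [|n IH].
    by rewrite /series/= big_geq// subrr ell1_mul0l.
  by rewrite seriesSr ell1_mulDl IH ell1_mulBr ell1_mul1r addrA subrK.
apply/eqP; rewrite -subr_eq0; apply/eqP; apply: rnorm_eq0; apply/eqP.
rewrite eq_le rnorm_ge0 andbT; apply/ler_addgt0Pr => e e0; rewrite add0r.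
have e20 : 0 < e / 2 by rewrite divr_gt0.
have K0 : 0 < rnorm (ell1_one - a) + 1 by rewrite ltr_wpDl ?rnorm_ge0.
have e30 := divr_gt0 e20 K0.
move/cvg_rnormP : sb => /(_ _ e30) sb.
have rn : r ^+ n @[n --> \oo] --> (0 : R) by apply: cvg_expr; rewrite ger0_norm.
move/cvgrPdist_lt : rn => /(_ _ e20) rn.
near \oo => n.
have -> : b ** (ell1_one - a) - ell1_one =
    (b - series (ell1_pow a) n) ** (ell1_one - a) - ell1_pow a n.
  have -> : b = (b - series (ell1_pow a) n) + series (ell1_pow a) n by rewrite subrK.
  rewrite ell1_mulDl tel addrK -!addrA; congr (_ + _).
  by rewrite addrC -addrA addNr addr0.
rewrite (le_trans (rnormB _ _))// (splitr e) lerD//.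
  rewrite (le_trans (rnorm_ell1_mul _ _))//.
  apply: (@le_trans _ _ (rnorm (b - series (ell1_pow a) n) * (rnorm (ell1_one - a) + 1))).
    by rewrite ler_wpM2l ?rnorm_ge0// lerDl.
  by rewrite -ler_pdivlMr//; apply: ltW; near: n.
rewrite (le_trans (rnorm_pow _ _))// (@le_trans _ _ (r ^+ n))//.
  by rewrite lerXn2r// nnegrE rnorm_ge0.
have : `|0 - r ^+ n| < e / 2 by near: n.
by rewrite sub0r normrN ger0_norm ?exprn_ge0// => /ltW.
Unshelve. all: by end_near. Qed.

End Algebra.

(** * Closed ideals of C(X) *)

(** Induction on compact sets, used below in place of extracting finite subcovers: a local property
    stable under unions holds for some set around all of [K]. *)
Lemma compact_ind (T : topologicalType) (K : set T) (Q : set T -> Prop) :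
  compact K -> Q set0 -> (forall B C, Q B -> Q C -> Q (B `|` C)) ->
  (forall x, K x -> exists2 U, nbhs x U & Q U) -> exists2 B, Q B & K `<=` B.
Proof.
move=> /compact_near_coveringP cK Q0 QU Qloc.
(* [F] holds the families that contain all supersets of some [Q]-set; stability of [Q] under unions
   makes it a filter, to which the near-covering form of compactness applies. *)
pose F : set_system (set T) := fun P => exists2 B, Q B & forall C, B `<=` C -> P C.
have FF : Filter F.
  split; first by exists set0.
    move=> P P' [B QB BP] [B' QB' BP']; exists (B `|` B'); first exact: QU.
    by move=> C; rewrite subUset => -[/BP ? /BP'].
  by move=> P P' PP' [B QB BP]; exists B => // C /BP /PP'.
have [x Kx|B QB KB] := cK _ F (fun C x => C x) FF.
  have [U xU QU'] := Qloc x Kx.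
  exists (U, [set C | U `<=` C]); first by split => //; exists U.
  by move=> [y C] /= [Uy UC]; exact: UC.
by exists B => //; exact: KB.
Qed.

Section CXTools.
Variables (R : realType) (S : dynsys).
Local Notation CX := (cfun R S).
Implicit Types (f g : CX).

Lemma realC_continuous : continuous (fun a : R => a%:C : R[i]).
Proof.
move=> a; apply/cvg_rnormP => e e0.
have /cvgrPdist_lt/(_ _ e0) : (x @[x --> a] --> a) by exact: cvg_id.
by apply: filterS => b; rewrite -rmorphB rnorm_real.
Qed.

Lemma conjC_continuous : continuous (fun z : R[i] => z^*%C).
Proof.
move=> a; apply/(cvg_rnormP (nbhs_filter a)) => e e0.
have := @near_rnorm R R[i] a e e0; apply: filterS => b.
by rewrite -rmorphB /rnorm normcJ.
Qed.

Lemma rnorm_cfun_continuous f : continuous (fun x => rnorm (f x)).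
Proof.
move=> x; apply: (@continuous_comp _ _ _ f (@rnorm R R[i])).
  exact: cfun_continuous.
exact: rnorm_continuous.
Qed.

Lemma open_rnorm_gt f (r : R) : open [set x | r < rnorm (f x)].
Proof.
have c := @rnorm_cfun_continuous f.
by have := @open_comp _ _ _ [set y : R | r < y] (fun x _ => c x) (@open_gt R r); apply.
Qed.

Lemma open_rnorm_lt f (r : R) : open [set x | rnorm (f x) < r].
Proof.
have c := @rnorm_cfun_continuous f.
by have := @open_comp _ _ _ [set y : R | y < r] (fun x _ => c x) (@open_lt R r); apply.
Qed.

Lemma open_neq0 f : open [set x | f x != 0].
Proof.
rewrite (_ : mkset _ = [set x | 0 < rnorm (f x)]); first exact: open_rnorm_gt.
apply/seteqP; split => x /=; first exact: rnorm_gt0.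
by apply: contraTneq => ->; rewrite rnorm0 ltxx.
Qed.

Lemma urysohn_cfun (F G : set S) : closed F -> closed G -> F `&` G = set0 ->
  exists f, [/\ forall x, F x -> f x = 0, forall x, G x -> f x = 1 & rnorm f <= 1].
Proof.
move=> cF cG FG; have Sn := compact_normal (@dyn_hausdorff S) (@dyn_compact S).
have sep : uniform_separator F G by have /(@normal_separatorP R S) := Sn; apply.
have cu : continuous (fun x => (Urysohn F G x : R)%:C : R[i]).
  move=> x; apply: (@continuous_comp _ _ _ (Urysohn F G) (fun a : R => a%:C)).
    exact: Urysohn_continuous.
  exact: realC_continuous.
exists (mk_cfun cu); split.
- by move=> x Fx; have E : Urysohn F G x = 0 :> R := Urysohn_sub0 sep (ex_intro2 _ _ x Fx erefl);
  by have -> : mk_cfun cu x = (Urysohn F G x : R)%:C by []; rewrite E.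
- by move=> x Gx; have E : Urysohn F G x = 1 :> R := Urysohn_sub1 sep (ex_intro2 _ _ x Gx erefl);
  by have -> : mk_cfun cu x = (Urysohn F G x : R)%:C by []; rewrite E.
rewrite rnorm_cfunE; apply: sup_norm_le => x /=; rewrite rnorm_real.
have := @Urysohn_range S R F G _ (ex_intro2 _ _ x I erefl).
by rewrite /= in_itv/= => /andP[h0 h1]; rewrite ger0_norm.
Qed.

Lemma dyn_closed1 (x : S) : closed [set x].
Proof.
by apply: compact_closed; [exact: dyn_hausdorff|exact: compact_set1].
Qed.

Lemma closed_notin_open (F : set S) x : closed F -> ~ F x ->
  exists O : set S, [/\ open O, O x & closure O `&` F = set0].
Proof.
move=> cF Fx.
have [f [f0 f1 _]] : exists f, [/\ forall y, F y -> f y = 0,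
    forall y, [set x] y -> f y = 1 & rnorm f <= 1].
  apply: urysohn_cfun => //; first exact: dyn_closed1.
  by rewrite -subset0 => y [Fy /= yx]; apply: Fx; rewrite -yx.
exists [set y | 1 / 2 < rnorm (f y)]; split; first exact: open_rnorm_gt.
  by rewrite /= f1// rnorm1; lra.
rewrite -subset0 => y [yc Fy].
have : nbhs y [set z | rnorm (f z) < 1 / 2].
  have /(cvg_rnormP (nbhs_filter y)) := @cfun_continuous R S f y.
  move=> /(_ (1 / 2) ltac:(lra)); apply: filterS => z /=.
  by rewrite (f0 y Fy) sub0r rnormN.
by move/yc => -[z [/= h1 /(lt_trans h1)]]; rewrite ltxx.
Qed.

(** The value 1 on a whole neighbourhood [V] allows nesting: a second bump [k] vanishing outside [V]
    satisfies [f * k = k]. *)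
Lemma cfun_bump (O : set S) x : open O -> O x ->
  exists f, [/\ exists V : set S, [/\ open V, V x & forall y, V y -> f y = 1],
                forall y, ~ O y -> f y = 0 & rnorm f <= 1].
Proof.
move=> oO Ox.
have [|V [oV Vx VO]] := @closed_notin_open (~` O) x _ (fun h => h Ox).
  exact: open_closedC.
have [f [f0 f1 fle]] : exists f, [/\ forall y, (~` O) y -> f y = 0,
    forall y, closure V y -> f y = 1 & rnorm f <= 1].
  apply: urysohn_cfun; [exact: open_closedC|exact: closed_closure|].
  by rewrite setIC.
by exists f; split => //; exists V; split => // y /subset_closure; exact: f1.
Qed.

Definition cfun_conj f : CX.
Proof.
apply: (@mk_cfun R S (fun x => (f x)^*%C)) => x.
apply: (@continuous_comp _ _ _ f (fun z : R[i] => z^*%C)).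
  exact: cfun_continuous.
exact: conjC_continuous.
Defined.

Lemma cfun_conjM f x : (cfun_conj f * f) x = (rnorm (f x) ^+ 2)%:C.
Proof. by rewrite cfunME mulrC rmorphXn/= rnormE; exact/esym/normCK. Qed.

Definition cfun_ideal (J : set CX) :=
  [/\ J 0, forall f g, J f -> J g -> J (f + g) & forall f g, J g -> J (f * g)].

Definition cfun_hull (J : set CX) : set S := [set x | forall f, J f -> f x = 0].

Lemma cfun_hull_closed J : closed (cfun_hull J).
Proof.
have -> : cfun_hull J = \bigcap_(f in J) ~` [set x | f x != 0].
  apply/seteqP; split => x /= h f Jf; first by apply/negP; rewrite negbK h.
  by apply/eqP; rewrite -[_ == _]negbK; apply/negP; exact: h.
by apply: closed_bigI => f _; apply: open_closedC; exact: open_neq0.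
Qed.

(* Closed ideals of C(X) are determined by their hull: on the compact set where
   |f| >= e some g = sum |g_i|^2 in J is at least 1, and f g / (g + eta) is
   uniformly close to f. *)
Lemma cfun_hull_approx J f : cfun_ideal J -> (forall x, cfun_hull J x -> f x = 0) ->
  forall e : R, 0 < e -> exists2 g, J g & rnorm (f - g) <= e.
Proof.
move=> [J0 JD JM] fJ e e0.
pose K := ~` [set x | rnorm (f x) < e].
have cK : closed K.
  by apply: open_closedC; exact: open_rnorm_lt.
have kK : compact K.
  apply: (subclosed_compact cK (@dyn_compact S)); exact: subsetT.
have Kg x : K x -> exists2 g, J g & 1 < rnorm (g x).
  move=> Kx; have : ~ cfun_hull J x.
    by move/fJ => fx0; apply: Kx; rewrite /= fx0 rnorm0.
  move=> /existsNP[g /not_implyP[Jg /eqP gx]].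
  (* Scaling to modulus 2 at [x] leaves room to stay above 1 on a neighbourhood. *)
  exists (cfun_cst S (2 / g x) * g); first exact: JM.
  rewrite cfunME /= divfK//.
  have -> : (2 : R[i]) = (2 : R)%:C by rewrite rmorph_nat.
  by rewrite rnorm_real ger0_norm// ltr1n.
have [G [GJ GK]] : exists G : CX, [/\ J G, forall x, K x -> 1 <= complex.Re (G x)
    & True] /\ forall x, exists2 r : R, 0 <= r & G x = r%:C.
  pose Q (B : set S) := exists G : CX, [/\ J G, forall x, B x -> 1 <= complex.Re (G x)
    & forall x, exists2 r : R, 0 <= r & G x = r%:C].
  have [||x /Kg[g Jg gx]|B [G [JG G1 Gr]] KB] := @compact_ind _ K Q kK.
  - by exists 0; split => // x; exists 0.
  - move=> B C [G [JG G1 Gr]] [G' [JG' G1' Gr']]; exists (G + G'); split.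
    + exact: JD.
    + have Re0 x : 0 <= complex.Re (G x) by have [r r0 ->] := Gr x.
      have Re0' x : 0 <= complex.Re (G' x) by have [r r0 ->] := Gr' x.
      move=> x [/G1|/G1'] h; rewrite cfunDE raddfD/=.
        by rewrite -[leLHS]addr0 lerD.
      by rewrite -[leLHS]add0r lerD.
    + move=> x; have [r r0 rE] := Gr x; have [r' r0' rE'] := Gr' x.
      by exists (r + r'); rewrite ?addr_ge0// cfunDE rE rE' rmorphD.
  - exists [set x | 1 < rnorm (g x)].
      by apply: open_nbhs_nbhs; split => //; exact: open_rnorm_gt.
    exists (cfun_conj g * g); split; first exact: JM.
      move=> y /= gy; rewrite cfun_conjM /= expr2 -[leLHS]mulr1.
      by rewrite ler_pM// ltW.
    by move=> y; exists (rnorm (g y) ^+ 2); rewrite ?sqr_ge0// cfun_conjM.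
  - by exists G; split => //; split => // x /KB; exact: G1.
case: GJ => JG G1 _.
(* On [K] the error [|f| eta / (r + eta)] is at most [|f| eta <= e] because [r >= 1]; off [K] it is
   at most [|f| < e]. *)
pose eta := e / (rnorm f + 1).
have f1 : 0 < rnorm f + 1 by rewrite ltr_wpDl ?rnorm_ge0.
have eta0 : 0 < eta by rewrite divr_gt0.
have hc : continuous (fun x => (G x + eta%:C)^-1).
  move=> x; apply: cvgV.
    have [r r0 ->] := GK x; rewrite -rmorphD/= -[0]/(0%:C) (inj_eq (@complexI R)).
    by rewrite gt_eqF// ltr_wpDl.
  by apply: cvgD; [exact: cfun_continuous|exact: cvg_cst].
exists (f * mk_cfun hc * G); first exact: JM.
rewrite rnorm_cfunE; apply: sup_norm_le => x.
rewrite cfunBE !cfunME /=.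
have [r r0 Gr] := GK x; have re : 0 < r + eta by rewrite ltr_wpDl.
have re' : (r + eta)%:C != 0 :> R[i].
  by rewrite -[0]/(0%:C) (inj_eq (@complexI R)) gt_eqF.
have -> : f x - f x * (G x + eta%:C)^-1 * G x = f x * (eta / (r + eta))%:C.
  have -> : (eta / (r + eta))%:C = eta%:C / (r%:C + eta%:C) :> R[i].
    by rewrite -rmorphD -fmorph_div.
  rewrite Gr; move: re'; rewrite rmorphD /=.
  by move: (f x) (r%:C) (eta%:C) => z p q pq; field.
rewrite crnormM rnorm_real ger0_norm; last by rewrite divr_ge0 ?ltW.
have [fe|fe] := ltP (rnorm (f x)) e.
  rewrite -[leRHS]mulr1; apply: ler_pM; first exact: rnorm_ge0.
  - by rewrite divr_ge0// ltW.
  - exact: ltW.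
  - by rewrite ler_pdivrMr// mul1r lerDr.
have r1 : 1 <= r.
  have := G1 x; rewrite Gr/=; apply; apply/negP; by rewrite -leNgt.
rewrite mulrA ler_pdivrMr// (@le_trans _ _ e)//.
  rewrite /eta mulrCA; apply: ler_piMr; first exact: ltW.
  by rewrite ler_pdivrMr// mul1r (le_trans (rnorm_eval _ _))// lerDl.
by apply: ler_peMr; [exact: ltW|rewrite (le_trans r1)// lerDl ltW].
Qed.

End CXTools.

(** * Algebraically irreducible representations *)

Section Representation.
Variables (R : realType) (S : dynsys).
Local Notation CX := (cfun R S).
Local Notation A := (ell1 CX).
Implicit Types (f g : CX) (a b c : A) (k m n : int).

Definition delta_pow n : A := ell1_single n (1 : CX).

Lemma cfun_emb_mul f g : cfun_emb f ** cfun_emb g = cfun_emb (f * g).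
Proof. by rewrite ell1_single_mul alpha_id. Qed.

Lemma delta_powD m n : delta_pow m ** delta_pow n = delta_pow (m + n).
Proof. by rewrite ell1_single_mul alpha1 mulr1. Qed.

Lemma delta_pow0 : delta_pow 0 = ell1_one R S.
Proof. by []. Qed.

Lemma single_split n f : ell1_single n f = cfun_emb f ** delta_pow n.
Proof. by rewrite ell1_single_mul alpha1 mulr1 add0r. Qed.

Lemma delta_pow_emb n f : delta_pow n ** cfun_emb f = cfun_emb (alpha n f) ** delta_pow n.
Proof. by rewrite !ell1_single_mul alpha1 mul1r mulr1 addr0 add0r. Qed.

Lemma cfun_emb_alpha n f :
  cfun_emb (alpha n f) = delta_pow n ** cfun_emb f ** delta_pow (- n).
Proof. by rewrite delta_pow_emb -ell1_mulA delta_powD subrr delta_pow0 ell1_mul1r. Qed.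

Lemma cfun_embD f g : cfun_emb (f + g) = cfun_emb f + cfun_emb g :> A.
Proof. by have := @ell1_single_linear R CX 0 1 f g; rewrite !scale1r. Qed.

Lemma cfun_emb0 : cfun_emb (0 : CX) = 0 :> A.
Proof. by apply: ell1P => m; rewrite ell1_singleE; case: eqP. Qed.

Lemma cfun_embZ (z : R[i]) f : cfun_emb (z *: f) = z *: cfun_emb f :> A.
Proof.
have := @ell1_single_linear R CX 0 z f 0.
by rewrite -/(cfun_emb _) -/(cfun_emb 0) cfun_emb0 !addr0.
Qed.

Lemma cfun_embB f g : cfun_emb (f - g) = cfun_emb f - cfun_emb g :> A.
Proof. by rewrite cfun_embD -scaleN1r cfun_embZ scaleN1r. Qed.

Section Rep.
Variables (E : lmodType R[i]) (pi : A -> E -> E).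
Hypothesis rep : representation pi.

Lemma repZDl (z : R[i]) a b v : pi (z *: a + b) v = z *: pi a v + pi b v.
Proof. by have [_ h _] := rep; exact: h. Qed.

Lemma repZDr (z : R[i]) a u v : pi a (z *: u + v) = z *: pi a u + pi a v.
Proof. by have [h _ _] := rep; exact: h. Qed.

Lemma repM a b v : pi (a ** b) v = pi a (pi b v).
Proof. by have [_ _ h] := rep; exact: h. Qed.

Lemma rep0l v : pi 0 v = 0.
Proof. by have := repZDl (-1) 0 0 v; rewrite !scaleN1r !addNr. Qed.

Lemma rep0r a : pi a 0 = 0.
Proof. by have := repZDr (-1) a 0 0; rewrite !scaleN1r !addNr. Qed.

Lemma repDl a b v : pi (a + b) v = pi a v + pi b v.
Proof. by have := repZDl 1 a b v; rewrite !scale1r. Qed.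

Lemma repDr a u v : pi a (u + v) = pi a u + pi a v.
Proof. by have := repZDr 1 a u v; rewrite !scale1r. Qed.

Lemma repZl (z : R[i]) a v : pi (z *: a) v = z *: pi a v.
Proof. by have := repZDl z a 0 v; rewrite rep0l !addr0. Qed.

Lemma repZr (z : R[i]) a v : pi a (z *: v) = z *: pi a v.
Proof. by have := repZDr z a v 0; rewrite rep0r !addr0. Qed.

Lemma repNl a v : pi (- a) v = - pi a v.
Proof. by rewrite -[- a]scaleN1r repZl scaleN1r. Qed.

Lemma repBl a b v : pi (a - b) v = pi a v - pi b v.
Proof. by rewrite repDl -[- b]scaleN1r repZl scaleN1r. Qed.

Lemma rep_suml (I : Type) (r : seq I) (P : pred I) (F : I -> A) v :
  pi (\sum_(i <- r | P i) F i) v = \sum_(i <- r | P i) pi (F i) v.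
Proof. by elim/big_rec2 : _ => [|i x y _ <-]; rewrite ?rep0l ?repDl. Qed.

Lemma rep_sumr (I : Type) (r : seq I) (P : pred I) a (F : I -> E) :
  pi a (\sum_(i <- r | P i) F i) = \sum_(i <- r | P i) pi a (F i).
Proof. by elim/big_rec2 : _ => [|i x y _ <-]; rewrite ?rep0r ?repDr. Qed.

End Rep.

Section Irreducible.
Variables (E : lmodType R[i]) (pi : A -> E -> E).
Hypothesis irr : alg_irreducible pi.

Let rep : representation pi. Proof. by case: irr. Qed.

(** The range of [pi 1] is invariant because 1 commutes with everything, and nonzero because
    [a ** 1 = a]. By irreducibility [pi 1] is a surjective idempotent. *)
Lemma irr_one v : pi (ell1_one R S) v = v.
Proof.
have [_ [a [v0 av0]] sub] := irr; pose one := pi (ell1_one R S).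
have oneA b u : one (pi b u) = pi b u by rewrite /one -(repM rep) ell1_mul1l.
have := sub (range one); case.
- split; first by exists 0 => //; rewrite /one (rep0r rep).
  move=> c _ _ [u _ <-] [w _ <-]; exists (c *: u + w) => //.
  by rewrite /one (repZDr rep).
- by move=> b _ [u _ <-]; exists (pi b u) => //; rewrite oneA /one -(repM rep) ell1_mul1r.
- move=> h; case: av0; rewrite -(ell1_mul1r a) (repM rep).
  have : range one (one v0) by exists v0.
  by rewrite h /= /one => ->; rewrite (rep0r rep).
- move=> h; have : [set: E] v by [].
  by rewrite -h => -[u _ <-]; exact: oneA.
Qed.

Lemma irr_neq0 : exists v : E, v <> 0.
Proof.
have [_ [a [v av]] _] := irr; exists v => v0; apply: av.
by rewrite v0 (rep0r rep).
Qed.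

Lemma irr_cyclic (w : E) : w <> 0 -> forall v, exists a, pi a w = v.
Proof.
move=> w0 v; have [_ _ sub] := irr; case: (sub (range (pi^~ w))).
- split; first by exists 0 => //; rewrite (rep0l rep).
  move=> c _ _ [a _ <-] [b _ <-]; exists (c *: a + b) => //.
  by rewrite (repZDl rep).
- by move=> b _ [a _ <-]; exists (b ** a) => //; rewrite (repM rep).
- move=> h; case: w0; rewrite -(irr_one w).
  have : range (pi^~ w) (pi (ell1_one R S) w) by exists (ell1_one R S).
  by rewrite h.
- move=> h; have : [set: E] v by [].
  by rewrite -h => -[a _ <-]; exists a.
Qed.

(* No continuity of pi is assumed: a vector fixed by a contraction is killed by
   an invertible element. *)
Lemma irr_eigenvalue_le a (w : E) (z : R[i]) :
  w <> 0 -> pi a w = z *: w -> rnorm z <= rnorm a.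
Proof.
move=> w0 aw; rewrite leNgt; apply/negP => az.
have z0 : z != 0.
  by apply: contraTneq az => ->; rewrite rnorm0 -leNgt rnorm_ge0.
have zr : rnorm (z^-1) = (rnorm z)^-1.
  apply/(mulfI (_ : rnorm z != 0)); first by rewrite gt_eqF// rnorm_gt0.
  rewrite -crnormM !divff ?rnorm1//; by rewrite gt_eqF// rnorm_gt0.
have za1 : rnorm (z^-1 *: a) < 1.
  by rewrite rnormZE zr mulrC ltr_pdivrMr ?rnorm_gt0// mul1r.
have [b bE _] := ell1_left_inverse (lexx _) za1.
apply: w0; rewrite -(irr_one w) -bE (repM rep) (repBl rep) irr_one (repZl rep).
by rewrite aw scalerA mulVf// scale1r subrr (rep0r rep).
Qed.

(** If [a w] were nonzero, cyclicity would give [b] with [b a w = w]. Then [b ** (a - c)] fixes [w]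
    for every [c] annihilating [w], which is impossible once its norm drops below 1. *)
Lemma irr_annihilator_closed (w : E) a :
  (forall e : R, 0 < e -> exists2 c, pi c w = 0 & rnorm (a - c) <= e) ->
  pi a w = 0.
Proof.
move=> cl; apply: contrapT => aw.
have [b bw] := irr_cyclic aw w.
have w0 : w <> 0 by move=> w0; apply: aw; rewrite w0 (rep0r rep).
have e0 : 0 < (2 * (rnorm b + 1))^-1 by rewrite invr_gt0 mulr_gt0// ltr_wpDl ?rnorm_ge0.
have [c cw ac] := cl _ e0.
have h : pi (b ** (a - c)) w = 1 *: w.
  by rewrite (repM rep) (repBl rep) cw subr0 bw scale1r.
have := irr_eigenvalue_le w0 h; rewrite rnorm1 leNgt => /negP; apply.
rewrite (le_lt_trans (rnorm_ell1_mul _ _))//.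
apply: (@le_lt_trans _ _ (rnorm b * (2 * (rnorm b + 1))^-1)).
  by rewrite ler_wpM2l ?rnorm_ge0.
have b0 := rnorm_ge0 b.
rewrite ltr_pdivrMr; lra.
Qed.

Lemma irr_annihilator_dense (w : E) a :
  (forall n, pi (ell1_single n (a n)) w = 0) -> pi a w = 0.
Proof.
apply: (@ell1_dense _ _ (fun a => pi a w = 0)).
- exact: (rep0l rep).
- by move=> b c bw cw; rewrite (repDl rep) bw cw addr0.
- exact: irr_annihilator_closed.
Qed.

(** Commutation and intertwining relations in [E] are reduced to monomials by this, with [L a] the
    element measuring their failure. *)
Lemma irr_bounded_lin0 (L : A -> A) (w : E) : bounded_lin L ->
  (forall n f, pi (L (ell1_single n f)) w = 0) -> forall a, pi (L a) w = 0.
Proof.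
move=> [lL [K LK]] Ls a.
have L0 : L 0 = 0 by have := lL (-1) 0 0; rewrite !scaleN1r !addNr.
have LD b c : L (b + c) = L b + L c by have := lL 1 b c; rewrite !scale1r.
apply: (@ell1_dense _ _ (fun a => pi (L a) w = 0)) => //.
- by rewrite L0 (rep0l rep).
- by move=> b c bw cw; rewrite LD (repDl rep) bw cw addr0.
- move=> b h; apply: irr_annihilator_closed => e e0.
  have K0 : 0 < `|K| + 1 by rewrite ltr_wpDl.
  have [c cw bc] := h _ (divr_gt0 e0 K0); exists (L c) => //.
  have -> : L b - L c = L (b - c).
    by have := LD (b - c) c; rewrite subrK => ->; rewrite addrK.
  rewrite (le_trans (LK _))// (@le_trans _ _ ((`|K| + 1) * rnorm (b - c)))//.
    by rewrite ler_wpM2r ?rnorm_ge0// (le_trans (ler_norm K))// lerDl.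
  by rewrite mulrC -ler_pdivlMr.
Qed.

Lemma irr_delta_inj n (v : E) : pi (delta_pow n) v = 0 -> v = 0.
Proof.
move=> h; rewrite -[LHS]irr_one -delta_pow0 -(addNr n) -delta_powD (repM rep) h.
by rewrite (rep0r rep).
Qed.

Definition cfun_ker : set CX := [set f | forall v, pi (cfun_emb f) v = 0].

Lemma cfun_ker_ideal : cfun_ideal cfun_ker.
Proof.
split=> [v|f g Jf Jg v|f g Jg v].
- by rewrite cfun_emb0 (rep0l rep).
- by rewrite cfun_embD (repDl rep) Jf Jg addr0.
- by rewrite -cfun_emb_mul (repM rep) Jg (rep0r rep).
Qed.

(* The set X_pi. *)
Definition rep_hull : set S := cfun_hull cfun_ker.

Lemma rep_hull_closed : closed rep_hull.
Proof. exact: cfun_hull_closed. Qed.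

(** [cfun_hull_approx] gives only approximation by elements of [cfun_ker]; closedness of
    annihilators absorbs the error. *)
Lemma rep_hull_vanish f : (forall x, rep_hull x -> f x = 0) ->
  forall v, pi (cfun_emb f) v = 0.
Proof.
move=> fX v; apply: irr_annihilator_closed => e e0.
have [g Jg fg] := cfun_hull_approx cfun_ker_ideal fX e0.
by exists (cfun_emb g); rewrite ?Jg// -cfun_embB rnorm_single.
Qed.

Lemma rep_support_hull : rep_support pi rep_hull.
Proof.
split; first exact: rep_hull_closed.
move=> f; split => [Jf x Xx|]; last exact: rep_hull_vanish.
exact: Xx.
Qed.

Lemma rep_hull_witness f x : rep_hull x -> f x <> 0 -> exists v, pi (cfun_emb f) v <> 0.
Proof.
move=> Xx fx; apply: contrapT => h; apply: fx; apply: Xx => v.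
by apply: contrapT => hv; apply: h; exists v.
Qed.

Lemma rep_hull_neq0 : rep_hull !=set0.
Proof.
apply/set0P/eqP => X0; have [v v0] := irr_neq0; apply: v0.
rewrite -[LHS]irr_one; apply: (@rep_hull_vanish 1) => x.
by rewrite X0.
Qed.

Lemma rep_hull_invariant n x : rep_hull x -> rep_hull (dyn_iter n x).
Proof.
move=> Xx f Jf; have : cfun_ker (alpha (- n) f).
  by move=> v; rewrite cfun_emb_alpha !(repM rep) Jf (rep0r rep).
by move/Xx; rewrite alphaE opprK.
Qed.

(** Otherwise bumps [f] at [x] and [g] at [y] have [g * alpha k f = 0] on the hull for all [k], so
    every [g ** a ** f] acts as zero. But a nonzero vector [f v] is cyclic, and [g] would vanish on
    all of [E]. *)
Lemma rep_hull_transitive (U V : set S) x y : open U -> open V ->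
  rep_hull x -> rep_hull y -> U x -> V y ->
  exists k z, [/\ rep_hull z, U z & V (dyn_iter k z)].
Proof.
move=> oU oV Xx Xy Ux Vy; apply: contrapT => h.
have [f [[U' [_ U'x f1]] fU _]] := @cfun_bump R S U x oU Ux.
have [g [[V' [_ V'y g1]] gV _]] := @cfun_bump R S V y oV Vy.
have fg k v : pi (cfun_emb (g * alpha k f)) v = 0.
  apply: rep_hull_vanish => z Xz; rewrite cfunME alphaE.
  have [Vz|/gV ->] := pselect (V z); last by rewrite mul0r.
  have [Uz|/fU ->] := pselect (U (dyn_iter (- k) z)); last by rewrite mulr0.
  exfalso; apply: h; exists k, (dyn_iter (- k) z); split => //.
    exact: rep_hull_invariant.
  by rewrite dyn_iterNK.
have [v fv] : exists v, pi (cfun_emb f) v <> 0.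
  by apply: (@rep_hull_witness f x) => //; rewrite f1//; exact/eqP/oner_neq0.
have [w gw] : exists v, pi (cfun_emb g) v <> 0.
  by apply: (@rep_hull_witness g y) => //; rewrite g1//; exact/eqP/oner_neq0.
have [a aw] := irr_cyclic fv w; apply: gw; rewrite -aw -!(repM rep).
apply: (@irr_bounded_lin0 (fun a => cfun_emb g ** a ** cfun_emb f)) => [|n u].
  exact: (bounded_lin_comp (ell1_mul_boundedr _) (ell1_mul_boundedl _)).
rewrite single_split -!ell1_mulA delta_pow_emb !ell1_mulA !cfun_emb_mul.
have -> : g * u * alpha n f = u * (g * alpha n f) by rewrite mulrCA mulrA.
by rewrite -cfun_emb_mul !(repM rep) fg (rep0r rep).
Qed.

End Irreducible.
End Representation.

(** * The representations attached to orbits *)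

Section ColumnNorm.
Variables (R : realType) (p : nat).
Implicit Types (v : 'cV[R[i]]_p).

Lemma rnorm_col_le v (M : R) : 0 <= M -> (forall i, rnorm (v i 0) <= M) -> rnorm v <= M.
Proof.
move=> M0 vM; have MC0 : 0 <= M%:C :> R[i] by rewrite ler0c.
rewrite -lecR rnormE [leLHS]mx_normE.
rewrite -[M%:C]/((NngNum MC0)%:num) num_le; apply/bigmax_leP; split.
  by rewrite -num_le /=.
by move=> [i j] _; rewrite -num_le /= -rnormE lecR (ord1 j).
Qed.

Lemma rnorm_col_entry v i : rnorm (v i 0) <= rnorm v.
Proof.
rewrite -lecR !rnormE [leRHS]mx_normE.
set b := bigop _ _ _; change ((`|v i 0|%:nng)%:num <= b%:num); rewrite num_le /b.
exact: (le_bigmax_cond _ (fun ij : 'I_p * 'I_1 => `|v ij.1 ij.2|%:nng) (j := (i, 0))).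
Qed.

Lemma col_abs_complete : @abs_complete R 'cV[R[i]]_p.
Proof.
move=> u ub; pose w i k := u k i 0.
have wu i k : rnorm (w i k) <= rnorm (u k) by exact: rnorm_col_entry.
have wc i : cvgn (series (w i)).
  by apply: complex_abs_complete; exact: rnorm_bounded_le (wu i) ub.
pose l : 'cV[R[i]]_p := \col_i limn (series (w i)).
apply/cvg_ex; exists l; apply/cvg_rnormP => e e0.
have := rnorm_tail_small ub e0; apply: filterS => n; apply: le_lt_trans.
apply: rnorm_col_le => [|i]; first exact: rnorm_tail_ge0.
have -> : (l - series u n) i 0 = limn (series (w i)) - series (w i) n.
  by rewrite !mxE /series /= summxE.
by apply: rnorm_series_tail => //; exact: wc.
Qed.

End ColumnNorm.

(** * Integrated form of a covariant pair *)

Section CovariantPair.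
Variables (R : realType) (S : dynsys) (V : normedModType R[i]).
Local Notation CX := (cfun R S).
Local Notation A := (ell1 CX).
Hypothesis cV : abs_complete V.
Variables (D : CX -> V -> V) (U : int -> V -> V).
Hypothesis D_linearl : forall v, linear (D^~ v).
Hypothesis D_linearr : forall f, linear (D f).
Hypothesis DM : forall f g v, D (f * g) v = D f (D g v).
Hypothesis D_le : forall f v, rnorm (D f v) <= rnorm f * rnorm v.
Hypothesis U_linear : forall n, linear (U n).
Hypothesis UD : forall m n v, U (m + n) v = U m (U n v).
Hypothesis U_le : forall n v, rnorm (U n v) <= rnorm v.
Hypothesis UDE : forall n f v, U n (D f v) = D (alpha n f) (U n v).

Definition covariant_rep (a : A) (v : V) : V := zint (fun n f => D f (U n v)) a.

Let lin v : forall n, linear (fun f => D f (U n v)).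
Proof. by move=> n; exact: D_linearl. Qed.

Let le v n f : rnorm (D f (U n v)) <= rnorm v * rnorm f.
Proof. by rewrite (le_trans (D_le _ _))// mulrC ler_wpM2r ?rnorm_ge0. Qed.

Lemma covariant_rep_single n f v : covariant_rep (ell1_single n f) v = D f (U n v).
Proof. exact: (zint_single cV (lin v)). Qed.

Lemma covariant_rep_bounded v : bounded_lin (covariant_rep^~ v).
Proof. exact: (zint_bounded cV (lin v) (@le v)). Qed.

Lemma covariant_rep_le a v : rnorm (covariant_rep a v) <= rnorm a * rnorm v.
Proof. by rewrite mulrC; exact: (zint_le cV (@le v)). Qed.

Lemma covariant_rep_contractive : contractive_rep covariant_rep.
Proof. by move=> a v; rewrite -!rnormE -rmorphM lecR covariant_rep_le. Qed.

Lemma covariant_rep_representation : representation covariant_rep.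
Proof.
have linr a : linear (covariant_rep a).
  move=> c u v; move: a; apply: bounded_lin_eq => [||n f].
  - exact: covariant_rep_bounded.
  - exact: bounded_lin_comb (covariant_rep_bounded _) (covariant_rep_bounded _).
  - by rewrite !covariant_rep_single U_linear D_linearr.
split => // [v|a b v]; first by have [] := covariant_rep_bounded v.
move: a; apply: bounded_lin_eq => [||m f].
- exact: (bounded_lin_comp (ell1_mul_boundedl b) (covariant_rep_bounded v)).
- exact: covariant_rep_bounded.
rewrite covariant_rep_single; move: b; apply: bounded_lin_eq => [||n g].
- exact: (bounded_lin_comp (ell1_mul_boundedr _) (covariant_rep_bounded v)).
- split=> [c b b'|].
    by have [h _] := covariant_rep_bounded v; rewrite h U_linear D_linearr.
  exists (rnorm f * rnorm v) => b; rewrite (le_trans (D_le _ _))//.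
  rewrite -mulrA ler_wpM2l ?rnorm_ge0// (le_trans (U_le _ _))//.
  by rewrite mulrC covariant_rep_le.
by rewrite ell1_single_mul !covariant_rep_single DM UDE UD.
Qed.

End CovariantPair.

(** * The representation on sequences along an orbit *)

Section OrbitRepresentation.
Variables (R : realType) (S : dynsys) (x : S).
Local Notation CX := (cfun R S).
Local Notation A := (ell1 CX).
Local Notation V := (ell1 R[i]).
Implicit Types (f g : CX) (v : V).

Let orbit_mul_le f v (s : seq int) : uniq s ->
  \sum_(n <- s) rnorm (f (dyn_iter n x) * v n) <= rnorm f * rnorm v.
Proof.
move=> us; apply: (@le_trans _ _ (\sum_(n <- s) rnorm f * rnorm (v n))).
  by apply: ler_sum => n _; rewrite crnormM ler_wpM2r ?rnorm_ge0 ?rnorm_eval.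
by rewrite -mulr_sumr ler_wpM2l ?rnorm_ge0 ?ell1_sum_le.
Qed.

Lemma orbit_mul_subproof f v : (fun n => f (dyn_iter n x) * v n) \in @ell1_pred R R[i].
Proof.
by rewrite unfold_in (le_lt_trans (ell1_mass_le (@orbit_mul_le f v)))// ltry.
Qed.

Definition orbit_mul f v : V := Ell1 (orbit_mul_subproof f v).

Let shift_le (k : int) v (s : seq int) : uniq s ->
  \sum_(n <- s) rnorm (v (n - k)) <= rnorm v.
Proof.
move=> us; rewrite -(big_map (fun n => n - k) xpredT (fun n => rnorm (v n))).
by apply: ell1_sum_le; rewrite map_inj_uniq//; exact: addIr.
Qed.

Lemma shift_subproof k v : (fun n => v (n - k)) \in @ell1_pred R R[i].
Proof. by rewrite unfold_in (le_lt_trans (ell1_mass_le (@shift_le k v)))// ltry. Qed.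

Definition shift k v : V := Ell1 (shift_subproof k v).

Definition orbit_rep : A -> V -> V := covariant_rep orbit_mul shift.

Let cV : abs_complete V := ell1_abs_complete (@complex_abs_complete R).

Lemma ell1DE (c : R[i]) u v n : (c *: u + v : V) n = c * u n + v n.
Proof. by []. Qed.

Let D_linearl v : linear (orbit_mul^~ v).
Proof.
move=> c f g; apply: ell1P => n; rewrite ell1DE /= !cfunE mulrDl mulrA.
by [].
Qed.

Let D_linearr f : linear (orbit_mul f).
Proof.
move=> c u v; apply: ell1P => n; rewrite ell1DE /=.
by rewrite -[X in _ * X = _]/(c * u n + v n) mulrDr mulrCA.
Qed.

Let DM f g v : orbit_mul (f * g) v = orbit_mul f (orbit_mul g v).
Proof. by apply: ell1P => n; rewrite /= -mulrA. Qed.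

Let D_le f v : rnorm (orbit_mul f v) <= rnorm f * rnorm v.
Proof. by apply: ell1_norm_le => s us; exact: orbit_mul_le. Qed.

Let U_linear n : linear (shift n).
Proof. by move=> c u v; apply: ell1P. Qed.

Let UD m n v : shift (m + n) v = shift m (shift n v).
Proof. by apply: ell1P => k; rewrite /= opprD addrA. Qed.

Let U_le n v : rnorm (shift n v) <= rnorm v.
Proof. by apply: ell1_norm_le => s us; exact: shift_le. Qed.

Let UDE n f v : shift n (orbit_mul f v) = orbit_mul (alpha n f) (shift n v).
Proof. by apply: ell1P => k; rewrite /= addrC dyn_iterD. Qed.

Lemma orbit_rep_single n f v :
  orbit_rep (ell1_single n f) v = orbit_mul f (shift n v).
Proof. exact (@covariant_rep_single R S V cV orbit_mul shift D_linearl n f v). Qed.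

Lemma shift_basis n k : shift n (basis_vecZ R k) = basis_vecZ R (k + n).
Proof. by apply: ell1P => m; rewrite /= subr_eq. Qed.

Lemma orbit_mul_basis f k :
  orbit_mul f (basis_vecZ R k) = f (dyn_iter k x) *: basis_vecZ R k.
Proof.
apply: ell1P => m.
have -> : (f (dyn_iter k x) *: basis_vecZ R k) m = f (dyn_iter k x) * basis_vecZ R k m by [].
by rewrite /=; case: eqP => [->|_]; rewrite ?mulr0.
Qed.

Lemma orbit_rep_is_pi_aper : is_pi_aper x orbit_rep.
Proof.
split.
- exact: (covariant_rep_representation cV).
- exact: (covariant_rep_contractive cV).
- move=> f k; rewrite orbit_rep_single shift_basis addr0; exact: orbit_mul_basis.
- move=> k; rewrite orbit_rep_single shift_basis orbit_mul_basis.
  by rewrite cfun1E scale1r.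
Qed.

End OrbitRepresentation.

(** * The matrix representation of a periodic orbit *)

Section PeriodicRepresentation.
Variables (R : realType) (S : dynsys) (x : S) (q : nat) (z : R[i]).
Hypothesis px : dyn_iter q.+1 x = x.
Hypothesis z1 : rnorm z = 1.
Local Notation p := q.+1.
Local Notation CX := (cfun R S).
Local Notation A := (ell1 CX).
Local Notation V := ('cV[R[i]]_p).
Implicit Types (f g : CX) (v : V).

Let z0 : z != 0.
Proof. by apply/eqP => z0; move: z1; rewrite z0 rnorm0 => /esym/eqP; rewrite oner_eq0. Qed.

(* C^p is identified with the functions on Z multiplied by 1/z under translation
   by p; there delta acts as the shift. *)
Definition quasi_ext v (k : int) : R[i] :=
  z ^ (- (k %/ p)%Z) * v (inord `|(k %% p)%Z|%N) 0.

Let Z_ind (P : int -> Prop) :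
  (forall j : 'I_p, P j%:Z) -> (forall k, P k <-> P (k + p%:Z)) -> forall k, P k.
Proof.
move=> P0 PS k; rewrite (divz_eq k p); set r := (k %% p)%Z; set m := (k %/ p)%Z.
have [j rj] : exists j : 'I_p, r = j%:Z.
  have r0 : 0 <= r by rewrite modz_ge0.
  have rp : r < p%:Z by rewrite ltz_pmod.
  have rp' : (`|r| < p)%N by lia.
  by exists (Ordinal rp') => /=; lia.
rewrite rj; elim/int_rect: m => [|m IH|m IH].
- by rewrite mul0r add0r.
- have -> : m.+1%:Z * p%:Z + j%:Z = m%:Z * p%:Z + j%:Z + p%:Z by lia.
  exact: (proj1 (PS _)).
- by apply: (proj2 (PS _)); have -> : - m.+1%:Z * p%:Z + j%:Z + p%:Z = - m%:Z * p%:Z + j%:Z by lia.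
Qed.

Lemma quasi_ext_ord v (j : 'I_p) : quasi_ext v j = v j 0.
Proof.
rewrite /quasi_ext divz_small ?oppr0 ?expr0z ?mul1r; last first.
  by rewrite /= ltz_nat ltn_ord.
by rewrite modz_small /= ?inord_val// ltz_nat ltn_ord.
Qed.

Lemma quasi_extD v k : quasi_ext v (k + p%:Z) = z^-1 * quasi_ext v k.
Proof.
rewrite /quasi_ext modzDr divzDr ?dvdzz// divzz /= opprD expfzDr//.
by rewrite -[z ^ (-1)]/(z^-1) [_ * z^-1]mulrC mulrA.
Qed.

Lemma quasi_ext_unique (g : int -> R[i]) : (forall k, g (k + p%:Z) = z^-1 * g k) ->
  quasi_ext (\col_(j < p) g j) =1 g.
Proof.
move=> gp; apply: Z_ind => [j|k]; first by rewrite quasi_ext_ord mxE.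
rewrite quasi_extD gp; split=> [->//|]; apply: mulfI.
by rewrite invr_eq0.
Qed.

Lemma rnorm_quasi_ext v k : rnorm (quasi_ext v k) <= rnorm v.
Proof.
have zi (c : R[i]) : rnorm (z^-1 * c) = rnorm c.
  by rewrite -[in RHS](mulVKf z0 c) [in RHS]crnormM z1 mul1r.
move: k; apply: Z_ind => [j|k]; first by rewrite quasi_ext_ord rnorm_col_entry.
by rewrite quasi_extD zi.
Qed.

Lemma quasi_ext_linear k : linear (quasi_ext^~ k).
Proof.
by move=> c u v; rewrite /quasi_ext !mxE mulrDr mulrCA.
Qed.

Definition per_mul f v : V := \col_(j < p) (f (dyn_iter j x) * v j 0).
Definition per_shift (n : int) v : V := \col_(j < p) quasi_ext v (j%:Z - n).

Let per_iter k : dyn_iter (k + p%:Z) x = dyn_iter k x.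
Proof. by rewrite dyn_iterD px. Qed.

Lemma quasi_ext_mul f v k :
  quasi_ext (per_mul f v) k = f (dyn_iter k x) * quasi_ext v k.
Proof.
have := @quasi_ext_unique (fun k => f (dyn_iter k x) * quasi_ext v k).
move=> <- => [|l]; last by rewrite per_iter quasi_extD mulrCA.
by congr quasi_ext; apply/colP => j; rewrite !mxE quasi_ext_ord.
Qed.

Lemma quasi_ext_shift n v k : quasi_ext (per_shift n v) k = quasi_ext v (k - n).
Proof.
by rewrite (@quasi_ext_unique (fun k => quasi_ext v (k - n)))// => l; rewrite addrAC quasi_extD.
Qed.

Definition per_rep : A -> V -> V := covariant_rep per_mul per_shift.

Let cV : abs_complete V := @col_abs_complete R p.

Let D_linearl v : linear (per_mul^~ v).
Proof. by move=> c f g; apply/colP => j; rewrite !mxE !cfunE mulrDl mulrA. Qed.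

Let D_linearr f : linear (per_mul f).
Proof. by move=> c u v; apply/colP => j; rewrite !mxE mulrDr mulrCA. Qed.

Let DM f g v : per_mul (f * g) v = per_mul f (per_mul g v).
Proof. by apply/colP => j; rewrite !mxE cfunE mulrA. Qed.

Let D_le f v : rnorm (per_mul f v) <= rnorm f * rnorm v.
Proof.
apply: rnorm_col_le => [|i]; first by rewrite mulr_ge0 ?rnorm_ge0.
by rewrite mxE crnormM ler_pM ?rnorm_ge0 ?rnorm_eval ?rnorm_col_entry.
Qed.

Let U_linear n : linear (per_shift n).
Proof. by move=> c u v; apply/colP => j; rewrite !mxE quasi_ext_linear. Qed.

Let UD m n v : per_shift (m + n) v = per_shift m (per_shift n v).
Proof. by apply/colP => j; rewrite !mxE quasi_ext_shift opprD addrA. Qed.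

Let U_le n v : rnorm (per_shift n v) <= rnorm v.
Proof.
by apply: rnorm_col_le => [|i]; rewrite ?rnorm_ge0// mxE rnorm_quasi_ext.
Qed.

Let UDE n f v : per_shift n (per_mul f v) = per_mul (alpha n f) (per_shift n v).
Proof.
by apply/colP => j; rewrite !mxE quasi_ext_mul alphaE addrC dyn_iterD.
Qed.

Lemma per_rep_le a v : rnorm (per_rep a v) <= rnorm a * rnorm v.
Proof. exact: (covariant_rep_le cV). Qed.

Lemma per_rep_is_pi_per : is_pi_per x z per_rep.
Proof.
have single n f v : per_rep (ell1_single n f) v = per_mul f (per_shift n v).
  exact (@covariant_rep_single R S V cV per_mul per_shift D_linearl n f v).
have shift0 v : per_shift 0 v = v.
  by apply/colP => j; rewrite mxE subr0 quasi_ext_ord.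
split.
- exact: (covariant_rep_representation cV).
- by exists 1 => a v; rewrite mul1r; exact: (covariant_rep_contractive cV).
- move=> f j; rewrite single shift0; apply/colP => i; rewrite !mxE.
  by case: eqP => [->//|_]; rewrite !mulr0.
- move=> i j ji; rewrite single; apply/colP => k; rewrite !mxE cfun1E mul1r.
  case: (ltnP 0 k) => k0.
    have k1 : (k.-1 < p)%N by apply: leq_ltn_trans (leq_pred _) (ltn_ord k).
    have -> : k%:Z - 1 = (Ordinal k1)%:Z by rewrite /=; lia.
    rewrite quasi_ext_ord mxE !andbT; congr (_%:R); congr nat_of_bool.
    by apply/idP/idP => /eqP/(congr1 val)/= h; apply/eqP/val_inj => /=; lia.
  (* For [k = 0] the shifted index is [-1], one period below the last basis index; as [i] is not the
     last index, the value there is 0. *)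
  have k0' : k%:Z - 1 = (ord_max : 'I_p)%:Z - p%:Z by rewrite /=; lia.
  rewrite k0'.
  have := quasi_extD (basis_vec R i) ((ord_max : 'I_p)%:Z - p%:Z).
  rewrite subrK quasi_ext_ord mxE andbT => h.
  have iq : (ord_max == i) = false.
    by apply/negP => /eqP im; have := ltn_ord j; rewrite ji -im /= ltnn.
  have kj : (k == j) = false.
    by apply/negP => /eqP kj; move: k0; rewrite kj ji.
  rewrite kj; move: h; rewrite iq => /esym/eqP; rewrite mulf_eq0 invr_eq0.
  by rewrite (negbTE z0) => /eqP ->.
- move=> i j ip j0; rewrite single; apply/colP => k; rewrite !mxE cfun1E mul1r.
  have im : i = ord_max by apply: val_inj => /=; lia.
  case: (ltnP 0 k) => k0.
    have k1 : (k.-1 < p)%N by apply: leq_ltn_trans (leq_pred _) (ltn_ord k).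
    have -> : k%:Z - 1 = (Ordinal k1)%:Z by rewrite /=; lia.
    rewrite quasi_ext_ord mxE !andbT.
    have -> : (k == j) = false by apply/negP => /eqP kj; rewrite kj j0 in k0.
    have -> : (Ordinal k1 == i) = false.
      apply/negP => /eqP/(congr1 val)/=; rewrite im /=.
      by have := ltn_ord k; lia.
    by rewrite mulr0.
  (* The wrap-around creates the scalar: the value 1 at the last index is [z^-1] times the value at
     [-1], which is therefore [z]. *)
  have k0' : k%:Z - 1 = (ord_max : 'I_p)%:Z - p%:Z by rewrite /=; lia.
  rewrite k0'; have := quasi_extD (basis_vec R i) ((ord_max : 'I_p)%:Z - p%:Z).
  rewrite subrK quasi_ext_ord mxE andbT im eqxx => h.
  have -> : (k == j) by apply/eqP/val_inj => /=; lia.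
  by rewrite andbT; apply/(mulfI (_ : z^-1 != 0)); rewrite ?invr_eq0// -h mulKf.
Qed.

End PeriodicRepresentation.

(** * Periods, return times and orbits *)

Section Orbits.
Variable S : dynsys.
Implicit Types (x y : S) (m n : int).

Lemma dyn_iter_inj n : injective (dyn_iter n : S -> S).
Proof. exact: can_inj (@dyn_iterK S n). Qed.

Lemma dyn_iterM x (p : nat) (m : int) : dyn_iter p x = x -> dyn_iter (m * p%:Z) x = x.
Proof.
move=> px; elim/int_rect: m => [|m IH|m IH]; first by rewrite mul0r.
  have -> : m.+1%:Z * p%:Z = m%:Z * p%:Z + p%:Z by lia.
  by rewrite dyn_iterD px.
apply: (@dyn_iter_inj p); rewrite -dyn_iterD px.
by have -> : p%:Z + - m.+1%:Z * p%:Z = - m%:Z * p%:Z by lia.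
Qed.

Lemma dyn_iter_mod x (p : nat) n : (0 < p)%N -> dyn_iter p x = x ->
  exists2 j : nat, (j < p)%N & dyn_iter n x = dyn_iter j x.
Proof.
move=> p0 px; exists `|(n %% p)%Z|%N.
  have r0 : 0 <= (n %% p)%Z by rewrite modz_ge0//; lia.
  have rp : (n %% p)%Z < p%:Z by rewrite ltz_pmod.
  lia.
rewrite {1}(divz_eq n p) addrC dyn_iterD dyn_iterM//; congr (dyn_iter _ _).
by rewrite gez0_abs// modz_ge0//; lia.
Qed.

Lemma per_orbitE x (p : nat) : (0 < p)%N -> dyn_iter p x = x ->
  dyn_orbit x = [set dyn_iter (Posz j) x | j in `I_p].
Proof.
move=> p0 px; apply/seteqP; split => [_ [n _ <-]|_ [j _ <-]]; last by exists j.
by have [j jp ->] := dyn_iter_mod n p0 px; exists j.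
Qed.

Lemma per_return x (p : nat) : (0 < p)%N -> dyn_iter p x = x -> Per x.
Proof.
by move=> p0 px; rewrite /Per /= (per_orbitE p0 px); exact/finite_image/finite_II.
Qed.

Lemma return_has_period x (p : nat) : (0 < p)%N -> dyn_iter p x = x ->
  exists q, has_period x q.
Proof.
move=> p0 px; have ex : exists q, (0 < q)%N && `[< dyn_iter (Posz q) x = x >].
  by exists p; rewrite p0; exact/asboolP.
case: (ex_minnP ex) => q /andP[q0 /asboolP qx] min; exists q; split => // r.
move=> /andP[r0 rq] rx; have := min r.
by rewrite r0/= => /(_ (introT (asboolP _) rx)); rewrite leqNgt rq.
Qed.

Lemma dyn_iter_return x m n : m < n -> dyn_iter m x = dyn_iter n x ->
  exists2 p : nat, (0 < p)%N & dyn_iter p x = x.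
Proof.
move=> mn h; exists `|n - m|%N; first lia.
have -> : `|n - m|%N%:Z = - m + n :> int by lia.
by rewrite dyn_iterD -h dyn_iterK.
Qed.

Lemma aper_inj x : Aper x -> injective (fun n => dyn_iter n x).
Proof.
move=> xA m n /= mn; apply/eqP; rewrite eq_le !leNgt -negb_or; apply/negP.
have absurd k l : k < l -> dyn_iter k x = dyn_iter l x -> False.
  by move=> kl /(dyn_iter_return kl)[p p0 px]; exact: xA (per_return p0 px).
by move=> /orP[] h; [exact: absurd h (esym mn)|exact: absurd h mn].
Qed.

Lemma per_has_period x : Per x -> exists p, has_period x p.
Proof.
move=> xP; apply: contrapT => np; apply: infinite_nat.
rewrite -(_ : (fun k : nat => dyn_iter k x) @^-1` (dyn_orbit x) = setT).
  apply: finite_preimage xP => k l _ _ /= kl; apply/eqP; rewrite eq_le !leNgt.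
  rewrite -negb_or; apply/negP => /orP[] h; apply: np.
    have h' : l%:Z < k%:Z by [].
    by have [p p0] := dyn_iter_return h' (esym kl); exact: return_has_period.
  have h' : k%:Z < l%:Z by [].
  by have [p p0] := dyn_iter_return h' kl; exact: return_has_period.
by apply/seteqP; split => // k _; exists (Posz k).
Qed.

Lemma has_period_inj x p (j k : nat) : has_period x p -> (j < p)%N -> (k < p)%N ->
  dyn_iter j x = dyn_iter k x -> j = k.
Proof.
move=> [p0 px min].
have main (a b : nat) : (a < b)%N -> (b < p)%N -> dyn_iter a x = dyn_iter b x -> False.
  move=> ab bp h; apply: (min (b - a)%N); first by lia.
  have -> : (b - a)%N%:Z = - a%:Z + b%:Z by lia.
  by rewrite dyn_iterD -h dyn_iterK.
move=> jp kp jk; case: (ltngtP j k) => // h; exfalso.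
  exact: main h kp jk.
exact: main h jp (esym jk).
Qed.

Lemma orbit_iter x n : dyn_orbit x (dyn_iter n x).
Proof. by exists n. Qed.

Lemma finite_closed (A : set S) : finite_set A -> closed A.
Proof.
move=> fA; apply: (proj1 accessible_finite_set_closed _ _ fA).
exact: hausdorff_accessible (@dyn_hausdorff S).
Qed.

End Orbits.

Section FiniteDimension.
Variables (F : fieldType) (E : lmodType F).

(** The matrix of coordinates has more rows than columns, hence a nonzero left kernel; the spanning
    family may itself be dependent. *)
Lemma spanned_dependent (n : nat) (e : 'I_n -> E) (w : 'I_n.+1 -> E) :
  (forall v, exists c : 'I_n -> F, v = \sum_(i < n) c i *: e i) ->
  exists c : 'I_n.+1 -> F, (exists i, c i != 0) /\ \sum_(i < n.+1) c i *: w i = 0.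
Proof.
move=> span; have [M wM] := choice (fun i => span (w i)).
pose B : 'M[F]_(n.+1, n) := \matrix_(i, j) M i j.
have : kermx B != 0.
  rewrite -mxrank_eq0 mxrank_ker -lt0n subn_gt0 ltnS.
  exact: rank_leq_col.
move=> /rowV0Pn[u /sub_kermxP uB u0]; exists (fun i => u 0 i); split.
  apply: contrapT => h; move/eqP: u0; apply; apply/rowP => i; rewrite mxE.
  by apply: contrapT => ui; apply: h; exists i; exact/eqP.
under eq_bigr do rewrite wM scaler_sumr.
rewrite exchange_big /= big1// => j _.
under eq_bigr do rewrite scalerA.
rewrite -scaler_suml.
have -> : \sum_(i < n.+1) u 0 i * M i j = (u *m B) 0 j.
  by rewrite !mxE; apply: eq_bigr => i _; rewrite mxE.
by rewrite uB mxE scale0r.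
Qed.

End FiniteDimension.

Section Separation.
Variables (R : realType) (S : dynsys).
Local Notation CX := (cfun R S).
Implicit Types (f : CX) (x : S).

Lemma separating_cfun x (s : seq S) : ~ [set` s] x ->
  exists f, [/\ f x = 1, forall y, y \in s -> f y = 0 & rnorm f <= 1].
Proof.
move=> xs; have [|||f [f0 f1 fle]] := @urysohn_cfun R S [set` s] [set x].
- by apply: finite_closed; exact: finite_seq.
- exact: dyn_closed1.
- by rewrite -subset0 => y [ys /= yx]; apply: xs; rewrite -yx.
by exists f; split => //; exact: f1.
Qed.

Lemma cfun_closure0 (Y : set S) f :
  (forall x, Y x -> f x = 0) -> forall x, closure Y x -> f x = 0.
Proof.
move=> fY x Yx; apply: contrapT => /eqP fx.
have [y [/fY fy /= /eqP]] := Yx [set y | f y != 0] (open_nbhs_nbhs (conj (open_neq0 f) fx)).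
by [].
Qed.

Lemma closed_separated (Y Z : set S) : closed Y ->
  (forall f, (forall x, Y x -> f x = 0) -> forall x, Z x -> f x = 0) -> Z `<=` Y.
Proof.
move=> cY h z Zz; apply: contrapT => Yz.
have [f [f0 f1 _]] : exists f, [/\ forall y, Y y -> f y = 0,
    forall y, [set z] y -> f y = 1 & rnorm f <= 1].
  apply: urysohn_cfun => //; first exact: dyn_closed1.
  by rewrite -subset0 => y [Yy /= yz]; apply: Yz; rewrite -yz.
by have /eqP := h _ f0 z Zz; rewrite f1// oner_eq0.
Qed.

End Separation.

Section Ell1Mono.
Variables (R : realType) (V W : normedModType R[i]).

Lemma ell1_norm_mono (a : ell1 V) (b : ell1 W) :
  (forall n, rnorm (a n) <= rnorm (b n)) -> rnorm a <= rnorm b.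
Proof.
move=> ab; apply: ell1_norm_le => s us; apply: le_trans (ell1_sum_le b us).
exact: ler_sum.
Qed.

Lemma ell1_eval_bounded n : bounded_lin (fun a : ell1 V => a n).
Proof. by split => //; exists 1 => a; rewrite mul1r rnorm_ell1_eval. Qed.

End Ell1Mono.

(** * Kernel and irreducibility at aperiodic points *)

Section PiAper.
Variables (R : realType) (S : dynsys) (x : S).
Local Notation CX := (cfun R S).
Local Notation A := (ell1 CX).
Local Notation V := (ell1 R[i]).
Variable pi : A -> V -> V.
Hypothesis pix : is_pi_aper x pi.
Implicit Types (f g : CX) (a b : A) (v : V) (k m n : int).

Let rep : representation pi. Proof. by case: pix. Qed.

Lemma pi_aper_le a v : rnorm (pi a v) <= rnorm a * rnorm v.
Proof. by have [_ h _ _] := pix; rewrite -lecR rmorphM /= !rnormE; exact: h. Qed.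

Lemma pi_aper_boundedl v : bounded_lin (pi^~ v).
Proof.
split=> [c a b|]; first exact: (repZDl rep).
by exists (rnorm v) => a; rewrite mulrC pi_aper_le.
Qed.

Lemma pi_aper_boundedr a : bounded_lin (pi a).
Proof.
split=> [c u v|]; first exact: (repZDr rep).
by exists (rnorm a) => v; exact: pi_aper_le.
Qed.

Lemma ell1_single_basis n (c : R[i]) : ell1_single n c = c *: basis_vecZ R n.
Proof.
apply: ell1P => m; have -> : (c *: basis_vecZ R n) m = c * basis_vecZ R n m by [].
by rewrite /=; case: eqP; rewrite ?mulr1 ?mulr0.
Qed.

Lemma pi_aper_one v : pi (ell1_one R S) v = v.
Proof.
move: v; apply: bounded_lin_eq => [||n c]; first exact: pi_aper_boundedr.
  by split => //; exists 1 => v; rewrite mul1r.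
rewrite ell1_single_basis (repZr rep); have [_ _ h _] := pix.
by rewrite h cfun1E scale1r.
Qed.

Lemma pi_aper_delta n k : pi (delta_pow R S n) (basis_vecZ R k) = basis_vecZ R (k + n).
Proof.
have [_ _ _ pos] := pix.
have neg l : pi (delta_pow R S (- 1)) (basis_vecZ R l) = basis_vecZ R (l - 1).
  rewrite -[in LHS](subrK 1 l) -pos -(repM rep) delta_powD addNr.
  exact: pi_aper_one.
elim/int_rect: n k => [|n IH|n IH] k; first by rewrite addr0; exact: pi_aper_one.
  have -> : n.+1%:Z = 1 + n%:Z :> int by lia.
  rewrite -delta_powD (repM rep) IH [LHS]pos; congr basis_vecZ; lia.
have -> : - n.+1%:Z = - 1 - n%:Z :> int by lia.
by rewrite -delta_powD (repM rep) IH neg; congr basis_vecZ; lia.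
Qed.

Lemma pi_aper_single n f k : pi (ell1_single n f) (basis_vecZ R k) =
  f (dyn_iter (k + n) x) *: basis_vecZ R (k + n).
Proof.
rewrite single_split (repM rep) pi_aper_delta; have [_ _ h _] := pix.
exact: h.
Qed.

(** Contractivity makes both sides bounded in [a], so the prescribed values on C(X) and [delta]
    determine every matrix coefficient. This is why the kernel sees only the orbit closure. *)
Lemma pi_aper_coord a k m :
  pi a (basis_vecZ R k) m = a (m - k) (dyn_iter m x).
Proof.
move: a; apply: bounded_lin_eq => [||n f].
- exact: (bounded_lin_comp (pi_aper_boundedl _) (ell1_eval_bounded _ _)).
- split=> [//|]; exists 1 => a; rewrite mul1r.
  by rewrite (le_trans (rnorm_eval _ _))// rnorm_ell1_eval.
rewrite pi_aper_single -ell1_single_basis !ell1_singleE subr_eq (addrC n).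
by case: eqP => [->//|_]; rewrite cfun0E.
Qed.

Lemma pi_aper_ker : rep_ker pi =
  [set a : A | forall n y, closure (dyn_orbit x) y -> a n y = 0].
Proof.
apply/seteqP; split => a /= h.
  move=> n; apply: cfun_closure0 => _ [m _ <-].
  have := h (basis_vecZ R (m - n)) => /(congr1 (fun v : V => v m)).
  by rewrite pi_aper_coord opprB addrC subrK.
apply: bounded_lin0 => [|k c]; first exact: pi_aper_boundedr.
rewrite ell1_single_basis (repZr rep).
have -> : pi a (basis_vecZ R k) = 0; last by rewrite scaler0.
apply: ell1P => m; rewrite pi_aper_coord h//; apply: subset_closure.
exact: orbit_iter.
Qed.

Lemma pi_aper_emb f v n : pi (cfun_emb f) v n = f (dyn_iter n x) * v n.
Proof.
move: v; apply: bounded_lin_eq => [||k c].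
- exact: (bounded_lin_comp (pi_aper_boundedr _) (ell1_eval_bounded _ _)).
- split=> [c u v|].
    by rewrite -[(c *: u + v) n]/(c * u n + v n) mulrDr mulrCA.
  exists (rnorm f) => v; rewrite crnormM ler_pM ?rnorm_ge0 ?rnorm_eval//.
  exact: rnorm_ell1_eval.
rewrite ell1_single_basis (repZr rep); have [_ _ h _] := pix.
rewrite h scalerA mulrC -!ell1_single_basis !ell1_singleE.
by case: eqP => [->//|_]; rewrite mulr0.
Qed.

Lemma pi_aper_shift k v n : pi (delta_pow R S k) v n = v (n - k).
Proof.
move: v; apply: bounded_lin_eq => [||m c].
- exact: (bounded_lin_comp (pi_aper_boundedr _) (ell1_eval_bounded _ _)).
- exact: ell1_eval_bounded.
rewrite ell1_single_basis (repZr rep) pi_aper_delta -!ell1_single_basis !ell1_singleE.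
by rewrite subr_eq.
Qed.

(** The element with constant coefficients [v n] sends [e_0] to [v]. Having no loss of norm keeps
    the perturbation of [e_0] below in the range of the Neumann series. *)
Lemma pi_aper_lift v : exists2 a, pi a (basis_vecZ R 0) = v & rnorm a <= rnorm v.
Proof.
have [|a aE av] := @ell1_sum_dominated R CX (fun n => cfun_cst S (v n)) (rnorm v).
  move=> s us; apply: le_trans (ell1_sum_le v us); apply: ler_sum => n _.
  by rewrite rnorm_cfunE; apply: sup_norm_le.
by exists a => //; apply: ell1P => m; rewrite pi_aper_coord aE subr0.
Qed.

Hypothesis xA : Aper x.

(* A nonzero invariant subspace contains, after localising with a function of
   C(X), a vector of the form e_0 + r with |r| <= 1/2; it is the image of e_0
   under an invertible element. *)
Lemma pi_aper_irreducible : alg_irreducible pi.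
Proof.
have e00 : basis_vecZ R 0 <> 0.
  by move/(congr1 (fun v : V => v 0))/eqP; rewrite /= oner_eq0.
split => //; first by exists (ell1_one R S), (basis_vecZ R 0); rewrite pi_aper_one.
move=> F [F0 FL] FI; have [FF|] := pselect (exists2 v, F v & v <> 0); last first.
  move=> h; left; apply/seteqP; split => v /=; last by move=> ->.
  by move=> Fv; apply: contrapT => v0; apply: h; exists v.
right; apply/seteqP; split => // u _.
have FZ c v : F v -> F (c *: v) by move=> Fv; rewrite -[c *: v]addr0; exact: FL.
suff Fe : F (basis_vecZ R 0) by have [a <- _] := pi_aper_lift u; exact: FI.
have [v Fv v1] : exists2 v, F v & v 0 = 1.
  case: FF => v Fv v0; have [k vk] : exists k, v k != 0.
    apply: contrapT => h; apply: v0; apply: ell1P => k.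
    by apply: contrapT => vk; apply: h; exists k; exact/eqP.
  exists ((v k)^-1 *: pi (delta_pow R S (- k)) v); first exact/FZ/FI.
  rewrite -[LHS]/((v k)^-1 * pi (delta_pow R S (- k)) v 0) pi_aper_shift.
  by rewrite sub0r opprK mulVf.
have [s us hs] := @ell1_approx R R[i] v (1 / 2) ltac:(lra).
pose t := undup (0 :: s).
have ut : uniq t by exact: undup_uniq.
have st : {subset s <= t} by move=> n ns; rewrite mem_undup in_cons ns orbT.
have {hs} := hs t ut st; set r := v - _ => hr.
have rE n : r n = if n \in t then 0 else v n.
  have -> : r n = v n - (\sum_(n <- t) ell1_single n (v n)) n by [].
  by rewrite ell1_sum_singleE//; case: ifP; rewrite ?subrr ?subr0.
(* [h] kills the finitely many coordinates in [t] other than 0, which aperiodicity keeps away from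
   [x]; the coordinates outside [t] have mass at most 1/2. *)
have [h [h1 h0 hle]] : exists h : CX, [/\ h x = 1,
    forall y, y \in [seq dyn_iter n x | n <- t & n != 0] -> h y = 0 & rnorm h <= 1].
  apply: separating_cfun => /mapP[n]; rewrite mem_filter => /andP[n0 _] xn.
  have /= := @aper_inj _ _ xA 0 n xn => n0'.
  by move: n0; rewrite -n0' eqxx.
pose w := pi (cfun_emb h) v - basis_vecZ R 0.
have wr : rnorm w <= 1 / 2.
  apply: le_trans hr; apply: ell1_norm_mono => n; rewrite rE.
  have -> : w n = h (dyn_iter n x) * v n - basis_vecZ R 0 n.
    by rewrite -pi_aper_emb.
  have [n0|n0] := eqVneq n 0.
    by rewrite n0 /= h1 v1 mulr1 subrr mem_undup mem_head.
  rewrite /basis_vecZ ell1_singleE (negbTE n0) subr0.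
  case: ifPn => nt; last first.
    by rewrite crnormM ler_piMl ?rnorm_ge0// (le_trans (rnorm_eval _ _)).
  by rewrite h0 ?mul0r//; apply: map_f; rewrite mem_filter n0.
have [a aw aw'] := pi_aper_lift w.
have [|b bE _] := @ell1_left_inverse R S (- a) (1 / 2) _ ltac:(lra).
  by rewrite rnormN (le_trans aw').
have -> : basis_vecZ R 0 = pi b (pi (cfun_emb h) v).
  have -> : pi (cfun_emb h) v = pi (ell1_one R S - (- a)) (basis_vecZ R 0).
    by rewrite opprK (repDl rep) pi_aper_one aw /w addrC subrK.
  by rewrite -(repM rep) bE pi_aper_one.
by apply: (FI); exact: FI.
Qed.

Lemma ell1C_infinite_dimensional : ~ finite_dimensional V.
Proof.
move=> [n [e span]].
have [c [[i ci] c0]] := spanned_dependent (fun i : 'I_n.+1 => basis_vecZ R i) span.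
move/(congr1 (fun v : V => v i%:Z)): c0; rewrite ell1_sumE.
have cE j : (c j *: basis_vecZ R j) i%:Z = c j * (i == j)%:R.
  transitivity (c j * basis_vecZ R j i%:Z) => //.
  by rewrite /basis_vecZ ell1_singleE eqz_nat val_eqE; case: eqP.
under eq_bigr do rewrite cE; rewrite (bigD1 i)//= eqxx big1 => [|j ji].
  by rewrite mulr1 addr0 => /eqP; rewrite (negbTE ci).
by rewrite eq_sym (negbTE ji) mulr0.
Qed.

End PiAper.

(** * Kernel and irreducibility at periodic points *)

Section PiPer.
Variables (R : realType) (S : dynsys) (x : S) (p : nat) (z : R[i]).
Local Notation CX := (cfun R S).
Local Notation A := (ell1 CX).
Local Notation V := ('cV[R[i]]_p).
Variable pi : A -> V -> V.
Hypothesis xp : has_period x p.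
Hypothesis pix : is_pi_per x z pi.
Implicit Types (f g : CX) (a b : A) (v : V) (i j k l : 'I_p).

Let rep : representation pi. Proof. by case: pix. Qed.

Lemma basis_vec_sum v : v = \sum_j v j 0 *: basis_vec R j.
Proof.
rewrite [LHS]matrix_sum_delta; apply: eq_bigr => j _.
by rewrite big_ord1.
Qed.

Lemma pi_per_emb f v j : pi (cfun_emb f) v j 0 = f (dyn_iter j x) * v j 0.
Proof.
rewrite [in LHS](basis_vec_sum v) (rep_sumr rep) summxE (bigD1 j)//= big1.
  by have [_ _ h _ _] := pix; rewrite addr0 (repZr rep) h !mxE !eqxx mulr1 mulrC.
move=> i ij; have [_ _ h _ _] := pix; rewrite (repZr rep) h !mxE.
by rewrite eq_sym (negbTE ij) !mulr0.
Qed.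

Lemma pi_per_one v : pi (ell1_one R S) v = v.
Proof. by apply/colP => j; rewrite pi_per_emb cfun1E mul1r. Qed.

(** Every basis vector is reached from [e_0] by a power below [p], so nothing wraps around and the
    scalar [z] does not enter. *)
Lemma pi_per_delta i j : pi (delta_pow R S (j%:Z - i%:Z)) (basis_vec R i) = basis_vec R j.
Proof.
have [p0 _ _] := xp; pose o := Ordinal p0.
have base (m : nat) (mp : (m < p)%N) :
    pi (delta_pow R S m) (basis_vec R o) = basis_vec R (Ordinal mp).
  elim: m mp => [|m IH] mp.
    have -> : Ordinal mp = o by apply: val_inj.
    exact: pi_per_one.
  have mp' := ltnW mp.
  have -> : m.+1%:Z = 1 + m%:Z :> int by lia.
  rewrite -delta_powD (repM rep) (IH mp'); have [_ _ _ h _] := pix.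
  exact: (h (Ordinal mp') (Ordinal mp)).
have bi : basis_vec R i = pi (delta_pow R S i%:Z) (basis_vec R o).
  by rewrite (base i (ltn_ord i)); congr basis_vec; apply: val_inj.
rewrite bi -(repM rep) delta_powD subrK (base j (ltn_ord j)).
by congr basis_vec; apply: val_inj.
Qed.

Lemma per_separating j : exists f, forall n : int,
  (dyn_iter n x = dyn_iter j x -> f (dyn_iter n x) = 1) /\
  (dyn_iter n x <> dyn_iter j x -> f (dyn_iter n x) = 0).
Proof.
have [p0 px _] := xp.
have [f [f1 f0 _]] : exists f : CX, [/\ f (dyn_iter j x) = 1, forall y,
    y \in [seq dyn_iter (Posz (k : 'I_p)) x | k <- enum 'I_p & k != j] -> f y = 0 &
    rnorm f <= 1].
  apply: separating_cfun => /mapP[k]; rewrite mem_filter => /andP[kj _].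
  move=> /(has_period_inj xp (ltn_ord j) (ltn_ord k)) jk.
  by move/eqP: kj; apply; apply: val_inj.
exists f => n; split => [->//|nj].
have [m mp mE] := dyn_iter_mod n p0 px; rewrite mE in nj *.
apply: f0; apply/mapP; exists (Ordinal mp) => //; rewrite mem_filter mem_enum andbT.
by apply/eqP => mj; apply: nj; rewrite -mj.
Qed.

(** Such an [f] acts as the diagonal matrix unit at [j]. *)
Lemma pi_per_sep j f : (forall n : int,
  (dyn_iter n x = dyn_iter j x -> f (dyn_iter n x) = 1) /\
  (dyn_iter n x <> dyn_iter j x -> f (dyn_iter n x) = 0)) ->
  forall v, pi (cfun_emb f) v = v j 0 *: basis_vec R j.
Proof.
move=> fj v; apply/colP => i; rewrite pi_per_emb !mxE andbT.
have [->|ij] := eqVneq i j; first by rewrite (proj1 (fj j))// mul1r mulr1.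
rewrite (proj2 (fj i)) ?mul0r ?mulr0// => /(has_period_inj xp (ltn_ord i) (ltn_ord j)) h.
by move/eqP: ij; apply; apply: val_inj.
Qed.

Lemma pi_per_irreducible : alg_irreducible pi.
Proof.
have [p0 _ _] := xp; pose o := Ordinal p0.
have o0 : basis_vec R o <> 0.
  by move/colP/(_ o)/eqP; rewrite !mxE eqxx oner_eq0.
split => //; first by exists (ell1_one R S), (basis_vec R o); rewrite pi_per_one.
move=> F [F0 FL] FI; have [[v Fv v0]|] := pselect (exists2 v, F v & v <> 0); last first.
  move=> h; left; apply/seteqP; split => v /=; last by move=> ->.
  by move=> Fv; apply: contrapT => v0; apply: h; exists v.
right; apply/seteqP; split => // u _.
have FZ c w : F w -> F (c *: w) by move=> Fw; rewrite -[c *: w]addr0; exact: FL.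
have FD w w' : F w -> F w' -> F (w + w') by rewrite -{2}(scale1r w); exact: FL.
have [j vj] : exists j, v j 0 != 0.
  apply: contrapT => h; apply: v0; apply/colP => j; rewrite mxE.
  by apply: contrapT => vj; apply: h; exists j; exact/eqP.
have Fj : F (basis_vec R j).
  have [f /pi_per_sep fj] := per_separating j.
  rewrite -[basis_vec R j]scale1r -(mulVf vj) -scalerA -fj.
  exact/FZ/FI.
rewrite (basis_vec_sum u); elim/big_ind : _ => // i _; apply: FZ.
by rewrite -(pi_per_delta j i); exact: FI.
Qed.

Lemma pi_per_ker_emb f : (forall v, pi (cfun_emb f) v = 0) <->
  (forall y, dyn_orbit x y -> f y = 0).
Proof.
have [p0 px _] := xp; split => [h y|h v].
  rewrite (per_orbitE p0 px) => -[j /= jp <-].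
  have := h (basis_vec R (Ordinal jp)) => /colP/(_ (Ordinal jp)).
  by rewrite pi_per_emb !mxE eqxx mulr1.
by apply/colP => j; rewrite pi_per_emb h ?mul0r ?mxE//; exact: orbit_iter.
Qed.

Lemma pi_per_ker_sub a :
  (forall n y, dyn_orbit x y -> a n y = 0) -> rep_ker pi a.
Proof.
move=> h v; apply: (irr_annihilator_dense pi_per_irreducible) => n.
by rewrite single_split (repM rep); move: (pi _ v); apply/pi_per_ker_emb/h.
Qed.

(* The image of pi contains all matrix units, so an ideal strictly containing
   the kernel contains an invertible element. *)
Lemma pi_per_ker_maximal (E : lmodType R[i]) (pi' : A -> E -> E) :
  alg_irreducible pi' -> rep_ker pi `<=` rep_ker pi' -> rep_ker pi' `<=` rep_ker pi.
Proof.
move=> irr' sub a a' v; apply: contrapT => av.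
have rep' : representation pi' by case: irr'.
have [j aj] : exists j, pi a (basis_vec R j) <> 0.
  apply: contrapT => h; apply: av; rewrite (basis_vec_sum v) (rep_sumr rep) big1// => j _.
  rewrite (repZr rep); have -> : pi a (basis_vec R j) = 0; last by rewrite scaler0.
  by apply: contrapT => aj; apply: h; exists j.
have [i ci] : exists i, pi a (basis_vec R j) i 0 != 0.
  apply: contrapT => h; apply: aj; apply/colP => i; rewrite mxE.
  by apply: contrapT => ai; apply: h; exists i; exact/eqP.
set c := pi a (basis_vec R j) i 0 in ci.
have [fi fiE] := per_separating i; have [fj fjE] := per_separating j.
(* A sum over [k] of [E_ki a E_jk] in terms of matrix units: it spreads the entry [c] of [a] along
   the diagonal, so [T] acts as [c] times the identity. *)
pose T := \sum_(k < p) delta_pow R S (k%:Z - i%:Z) ** (cfun_emb fi ** (a **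
   (cfun_emb fj ** delta_pow R S (j%:Z - k%:Z)))).
have Tl l : pi T (basis_vec R l) = c *: basis_vec R l.
  rewrite (rep_suml rep) (bigD1 l)//= big1 => [|k kl].
    rewrite addr0 !(repM rep) pi_per_delta (pi_per_sep fjE) mxE !eqxx scale1r.
    by rewrite (pi_per_sep fiE) -/c (repZr rep) pi_per_delta.
  rewrite !(repM rep) (_ : pi (cfun_emb fj) _ = 0) ?(rep0r rep)//.
  rewrite -(repM rep) -[fj](alpha_id fj) -(subrr (j%:Z - k%:Z)) -alpha_comp.
  rewrite -delta_pow_emb (repM rep); have [_ _ h _ _] := pix.
  rewrite h alphaE opprK -dyn_iterD (proj2 (fjE _)) ?scale0r ?(rep0r rep)//.
  move=> e; have : dyn_iter l x = dyn_iter k x.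
    apply: (@dyn_iter_inj S (j%:Z - k%:Z)); rewrite -!dyn_iterD e.
    by congr (dyn_iter _ _); lia.
  move/(has_period_inj xp (ltn_ord l) (ltn_ord k)) => lk.
  by move/eqP: kl; apply; apply: val_inj.
(* [pi'] kills [T - c] by inclusion of the kernels, and [T] because every summand contains [a]. So
   it would kill the nonzero scalar [c]. *)
have : rep_ker pi (T - c *: ell1_one R S).
  move=> u; rewrite (basis_vec_sum u) (rep_sumr rep) big1// => l _.
  rewrite (repZr rep) (repBl rep) Tl (repZl rep) pi_per_one subrr scaler0.
  by [].
move/sub => h; have [u u0] := irr_neq0 irr'; apply: u0.
have := h u; rewrite (repBl rep') (repZl rep') (irr_one irr') (rep_suml rep') big1.
  by rewrite sub0r => /eqP; rewrite oppr_eq0 scaler_eq0 (negbTE ci) => /eqP.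
by move=> k _; rewrite !(repM rep') a' !(rep0r rep').
Qed.

End PiPer.

(** * Central isometries are scalars *)

Section ComplexDisc.
Variable R : realType.

(** Compactness is borrowed from the square in [R * R] through the map [t.1 +i* t.2]. *)
Lemma complex_disc_compact_cover (M : R) (Q : set R[i] -> Prop) :
  Q set0 -> (forall B C, Q B -> Q C -> Q (B `|` C)) ->
  (forall z, exists2 e : R, 0 < e & Q [set y | rnorm (z - y) < e]) ->
  exists2 B, Q B & [set z | rnorm z <= M] `<=` B.
Proof.
move=> Q0 QU Qloc.
pose h (t : R * R) : R[i] := t.1 +i* t.2.
pose K : set (R * R) := `[- M, M]%classic `*` `[- M, M]%classic.
have cK : compact K by apply: compact_setX; exact: segment_compact.
have [||t _|B QB KB] := @compact_ind _ K (fun B => exists2 C, Q C & h @` B `<=` C) cK.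
- by exists set0 => // z [].
- move=> B C [B' QB BB] [C' QC CC]; exists (B' `|` C'); first exact: QU.
  by move=> z [y [By|Cy] <-]; [left; apply: BB; exists y|right; apply: CC; exists y].
- have [e e0 Qe] := Qloc (h t); exists (h @^-1` [set y | rnorm (h t - y) < e]).
    have e20 : 0 < e / 2 by rewrite divr_gt0.
    exists (ball t.1 (e / 2), ball t.2 (e / 2)).
      by split; exact: nbhsx_ballx.
    move=> [a b] [] /=; rewrite -!ball_normE /ball_ /= => ha hb.
    have -> : h t - h (a, b) = (t.1 - a) +i* (t.2 - b) by [].
    by rewrite (le_lt_trans (crnorm_le _ _))// (splitr e) ltrD.
  by exists [set y | rnorm (h t - y) < e] => // z [y /= hy <-].
case: QB => C QC BC; exists C => // z /= zM; apply: BC.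
exists (complex.Re z, complex.Im z); last by rewrite /h /=; case: z {zM}.
apply: KB; split; rewrite /= in_itv/= -ler_norml.
  exact: le_trans (Re_le_rnorm z) zM.
exact: le_trans (Im_le_rnorm z) zM.
Qed.

(** Rotation by such a [u] changes the sign of [z ^+ N], as the halving step requires. *)
Lemma complex_root_neg1 (N : nat) : (0 < N)%N ->
  exists2 u : R[i], u ^+ N = -1 & rnorm u = 1.
Proof.
move=> N0; exists (N.-root (-1) : R[i]); first by rewrite rootCK.
have : rnorm ((N.-root (-1) : R[i]) ^+ N) = 1 by rewrite rootCK// rnormN rnorm1.
have -> (c : R[i]) : rnorm (c ^+ N) = rnorm c ^+ N.
  by elim: (N) => [|n IH]; rewrite ?expr0 ?rnorm1// !exprS crnormM IH.
by move/eqP; rewrite pexpr_eq1 ?rnorm_ge0// => /eqP.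
Qed.

End ComplexDisc.

(* Nonempty spectrum of an invertible isometry T, without function theory (after
   Rickart).  B f r says that f has norm at most r.  If all resolvents of T
   exist they are uniformly bounded on a disc, so z / (z - T) varies little
   between the circles of radius 1 - d and 1 + d.  Averaging over the N-th roots
   of unity, N = 2^m, which is done here by repeated halving, the same bound
   holds for z^N / (z^N - T^N); but this tends to 0 inside the unit circle and
   to 1 outside. *)
Section GelfandMazur.
Variables (R : realType) (F : fieldType) (iota : {rmorphism R[i] -> F}).
Variable B : F -> R -> Prop.
Hypothesis B_le : forall f r s, B f r -> r <= s -> B f s.
Hypothesis B_ex : forall f, exists r, B f r.
Hypothesis BD : forall f g r s, B f r -> B g s -> B (f + g) (r + s).
Hypothesis BM : forall f g r s, B f r -> B g s -> B (f * g) (r * s).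
Hypothesis BC : forall c, B (iota c) (rnorm c).
Hypothesis BV : forall f r, B f r -> r < 1 -> B (1 - f)^-1 (1 - r)^-1.
Hypothesis B1 : forall r, B 1 r -> 1 <= r.
Variable T : F.
Hypothesis T0 : T != 0.
Hypothesis BT : B T 1.
Hypothesis BTV : B T^-1 1.
Hypothesis NT : forall c, iota c != T.

Let BN f r : B f r -> B (- f) r.
Proof.
move=> Bf; have := BM (BC (-1)) Bf; rewrite rnormN rnorm1 mul1r.
by rewrite rmorphN1 mulN1r.
Qed.

Let BB f g r s : B f r -> B g s -> B (f - g) (r + s).
Proof. by move=> Bf /BN; exact: BD. Qed.

Let BX f n : B f 1 -> B (f ^+ n) 1.
Proof.
move=> Bf; elim: n => [|n IH].
  by have := BC 1; rewrite rnorm1 rmorph1 expr0.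
by rewrite exprS -[1]mulr1; exact: BM.
Qed.

Let sub0 c : iota c - T != 0.
Proof. by rewrite subr_eq0. Qed.

Lemma resolvent_bounded (M : R) : exists2 C : R, 1 <= C &
  forall z, rnorm z <= M -> B (iota z - T)^-1 C.
Proof.
pose Q (D : set R[i]) := exists2 C : R, 1 <= C & forall z, D z -> B (iota z - T)^-1 C.
have [||z|D [C C1 CD] sub] := @complex_disc_compact_cover R M Q.
- by exists 1.
- move=> D D' [C C1 CD] [C' C1' CD']; exists (Num.max C C').
    by rewrite le_max C1.
  by move=> z [/CD|/CD'] h; apply: B_le h _; rewrite le_max lexx ?orbT.
- have [r0 Br0] := B_ex (iota z - T)^-1.
  pose r := Num.max r0 1.
  have Br : B (iota z - T)^-1 r by apply: B_le Br0 _; rewrite le_max lexx.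
  have r1 : 1 <= r by rewrite le_max lexx orbT.
  (* Within this radius the perturbation [(z - y) / (z - T)] has size at most 1/2, so the Neumann
     series at most doubles the bound [r]. *)
  exists (2 * r)^-1; first by rewrite invr_gt0; lra.
  exists (2 * r); first by lra.
  move=> y /= zy.
  have h : B (iota (z - y) * (iota z - T)^-1) (2^-1).
    apply: B_le (BM (BC _) Br) _.
    have r0' : 0 < r by lra.
    by rewrite -ler_pdivlMr// -invfM ltW.
  have := BM (BV h _) Br.
  have -> : (1 - 2^-1 : R)^-1 * r = 2 * r.
    by rewrite (_ : 1 - 2^-1 = 2^-1 :> R) ?invrK//; lra.
  have yT := sub0 y; have zT := sub0 z.
  have -> : (1 - iota (z - y) / (iota z - T))^-1 / (iota z - T) = (iota y - T)^-1.
    have -> : 1 - iota (z - y) / (iota z - T) = (iota y - T) / (iota z - T).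
      by rewrite rmorphB; field.
    by rewrite invf_div mulrAC divff// mul1r.
  by apply; lra.
by exists C => // z zM; apply: CD; exact: sub.
Qed.

Lemma gelfand_mazur_isometry : False.
Proof.
have [C C1 CB] := resolvent_bounded 2.
(* On the circles of radius [1 - d] and [1 + d], both inside the disc of radius 2, the gap [2 d] and
   two resolvents multiply to [2 d C^2 = 1/4]. *)
pose d : R := (8 * C ^+ 2)^-1.
have C20 : 0 < C ^+ 2 by rewrite exprn_gt0//; lra.
have C21 : 1 <= C ^+ 2 by rewrite exprn_ege1.
have d0 : 0 < d by rewrite invr_gt0; lra.
have dC : d * C ^+ 2 = 8^-1 by rewrite /d invfM mulfVK// gt_eqF.
have d8 : d <= 8^-1 by rewrite -dC; apply: ler_peMr => //; exact: ltW.
pose a (z : R[i]) := iota ((1 - d)%:C * z); pose b (z : R[i]) := iota ((1 + d)%:C * z).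
have h2 : (2 : F) != 0.
  have : iota 2 != 0 by rewrite fmorph_eq0 pnatr_eq0.
  by rewrite rmorph_nat.
(* Invertibility of [c^N - T^N] travels with the estimate: doubling [N] needs both factors of
   [c^(2N) - T^(2N)], and the second is the first at a rotated [c]. *)
have key (m : nat) : (forall c, iota c ^+ (2 ^ m) - T ^+ (2 ^ m) != 0) /\
  (forall z, rnorm z = 1 ->
   B (b z ^+ (2 ^ m) / (b z ^+ (2 ^ m) - T ^+ (2 ^ m)) -
      a z ^+ (2 ^ m) / (a z ^+ (2 ^ m) - T ^+ (2 ^ m))) (1 / 4)).
  elim: m => [|m [IH0 IH]].
    rewrite expn0; split => [c|z z1]; first by rewrite !expr1.
    rewrite !expr1; have aT : a z - T != 0 by exact: sub0.
    have bT : b z - T != 0 by exact: sub0.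
    have -> : b z / (b z - T) - a z / (a z - T) =
        T * (a z - b z) * ((b z - T)^-1 * (a z - T)^-1).
      move: (a z) (b z) aT bT => p q pT qT.
      by field; rewrite pT qT.
    have abE : a z - b z = iota ((- (2 * d))%:C * z).
      rewrite -rmorphB -mulrBl -rmorphB; congr (iota (_%:C * _)); lra.
    have n1 : rnorm ((- (2 * d))%:C * z) = 2 * d.
      by rewrite crnormM z1 mulr1 rnorm_real normrN ger0_norm//; lra.
    have ca : B (a z - T)^-1 C.
      by apply: CB; rewrite crnormM z1 mulr1 rnorm_real ger0_norm; lra.
    have cb : B (b z - T)^-1 C.
      by apply: CB; rewrite crnormM z1 mulr1 rnorm_real ger0_norm; lra.
    have := BM (BM BT (BC ((- (2 * d))%:C * z))) (BM cb ca).
    rewrite -abE n1 mul1r => h; apply: B_le h _.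
    by rewrite -mulrA -expr2 dC; lra.
  have N0 : (0 < 2 ^ m)%N by rewrite expn_gt0.
  have [u uN u1] := @complex_root_neg1 R _ N0.
  have uF : iota u ^+ (2 ^ m) = -1 by rewrite -rmorphXn uN rmorphN1.
  have plus c : iota c ^+ (2 ^ m) + T ^+ (2 ^ m) != 0.
    have := IH0 (u * c); rewrite rmorphM exprMn uF mulN1r.
    by rewrite -opprD oppr_eq0.
  have dbl (y : F) : y ^+ (2 ^ m.+1) = (y ^+ (2 ^ m)) ^+ 2 by rewrite -exprM -expnSr.
  split=> [c|z z1]; first by rewrite !dbl subr_sqr mulf_neq0.
  have uz1 : rnorm (u * z) = 1 by rewrite crnormM u1 z1 mulr1.
  have h := BM (BC (2^-1)) (BD (IH z z1) (IH (u * z) uz1)).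
  have nb (s : R) : iota (s%:C * (u * z)) ^+ (2 ^ m) = - (iota (s%:C * z) ^+ (2 ^ m)).
    by rewrite mulrCA rmorphM exprMn uF mulN1r.
  rewrite /a /b !nb -/(a z) -/(b z) in h.
  rewrite !dbl; move: h.
  have a1 : a z ^+ (2 ^ m) - T ^+ (2 ^ m) != 0 by exact: IH0.
  have b1 : b z ^+ (2 ^ m) - T ^+ (2 ^ m) != 0 by exact: IH0.
  have a2 : a z ^+ (2 ^ m) + T ^+ (2 ^ m) != 0 by exact: plus.
  have b2 : b z ^+ (2 ^ m) + T ^+ (2 ^ m) != 0 by exact: plus.
  move: (a z ^+ (2 ^ m)) (b z ^+ (2 ^ m)) (T ^+ (2 ^ m)) a1 b1 a2 b2.
  move=> p q t pt qt pt' qt'.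
  (* The rotated point contributes [-q / (-q - t) = q / (q + t)]; its mean with [q / (q - t)] is
     [q^2 / (q^2 - t^2)], so averaging preserves the bound 1/4. *)
  have -> : iota 2^-1 * (q / (q - t) - p / (p - t) + (- q / (- q - t) - - p / (- p - t))) =
      q ^+ 2 / (q ^+ 2 - t ^+ 2) - p ^+ 2 / (p ^+ 2 - t ^+ 2).
    rewrite fmorphV rmorph_nat -!opprD !invrN !mulNr !mulrN !opprK !subr_sqr.
    field; rewrite h2 pt qt pt' qt'.
    by [].
  move=> h; apply: B_le h _.
  have -> : rnorm (2^-1 : R[i]) = 2^-1.
    have -> : (2^-1 : R[i]) = (2^-1 : R)%:C by rewrite fmorphV rmorph_nat.
    by rewrite rnorm_real ger0_norm// invr_ge0.
  lra.
have small (x : R) : 0 <= x < 1 -> exists n0, forall n, (n0 <= n)%N -> x ^+ n <= 1 / 5.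
  move=> /andP[x0 x1].
  have : x ^+ n @[n --> \oo] --> (0 : R) by apply: cvg_expr; rewrite ger0_norm.
  move/cvgrPdist_lt/(_ (1 / 5) ltac:(lra)) => [n0 _ hn]; exists n0 => n /hn /=.
  by rewrite sub0r normrN ger0_norm ?exprn_ge0// => /ltW.
have [n1 hn1] := small (1 - d) ltac:(lra).
have [n2 hn2] : exists n0, forall n, (n0 <= n)%N -> (1 + d)^-1 ^+ n <= 1 / 5.
  apply: small; rewrite invr_ge0 invf_lt1; lra.
pose N := (2 ^ (n1 + n2))%N.
have Nn : (n1 + n2 <= N)%N by exact/ltnW/ltn_expl.
have [nz /(_ 1 (rnorm1 R))] := key (n1 + n2)%N; rewrite -/N => kB.
have q1 : (1 - d) ^+ N <= 1 / 5 by apply: hn1; lia.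
have q2 : (1 + d)^-1 ^+ N <= 1 / 5 by apply: hn2; lia.
have rX (c : R[i]) n : rnorm (c ^+ n) = rnorm c ^+ n.
  by elim: n => [|n IH]; rewrite ?expr0 ?rnorm1// !exprS crnormM IH.
(* The threshold 1/5 is the one for which [f / (1 - f)] has size at most [(1/5) / (4/5) = 1/4]. *)
have sm f : B f (1 / 5) -> B (f * (1 - f)^-1) (1 / 4).
  move=> Bf; have := BM Bf (BV Bf _) => /(_ ltac:(lra)) h; apply: B_le h _.
  have -> : (1 - 1 / 5 : R) = 4 / 5 by lra.
  by rewrite invf_div; lra.
have TN0 : T ^+ N != 0 by rewrite expf_neq0.
have aN : a 1 ^+ N - T ^+ N != 0 by exact: nz.
have bN : b 1 ^+ N - T ^+ N != 0 by exact: nz.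
have b0 : b 1 ^+ N != 0.
  rewrite expf_neq0// fmorph_eq0 mulr1 -[0]/(0%:C) (inj_eq (@complexI R)).
  by rewrite gt_eqF//; lra.
have Ba : B (a 1 ^+ N / (a 1 ^+ N - T ^+ N)) (1 / 4).
  have Bf : B (a 1 ^+ N * T^-1 ^+ N) (1 / 5).
    apply: B_le (BM (_ : B _ ((1 - d) ^+ N)) (BX N BTV)) _; last by rewrite mulr1.
    rewrite -rmorphXn; apply: B_le (BC _) _; rewrite rX mulr1 rnorm_real ger0_norm//.
    lra.
  have := BN (sm _ Bf); congr B; rewrite exprVn.
  have -> : 1 - a 1 ^+ N / T ^+ N = - (a 1 ^+ N - T ^+ N) / T ^+ N.
    by rewrite opprB mulrBl divff.
  by rewrite invfM invrN invrK; field; rewrite TN0 aN.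
have Bb : B (T ^+ N / (b 1 ^+ N - T ^+ N)) (1 / 4).
  have Bf : B (T ^+ N * (b 1)^-1 ^+ N) (1 / 5).
    apply: B_le (BM (BX N BT) (_ : B _ ((1 + d)^-1 ^+ N))) _; last by rewrite mul1r.
    rewrite -fmorphV -rmorphXn; apply: B_le (BC _) _.
    rewrite rX mulr1 -fmorphV rnorm_real ger0_norm// invr_ge0; lra.
  have := sm _ Bf; congr B; rewrite exprVn.
  have -> : 1 - T ^+ N / b 1 ^+ N = (b 1 ^+ N - T ^+ N) / b 1 ^+ N.
    by rewrite mulrBl divff.
  by rewrite invfM invrK; field; rewrite b0 bN.
(* The combined terms equal 1, while the three bounds of 1/4 add up to 3/4, against [B1]. *)
have := BD (BB kB Bb) Ba.
have -> : b 1 ^+ N / (b 1 ^+ N - T ^+ N) - a 1 ^+ N / (a 1 ^+ N - T ^+ N)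
   - T ^+ N / (b 1 ^+ N - T ^+ N) + a 1 ^+ N / (a 1 ^+ N - T ^+ N) = 1.
  by field; rewrite aN bN.
by move/B1; lra.
Qed.

End GelfandMazur.

Lemma fraction_numden (D : idomainType) (f : {fraction D}) :
  exists p q : D, q != 0 /\ f = tofrac p / tofrac q.
Proof.
elim/quotW: f => x; exists (frac x).1, (frac x).2; split; first exact: denom_ratioP.
have d0 : tofrac (frac x).2 != 0 :> {fraction D} by rewrite tofrac_eq0 denom_ratioP.
apply: (mulIf d0); rewrite divfK//; unlock tofrac.
rewrite -[LHS]/(FracField.mul _ _) !piE; apply/eqmodP.
rewrite /= FracField.equivfE /FracField.mulf !numden_Ratio ?mulf_neq0 ?oner_neq0 ?denom_ratioP//.
by rewrite !mulr1 mulrC.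
Qed.

(** * Polynomials in a linear map *)

Section PolyAction.
Variables (K : closedFieldType) (E : lmodType K) (T : E -> E).
Hypothesis T_linear : linear T.
Implicit Types (p q : {poly K}) (v w : E).

Let T0 : T 0 = 0.
Proof. by have := T_linear (-1) 0 0; rewrite !scaleN1r !addNr. Qed.

Let TD v w : T (v + w) = T v + T w.
Proof. by have := T_linear 1 v w; rewrite !scale1r. Qed.

Let TZ (c : K) v : T (c *: v) = c *: T v.
Proof. by have := T_linear c v 0; rewrite T0 !addr0. Qed.

Definition poly_act p v : E := \sum_(i < size p) p`_i *: iter i T v.

Lemma poly_act_wide n p v : (size p <= n)%N ->
  poly_act p v = \sum_(i < n) p`_i *: iter i T v.
Proof.
move=> pn; rewrite /poly_act -!(big_mkord xpredT (fun i => p`_i *: iter i T v)).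
rewrite [RHS](big_cat_nat _ pn)//= [X in _ + X]big1_seq ?addr0// => i.
by rewrite mem_index_iota => /andP[_ /andP[pi _]]; rewrite nth_default// scale0r.
Qed.

Lemma poly_actD p q v : poly_act (p + q) v = poly_act p v + poly_act q v.
Proof.
set n := maxn (size p) (size q).
rewrite !(@poly_act_wide n) ?leq_maxl ?leq_maxr ?size_polyD// -big_split.
by apply: eq_bigr => i _; rewrite coefD scalerDl.
Qed.

Lemma poly_actZ c p v : poly_act (c *: p) v = c *: poly_act p v.
Proof.
rewrite (@poly_act_wide (size p)) ?size_scale_leq// scaler_sumr.
by apply: eq_bigr => i _; rewrite coefZ scalerA.
Qed.

Lemma poly_actC c v : poly_act c%:P v = c *: v.
Proof.
rewrite (@poly_act_wide 1) ?size_polyC_leq1// big_ord1 coefC eqxx.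
by [].
Qed.

Lemma poly_act_mulX p v : poly_act (p * 'X) v = poly_act p (T v).
Proof.
rewrite (@poly_act_wide (size p).+1); last first.
  by have [->|p0] := eqVneq p 0; rewrite ?mul0r ?size_poly0// size_mulX.
rewrite big_ord_recl coefMX eqxx scale0r add0r; apply: eq_bigr => i _.
by rewrite coefMX /= -iterS iterSr.
Qed.

Lemma poly_actT p v : poly_act p (T v) = T (poly_act p v).
Proof.
rewrite /poly_act; elim/big_rec2 : _ => [|i x y _ ->]; first by rewrite T0.
by rewrite TD TZ -iterS iterSr.
Qed.

Lemma poly_actM p q v : poly_act (p * q) v = poly_act p (poly_act q v).
Proof.
elim/poly_ind: p v => [|p c IH] v.
  by rewrite mul0r /poly_act size_poly0 !big_ord0.
rewrite mulrDl poly_actD mul_polyC poly_actZ poly_actD poly_actC; congr (_ + _).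
by rewrite mulrAC !poly_act_mulX IH poly_actT.
Qed.

(** Over an algebraically closed field [p] splits, and without eigenvectors each linear factor is
    injective. *)
Lemma poly_act_inj p v : (forall c w, T w = c *: w -> w = 0) ->
  p != 0 -> poly_act p v = 0 -> v = 0.
Proof.
move=> noeig; have [r ->] := closed_field_poly_normal p.
rewrite scaler_eq0 negb_or => /andP[c0 _]; rewrite poly_actZ => /eqP.
rewrite scaler_eq0 (negbTE c0)/= => /eqP.
elim: r v => [|a r IH] v; first by rewrite big_nil poly_actC scale1r.
rewrite big_cons mulrC poly_actM => /IH.
rewrite -polyCN poly_actD poly_actC -['X]mul1r poly_act_mulX -polyC1 poly_actC scale1r.
rewrite scaleNr => /eqP; rewrite subr_eq0 => /eqP; exact: noeig.
Qed.

End PolyAction.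

(** * Schur's lemma for central isometries *)

Section Schur.
Variables (R : realType) (S : dynsys).
Local Notation A := (ell1 (cfun R S)).
Variables (E : lmodType R[i]) (pi : A -> E -> E).
Hypothesis irr : alg_irreducible pi.
Variables (c c' : A).
Hypothesis c1 : rnorm c <= 1.
Hypothesis c'1 : rnorm c' <= 1.
Hypothesis cc' : forall v, pi c (pi c' v) = v.
Hypothesis c_central : forall a v, pi c (pi a v) = pi a (pi c v).

Let rep : representation pi. Proof. by case: irr. Qed.

Let c_linear : linear (pi c).
Proof. by move=> z u v; rewrite (repZDr rep). Qed.

Lemma poly_act_pi p a v : poly_act (pi c) p (pi a v) = pi a (poly_act (pi c) p v).
Proof.
rewrite /poly_act (rep_sumr rep); apply: eq_bigr => i _.
rewrite (repZr rep); congr (_ *: _).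
by elim: (i : nat) => //= n ->; rewrite c_central.
Qed.

(** Without an eigenvector, nonzero polynomials in [pi c] are injective, so fractions p/q can be
    read as relations between [p w] and [q w]. The variable ['X], which is no constant, would then
    be a [T] as excluded by [gelfand_mazur_isometry]. *)
Lemma central_isometry_eigenvector : exists z w, w <> 0 /\ pi c w = z *: w.
Proof.
apply: contrapT => h.
have noeig z w : pi c w = z *: w -> w = 0.
  by move=> cw; apply: contrapT => w0; apply: h; exists z, w.
have [w w0] := irr_neq0 irr.
pose act p := poly_act (pi c) p w.
have act0 p : p != 0 -> act p <> 0.
  by move=> p0 /(poly_act_inj c_linear noeig p0).
have actM p q : act (p * q) = poly_act (pi c) p (act q).
  by rewrite /act (poly_actM c_linear).
have actD p q : act (p + q) = act p + act q by rewrite /act poly_actD.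
have actC p q a : poly_act (pi c) p (pi a (act q)) = pi a (act (p * q)).
  by rewrite poly_act_pi -actM.
pose F := {fraction {poly R[i]}}.
(* The substitute for a norm on fractions. Centrality of [c] makes it submultiplicative, the Neumann
   series gives [BV], and [irr_eigenvalue_le] at eigenvalue 1 gives [B1]. *)
pose B (f : F) (r : R) := exists p q a, [/\ q != 0, f = tofrac p / tofrac q,
  rnorm a <= r & act p = pi a (act q)].
have tf (q : {poly R[i]}) : q != 0 -> tofrac q != 0 :> F by rewrite tofrac_eq0.
apply: (@gelfand_mazur_isometry R F (@FracField.tofrac {poly R[i]} \o @polyC R[i])
  B _ _ _ _ _ _ _ (tofrac 'X)).
- by move=> f r s [p [q [a [q0 fE ar pq]]]] rs; exists p, q, a; split => //; exact: le_trans rs.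
- move=> f; have [p [q [q0 fE]]] := fraction_numden f.
  have [a pq] := irr_cyclic irr (act0 q q0) (act p).
  by exists (rnorm a), p, q, a.
- move=> f g r s [p [q [a [q0 -> ar pq]]]] [p' [q' [a' [q0' -> ar' pq']]]].
  exists (p * q' + p' * q), (q * q'), (a + a'); split.
  + by rewrite mulf_neq0.
  + by rewrite addf_div ?tf// rmorphD !rmorphM /=; congr ((_ + _) / _); rewrite mulrC.
  + by rewrite (le_trans (rnormD _ _))// lerD.
  + rewrite actD (repDl rep); congr (_ + _).
      by rewrite (mulrC p) actM pq actC (mulrC q').
    by rewrite (mulrC p') actM pq' actC.
- move=> f g r s [p [q [a [q0 -> ar pq]]]] [p' [q' [a' [q0' -> ar' pq']]]].
  exists (p * p'), (q * q'), (a' ** a); split.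
  + by rewrite mulf_neq0.
  + by rewrite mulf_div !rmorphM.
  + by rewrite mulrC (le_trans (rnorm_ell1_mul _ _))// ler_pM// ?rnorm_ge0.
  + by rewrite actM pq' actC (mulrC p) actM pq actC (repM rep) (mulrC q').
- move=> z; exists z%:P, 1, (z *: ell1_one R S); split.
  + exact: oner_neq0.
  + by rewrite rmorph1 divr1.
  + by rewrite rnormZE rnorm_one mulr1.
  + by rewrite /act -polyC1 !poly_actC // scale1r (repZl rep) (irr_one irr).
- move=> f r [p [q [a [q0 -> ar pq]]]] r1.
  have [b bE br] := ell1_left_inverse ar r1.
  have act_qp : act (q - p) = pi (ell1_one R S - a) (act q).
    rewrite actD -scaleN1r /act poly_actZ scaleN1r -/(act q) -/(act p) pq.
    by rewrite (repBl rep) (irr_one irr).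
  have bact : pi b (act (q - p)) = act q.
    by rewrite act_qp -(repM rep) bE (irr_one irr).
  have qp0 : q - p != 0.
    apply/eqP => qp; apply: (act0 q q0); rewrite -bact qp.
    by rewrite /act /poly_act size_poly0 big_ord0 (rep0r rep).
  exists q, (q - p), b; split => //.
  by rewrite rmorphB /= -{1}(divff (tf _ q0)) -mulrBl invf_div.
- move=> r [p [q [a [q0 /esym/divr1_eq pq ar ha]]]].
  have {}pq : p = q by apply/eqP; rewrite -tofrac_eq pq.
  rewrite pq in ha; have := irr_eigenvalue_le irr (act0 q q0) (z := 1) (a := a).
  by rewrite scale1r -ha rnorm1 => /(_ erefl) /le_trans; apply.
- by rewrite tf// polyX_eq0.
- exists 'X, 1, c; split.
  + exact: oner_neq0.
  + by rewrite rmorph1 divr1.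
  + exact: c1.
  + by rewrite /act -['X]mul1r poly_act_mulX // -polyC1 !poly_actC // !scale1r.
- exists 1, 'X, c'; split.
  + by rewrite polyX_eq0.
  + by rewrite rmorph1 mul1r.
  + exact: c'1.
  + rewrite /act -['X]mul1r poly_act_mulX // -polyC1 !poly_actC // !scale1r.
    by rewrite -c_central cc'.
- move=> z; rewrite /= tofrac_eq; apply/eqP => /(congr1 (fun p : {poly R[i]} => p`_1)).
  by rewrite coefC coefX /= => /eqP; rewrite eq_sym oner_eq0.
Qed.

Lemma central_isometry_scalar : exists z, forall v, pi c v = z *: v.
Proof.
have [z [w [w0 cw]]] := central_isometry_eigenvector; exists z => v.
have [a <-] := irr_cyclic irr w0 v.
by rewrite c_central cw (repZr rep).
Qed.

End Schur.

(** * Transitive closed sets *)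

Section Baire.
Variables (R : realType) (S : dynsys).
Implicit Types (Y O : set S) (x y : S).

Lemma closed_set_compact Y : closed Y -> compact Y.
Proof.
by move=> cY; apply: (subclosed_compact cY (@dyn_compact S)); exact: subsetT.
Qed.

(** Baire's theorem relative to [Y]: nested open sets meeting [Y], each with closure inside the
    previous one and one more [W i]. Compactness of [Y] replaces completeness. *)
Lemma baire_closed (I : countType) Y (W : I -> set S) : closed Y -> Y !=set0 ->
  (forall i, open (W i)) ->
  (forall i O, open O -> O `&` Y !=set0 -> O `&` W i `&` Y !=set0) ->
  exists2 x, Y x & forall i, W i x.
Proof.
move=> cY Y0 oW dW.
(* Codes that decode to no index get [setT], so the construction can run over [nat]. *)
pose W' n := if (choice.unpickle n : option I) is Some i then W i else setT.
have oW' n : open (W' n) by rewrite /W'; case: choice.unpickle => // ; exact: openT.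
have dW' n O : open O -> O `&` Y !=set0 -> O `&` W' n `&` Y !=set0.
  by rewrite /W'; case: choice.unpickle => [i|_]; [exact: dW|rewrite setIT].
pose good (O : set S) := open O /\ O `&` Y !=set0.
have step (nO : nat * set S) : exists P, good nO.2 ->
    good P /\ closure P `<=` nO.2 `&` W' nO.1.
  case: nO => n O /=; have [gO|] := pselect (good O); last by exists O.
  have [oO OY] := gO; have [x [[Ox Wx] Yx]] := dW' n O oO OY.
  have cF : closed (~` (O `&` W' n)) by apply: open_closedC; exact: openI.
  have [P [oP Px PF]] := closed_notin_open R cF (fun h => h (conj Ox Wx)).
  exists P => _; split; first by split => //; exists x.
  move=> y Py; apply: contrapT => h.
  have : (closure P `&` ~` (O `&` W' n)) y by [].
  by rewrite PF.
have [g gP] := choice step.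
pose fix Q n : set S := if n is n'.+1 then g (n', Q n') else setT.
have gQ n : good (Q n).
  elim: n => [|n IH] /=; first by split; [exact: openT|rewrite setTI].
  by have [] := gP (n, Q n) IH.
have cQ n : closure (Q n.+1) `<=` Q n `&` W' n by have [] := gP (n, Q n) (gQ n).
have QS n m : (n <= m)%N -> Q m `<=` Q n.
  elim: m => [|m IH]; first by rewrite leqn0 => /eqP ->.
  rewrite leq_eqVlt => /orP[/eqP <-//|/IH h] x Qx; apply: h.
  by have [] := cQ m x (subset_closure Qx).
have [x [Yx Qx]] : exists x, Y x /\ forall n, closure (Q n) x.
  apply: contrapT => h.
  (* As the closures decrease, being disjoint from one of them is stable under unions. Without a
     common point this would hold for a set containing [Y], although every [Q n] meets [Y]. *)
  pose P (B : set S) := exists n, closure (Q n) `&` B = set0.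
  have [||x Yx|B [n QB] YB] := @compact_ind _ Y P (closed_set_compact cY).
  - by exists 0%N; rewrite setI0.
  - move=> B C [n nB] [m mC]; exists (maxn n m).
    rewrite -subset0 => y [Qy [By|Cy]].
      by rewrite -nB; split => //; apply: closure_subset Qy; apply: QS; exact: leq_maxl.
    by rewrite -mC; split => //; apply: closure_subset Qy; apply: QS; exact: leq_maxr.
  - have [n Qn] : exists n, ~ closure (Q n) x.
      apply: contrapT => h'; apply: h; exists x; split => // n.
      by apply: contrapT => h''; apply: h'; exists n.
    exists (~` closure (Q n)); last by exists n; exact: setICr.
    by apply: open_nbhs_nbhs; split => //; apply: closed_openC; exact: closed_closure.
  have [_ [y [Qy Yy]]] := gQ n.
  have : (closure (Q n) `&` B) y by split; [exact: subset_closure|exact: YB].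
  by rewrite QB.
exists x => // i; have [_ ] := cQ _ _ (Qx (choice.pickle i).+1).
by rewrite /W' choice.pickleK.
Qed.

Definition dyn_transitive Y := forall (U V : set S) x y, open U -> open V ->
  Y x -> Y y -> U x -> V y -> exists (k : int) z, [/\ Y z, U z & V (dyn_iter k z)].

Definition dyn_invariant Y := forall (n : int) x, Y x -> Y (dyn_iter n x).

Lemma open_dyn_preimage O (k : int) : open O -> open [set x | O (dyn_iter k x)].
Proof. by move=> oO; apply: open_comp oO => x _; exact: dyn_iter_continuous. Qed.

Lemma open_saturation O : open O -> open [set x | exists k : int, O (dyn_iter k x)].
Proof.
move=> oO; have -> : [set x | exists k : int, O (dyn_iter k x)] =
    \bigcup_(k in [set: int]) [set x | O (dyn_iter k x)].
  by apply/seteqP; split => [x [k Ok]|x [k _ Ok]]; exists k.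
by apply: bigcup_open => k _; exact: open_dyn_preimage.
Qed.

Lemma set_type_nbhsP Y (y : Y) (A : set Y) : nbhs y A <->
  exists O : set S, [/\ open O, O (set_val y) & forall z : Y, O (set_val z) -> A z].
Proof.
rewrite nbhsE; split => [[_ [[U oU <-] Uy] UA]|[U [oU Uy UA]]].
  by exists U; split.
exists (set_val @^-1` U) => //; split => //; by exists U.
Qed.

(** The cover consists of open sets of [S] rather than of [Y], so that they can be saturated under
    the dynamics. *)
Lemma metrizable_cover Y (d : Y -> Y -> R) (e : R) :
  (forall x y : Y, d x y = 0 <-> x = y) -> (forall x y : Y, d x y = d y x) ->
  (forall x y z : Y, d x z <= d x y + d y z) ->
  (forall (x : Y) (A : set Y), nbhs x A <-> exists2 e : R, 0 < e & [set y | d x y < e] `<=` A) ->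
  closed Y -> 0 < e ->
  exists s : seq (set S),
    (forall i, (i < size s)%N -> [/\ open (nth setT s i), nth setT s i `&` Y !=set0 &
      forall y z : Y, nth setT s i (set_val y) -> nth setT s i (set_val z) -> d y z < e]) /\
    (forall y : S, Y y -> exists2 i, (i < size s)%N & nth setT s i y).
Proof.
move=> d0 ds dt dn cY e0.
pose good (O : set S) := [/\ open O, O `&` Y !=set0 &
      forall y z : Y, O (set_val y) -> O (set_val z) -> d y z < e].
pose Q (B : set S) := exists s : seq (set S),
  (forall i, (i < size s)%N -> good (nth setT s i)) /\
  (forall y : S, B y -> exists2 i, (i < size s)%N & nth setT s i y).
have [||x Yx|B [s [sg sB]] YB] := @compact_ind _ Y Q (closed_set_compact cY).
- by exists [::]; split.
- move=> B C [s [sg sB]] [t [tg tC]]; exists (s ++ t); split=> [i|y].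
    rewrite size_cat nth_cat; case: (ltnP i (size s)) => [si _|si it].
      exact: sg.
    by apply: tg; rewrite ltn_subLR.
  move=> [/sB|/tC] [i il iy].
    by exists i; rewrite ?nth_cat ?il// size_cat ltn_addr.
  exists (size s + i)%N; first by rewrite size_cat ltn_add2l.
  by rewrite nth_cat ltnNge leq_addr/= addKn.
- have /mem_set Yx' := Yx; pose x' : Y := SigSub Yx'.
  have [|O [oO Ox OB]] := proj1 (@set_type_nbhsP Y x' [set y | d x' y < e / 2]).
    by apply/dn; exists (e / 2); rewrite ?divr_gt0.
  exists O; first exact: open_nbhs_nbhs.
  exists [:: O]; split => [[|//] _|y Oy]; last by exists 0%N.
  split => //=; first by exists x.
  move=> y z /OB /= xy /OB /= xz; apply: le_lt_trans (dt y x' z) _.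
  by rewrite (splitr e) ltrD// ds.
by exists s; split => // y /YB /sB.
Qed.

(** By transitivity the saturation of every set in the covers of mesh [1/(m+1)] is dense in [Y]. A
    point common to all saturations visits each cover set, hence comes arbitrarily close to every
    point of [Y]. *)
Lemma transitive_dense_orbit Y : closed Y -> Y !=set0 -> dyn_invariant Y ->
  dyn_transitive Y -> metrizable R Y ->
  exists2 x, Y x & closure (dyn_orbit x) = Y.
Proof.
move=> cY Y0 iY tY [d [d0 ds dt dn]].
have [L LP] := choice (fun m : nat => metrizable_cover d0 ds dt dn cY
  (ltac:(by rewrite invr_gt0) : 0 < (m.+1%:R)^-1 :> R)).
(* Index pairs beyond the lists read the default [setT], for which openness and density are trivial;
   so all of [nat * nat] can index the family. *)
pose W (mi : nat * nat) := [set x | exists k : int, nth setT (L mi.1) mi.2 (dyn_iter k x)].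
have good m i : (i < size (L m))%N \/ nth setT (L m) i = setT.
  by case: ltnP => h; [left|right; rewrite nth_default].
have [||x Yx Wx] := @baire_closed (nat * nat)%type Y W cY Y0.
- move=> [m i]; apply: open_saturation => /=.
  case: (good m i) => [h|->]; last exact: openT.
  by have [] := proj1 (LP m) i h.
- move=> [m i] O oO [y [Oy Yy]]; rewrite /W /=.
  case: (good m i) => [h|->]; last first.
    by exists y; split => //; split => //; exists 0.
  have [oN [z [Nz Yz]] _] := proj1 (LP m) i h.
  have [k [u [Yu Ou Nu]]] := tY O _ y z oO oN Yy Yz Oy Nz.
  by exists u; split => //; split => //; exists k.
exists x => //; apply/seteqP; split.
  apply: (@subset_trans _ (closure Y)); last by rewrite closureE; exact: smallest_sub.
  by apply: closure_subset => _ [n _ <-]; exact: iY.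
move=> y Yy B yB; have /mem_set Yy' := Yy; pose y' : Y := SigSub Yy'.
have : nbhs y' (set_val @^-1` B).
  move: yB; rewrite nbhsE => -[ O [oO Oy] OB]; apply/set_type_nbhsP.
  by exists O; split => // z /OB.
move/dn => [e e0 eB].
have [m me] : exists m : nat, (m.+1%:R)^-1 < e.
  by have [m] := ltr_add_invr e0; rewrite add0r; exists m.
have [i il Ny] := proj2 (LP m) y Yy.
have [_ _ small] := proj1 (LP m) i il.
have [k Nk] := Wx (m, i); exists (dyn_iter k x); split; first exact: orbit_iter.
have /mem_set Yk := iY k x Yx.
apply: (eB (SigSub Yk)) => /=; apply: lt_trans me.
exact: small.
Qed.

(** A common period leaves finitely many iterates to control: the points whose whole orbit avoids
    the closure of a neighbourhood [O] of [y] form an open set, and it contains [x] if [y] is off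
    its orbit. *)
Lemma transitive_period_orbit Y x (p : nat) : dyn_transitive Y -> (0 < p)%N ->
  (forall y, Y y -> dyn_iter p y = y) -> Y x -> Y `<=` dyn_orbit x.
Proof.
move=> tY p0 Yp Yx y Yy; apply: contrapT => yx.
have cO : closed (dyn_orbit x).
  by apply: finite_closed; apply: per_return p0 _; exact: Yp.
have [ O [oO Oy OO]] := closed_notin_open R cO yx.
pose U := ~` \bigcup_(j in [set: 'I_p]) [set z | closure O (dyn_iter (Posz j) z)].
have oU : open U.
  apply: closed_openC; apply: closed_bigcup => [|j _]; first exact: finite_finset.
  apply: (@closed_comp _ _ (dyn_iter (Posz j))); last exact: closed_closure.
  by move=> z _; exact: dyn_iter_continuous.
have Ux : U x.
  move=> [j _ Oj]; have : (closure O `&` dyn_orbit x) (dyn_iter (Posz j) x).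
    by split => //; exact: orbit_iter.
  by rewrite OO.
have [k [z [Yz Uz Oz]]] := tY U O x y oU oO Yx Yy Ux Oy.
have [j jp kE] := dyn_iter_mod k p0 (Yp z Yz).
apply: Uz; exists (Ordinal jp) => //.
by have := @subset_closure _ O _ Oz; rewrite kE.
Qed.

(** If each open set of points not fixed by the power [n + 1] were dense in [Y], Baire would give a
    point without period. So some power fixes a relatively open part of [Y], and by transitivity all
    of [Y]. *)
Lemma transitive_all_periodic Y : closed Y -> Y !=set0 -> dyn_invariant Y ->
  dyn_transitive Y -> (forall y, Y y -> Per y) -> finite_set Y.
Proof.
move=> cY Y0 iY tY YP.
suff [p p0 pY] : exists2 p : nat, (0 < p)%N & forall y, Y y -> dyn_iter p y = y.
  have [x Yx] := Y0; apply: (@sub_finite_set _ _ (dyn_orbit x)).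
    exact: transitive_period_orbit pY Yx.
  exact: YP.
pose W (n : nat) := [set x : S | dyn_iter (Posz n.+1) x <> x].
have oW n : open (W n).
  move: (@dyn_hausdorff S); rewrite open_hausdorff => hS.
  rewrite openE => x /= /eqP xn; change (nbhs x (W n)).
  have [[A B] /= [Ax Bx] [oA oB AB]] := hS _ _ xn.
  move: Ax Bx => /set_mem Ax /set_mem Bx.
  apply: (@filterS _ (nbhs x) _ ([set z | A (dyn_iter (Posz n.+1) z)] `&` B)).
    move=> z [Az Bz] zn; have : (A `&` B) z by split => //; exact: eq_ind _ A Az _ zn.
    by rewrite (eqP AB).
  apply: open_nbhs_nbhs; split; last by [].
  by apply: openI => //; exact: open_dyn_preimage.
have [n [ O [oO [y [Oy Yy]] OW]]] : exists n O, [/\ open O, O `&` Y !=set0 &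
    O `&` W n `&` Y = set0].
  apply: contrapT => h.
  have [i O oO OY|x Yx Wx] := @baire_closed nat Y W cY Y0 oW.
    by apply/set0P/eqP => OW; apply: h; exists i, O.
  have [q [q0 qx _]] := per_has_period (YP x Yx).
  by apply: (Wx q.-1); rewrite prednK.
exists n.+1 => // z Yz; apply: contrapT => zn.
have [k [u [Yu Wu Ou]]] := tY (W n) O z y (oW n) oO Yz Yy zn Oy.
have : (O `&` W n `&` Y) (dyn_iter k u).
  split; last exact: iY.
  split => //= h; apply: Wu; apply: (@dyn_iter_inj S k).
  by rewrite -dyn_iterD addrC dyn_iterD.
by rewrite OW.
Qed.

End Baire.

(** * Classification of the kernels *)

Section PeriodicSupport.
Variables (R : realType) (S : dynsys).
Local Notation CX := (cfun R S).
Local Notation A := (ell1 CX).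
Variables (E : lmodType R[i]) (pi : A -> E -> E).
Hypothesis irr : alg_irreducible pi.
Variables (x : S) (p : nat).
Hypothesis xp : has_period x p.
Hypothesis sx : rep_hull pi x.
Hypothesis so : rep_hull pi `<=` dyn_orbit x.
Implicit Types (f g : CX) (a b : A).

Let rep : representation pi. Proof. by case: irr. Qed.

Let ker_orbit f : (forall y, dyn_orbit x y -> f y = 0) -> forall v, pi (cfun_emb f) v = 0.
Proof. by move=> h; apply: rep_hull_vanish => // y /so; exact: h. Qed.

(** On a monomial the commutator is [alpha p f - f] times a power of [delta], and [alpha p f] agrees
    with [f] on the orbit. *)
Lemma delta_period_central a v : pi (delta_pow R S p) (pi a v) = pi a (pi (delta_pow R S p) v).
Proof.
have [p0 px _] := xp.
apply/eqP; rewrite -subr_eq0 -!(repM rep) -(repBl rep); apply/eqP; move: a.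
apply: (irr_bounded_lin0 irr) => [|n f].
  have := bounded_lin_comb (-1) (ell1_mul_boundedl (delta_pow R S p))
    (ell1_mul_boundedr (delta_pow R S p)).
  by congr bounded_lin; apply/funext => a; rewrite scaleN1r addrC.
rewrite !ell1_single_mul alpha1 mul1r mulr1 (addrC n).
rewrite (single_split _ (alpha p f)) (single_split _ f) (repBl rep) !(repM rep).
rewrite -(repBl rep) -cfun_embB; apply: ker_orbit => _ [m _ <-].
rewrite cfunBE alphaE -dyn_iterD (addrC (- p%:Z)) dyn_iterD.
have -> : dyn_iter (- p%:Z) x = x by rewrite -[in LHS]px dyn_iterK.
by rewrite subrr.
Qed.

(** The power and its inverse both have norm 1, so the eigenvalue bound applies to [z] and to
    [z^-1]. *)
Lemma delta_period_scalar : exists2 z : R[i], rnorm z = 1 &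
  forall v, pi (delta_pow R S p) v = z *: v.
Proof.
have cc' v : pi (delta_pow R S p) (pi (delta_pow R S (- p%:Z)) v) = v.
  by rewrite -(repM rep) delta_powD subrr (irr_one irr).
have [||z zE] := central_isometry_scalar irr _ _ cc' delta_period_central.
- by rewrite rnorm_delta.
- by rewrite rnorm_delta.
exists z => //; have [w w0] := irr_neq0 irr.
have z1 : rnorm z <= 1.
  by have := irr_eigenvalue_le irr w0 (zE w); rewrite rnorm_delta.
have z0 : z != 0.
  apply/eqP => z0; apply: w0; rewrite -(cc' w) zE z0.
  by rewrite scale0r.
have zi : pi (delta_pow R S (- p%:Z)) w = z^-1 *: w.
  by rewrite -[in RHS](cc' w) zE scalerA mulVf// scale1r.
have := irr_eigenvalue_le irr w0 zi; rewrite rnorm_delta => zi1.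
apply/eqP; rewrite eq_le z1 /=.
have : rnorm z * rnorm z^-1 = 1 by rewrite -crnormM divff// rnorm1.
by move=> <-; rewrite ler_piMr// rnorm_ge0.
Qed.

(** A [k] that is 1 at [x] and 0 elsewhere on the orbit satisfies [f * k = f x *: k] there, so [k u]
    is a joint eigenvector of C(X); powers of [delta] carry it along the orbit. *)
Lemma orbit_eigenvector : exists2 w, w <> 0 &
  forall f (n : int), pi (cfun_emb f) (pi (delta_pow R S n) w) =
    f (dyn_iter n x) *: pi (delta_pow R S n) w.
Proof.
have [p0 px _] := xp.
have [k kE] := per_separating R xp (Ordinal p0).
have [u ku] : exists u, pi (cfun_emb k) u <> 0.
  apply: (@rep_hull_witness _ _ _ _ k x sx).
  by rewrite (proj1 (kE 0) erefl); exact/eqP/oner_neq0.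
exists (pi (cfun_emb k) u) => // f n.
rewrite -{1}(alpha_id f) -(subrr n) -alpha_comp -(repM rep) -delta_pow_emb (repM rep).
rewrite -(repZr rep); congr (pi _ _).
rewrite -(repM rep) cfun_emb_mul; apply/eqP; rewrite -subr_eq0; apply/eqP.
rewrite -(repZl rep) -cfun_embZ -(repBl rep) -cfun_embB.
apply: ker_orbit => _ [m _ <-]; rewrite cfunBE cfunME cfunZE.
have [xm|xm] := pselect (dyn_iter m x = x).
  by rewrite xm alphaE opprK subrr.
by rewrite (proj2 (kE m) xm) !mulr0 subrr.
Qed.

Lemma periodic_support_classification : exists z : R[i], [/\ `|z| = 1,
  is_P_per x z (rep_ker pi) & finite_dimensional E].
Proof.
have [z z1 zE] := delta_period_scalar; have [w w0 wE] := orbit_eigenvector.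
exists z; have [p0 px _] := xp.
have [q qE] : exists q, p = q.+1 by exists p.-1; rewrite prednK.
pose pi' : A -> 'cV[R[i]]_q.+1 -> 'cV[R[i]]_q.+1 := per_rep x z.
have pi'P : is_pi_per x z pi' by apply: per_rep_is_pi_per => //; rewrite -qE.
have xq : has_period x q.+1 by rewrite -qE.
have rep' : representation pi' by case: pi'P.
pose wn (n : int) := pi (delta_pow R S n) w.
have wn0 n : wn n <> 0 by move=> h; apply: w0; exact: (irr_delta_inj irr h).
(* The future equivalence with [per_rep]: [e_j] goes to [delta^j w]. *)
pose Th (v : 'cV[R[i]]_q.+1) := \sum_j v j 0 *: wn (Posz j).
have ThL : linear Th.
  move=> c u v; rewrite /Th scaler_sumr -big_split; apply: eq_bigr => j _.
  by rewrite !mxE scalerDl scalerA.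
have Th0 : Th 0 = 0 by have := ThL (-1) 0 0; rewrite !scaleN1r !addNr.
have ThZ c v : Th (c *: v) = c *: Th v by have := ThL c v 0; rewrite Th0 !addr0.
have ThD u v : Th (u + v) = Th u + Th v by have := ThL 1 u v; rewrite !scale1r.
have Th_sum (F : 'I_q.+1 -> 'cV[R[i]]_q.+1) : Th (\sum_j F j) = \sum_j Th (F j).
  by elim/big_rec2 : _ => // j u v _ <-.
have Th_basis j : Th (basis_vec R j) = wn (Posz j).
  rewrite /Th (bigD1 j)//= big1 => [|k kj].
    by rewrite mxE !eqxx scale1r addr0.
  by rewrite mxE (negbTE kj) scale0r.
have Th_f f v : Th (pi' (cfun_emb f) v) = pi (cfun_emb f) (Th v).
  rewrite /Th (rep_sumr rep); apply: eq_bigr => j _.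
  rewrite (pi_per_emb pi'P) (repZr rep) wE scalerA.
  by rewrite mulrC.
have Th_eq (F G : 'cV[R[i]]_q.+1 -> E) : linear F -> linear G ->
    (forall j, F (basis_vec R j) = G (basis_vec R j)) -> F =1 G.
  move=> FL GL FG v; rewrite (basis_vec_sum v).
  have h (H : 'cV[R[i]]_q.+1 -> E) (HL : linear H) :
      H (\sum_j v j 0 *: basis_vec R j) = \sum_j v j 0 *: H (basis_vec R j).
    have H0 : H 0 = 0 by have := HL (-1) 0 0; rewrite !scaleN1r !addNr.
    by elim/big_rec2 : _ => // j u' v' _ <-; rewrite HL.
  by rewrite !h//; apply: eq_bigr => j _; rewrite FG.
have Th_pi'L a : linear (fun v => Th (pi' a v)).
  by move=> c u v; rewrite (repZDr rep') ThL.
have pi_ThL a : linear (fun v => pi a (Th v)).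
  by move=> c u v; rewrite ThL (repZDr rep).
have Th_1 v : Th (pi' (delta_pow R S 1) v) = pi (delta_pow R S 1) (Th v).
  move: v; apply: Th_eq => // j; rewrite Th_basis /wn -(repM rep) delta_powD.
  have [_ _ _ h1 h2] := pi'P.
  have [jq|jq] := ltnP j q.
    have jq' : (j.+1 < q.+1)%N by [].
    have -> : pi' (delta_pow R S 1) (basis_vec R j) = basis_vec R (Ordinal jq').
      exact: h1.
    by rewrite Th_basis; congr (pi (delta_pow _ _ _) _) => /=; lia.
  have jE : j.+1 = q.+1 by have := ltn_ord j; lia.
  have -> : pi' (delta_pow R S 1) (basis_vec R j) = z *: basis_vec R ord0.
    exact: h2.
  rewrite ThZ Th_basis [wn _](irr_one irr) -zE.
  by congr (pi (delta_pow _ _ _) _) => /=; lia.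
have Th_N1 v : Th (pi' (delta_pow R S (- 1)) v) = pi (delta_pow R S (- 1)) (Th v).
  set u := pi' _ v; have -> : v = pi' (delta_pow R S 1) u.
    by rewrite -(repM rep') delta_powD subrr (pi_per_one pi'P).
  by rewrite Th_1 -(repM rep) delta_powD addNr (irr_one irr).
have Th_n (n : int) v : Th (pi' (delta_pow R S n) v) = pi (delta_pow R S n) (Th v).
  elim/int_rect: n v => [|n IH|n IH] v.
  - by rewrite (pi_per_one pi'P) (irr_one irr).
  - have -> : n.+1%:Z = 1 + n%:Z :> int by lia.
    by rewrite -delta_powD (repM rep) (repM rep') Th_1 IH.
  - have -> : - n.+1%:Z = - 1 - n%:Z :> int by lia.
    by rewrite -delta_powD (repM rep) (repM rep') Th_N1 IH.
have Th_a a v : Th (pi' a v) = pi a (Th v).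
  move: v; apply: Th_eq => // i; rewrite Th_basis.
  (* [pi (L b) w] is the failure of intertwining at [e_i], written with a bounded [L] from the
     algebra to itself, so that monomials suffice. *)
  pose L b := b ** delta_pow R S (Posz i) -
    \sum_j (pi' b (basis_vec R i) j 0 *: delta_pow R S (Posz j)).
  have LE b : pi (L b) w = pi b (wn (Posz i)) - Th (pi' b (basis_vec R i)).
    rewrite /L (repBl rep) (repM rep) (rep_suml rep); congr (_ - _).
    by apply: eq_bigr => j _; rewrite (repZl rep).
  suff : pi (L a) w = 0 by rewrite LE => /eqP; rewrite subr_eq0 => /eqP.
  move: a; apply: (irr_bounded_lin0 irr) => [|n f]; last first.
    by rewrite LE !single_split (repM rep) (repM rep') Th_f Th_n Th_basis subrr.
  have cb j : bounded_lin (fun b => pi' b (basis_vec R i) j 0).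
    split=> [c b b'|]; first by rewrite (repZDl rep') !mxE.
    exists (rnorm (basis_vec R i)) => b; apply: le_trans (rnorm_col_entry _ _) _.
    by rewrite mulrC per_rep_le.
  have := bounded_lin_comb (-1) (bounded_lin_sum (fun j => bounded_lin_scale
     (delta_pow R S (Posz j)) (cb j))) (ell1_mul_boundedl (delta_pow R S (Posz i))).
  by congr bounded_lin; apply/funext => b; rewrite /L scaleN1r addrC.
have Th_inj v : Th v = 0 -> v = 0.
  move=> Tv; apply/colP => j; rewrite mxE.
  have [f fE] := per_separating R xq j.
  have : Th (pi' (cfun_emb f) v) = 0 by rewrite Th_a Tv (rep0r rep).
  rewrite (pi_per_sep xq pi'P fE) ThZ Th_basis => /eqP.
  by rewrite scaler_eq0 => /orP[/eqP //|/eqP /wn0].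
have Th_surj u : exists v, u = Th v.
  have [a <-] := irr_cyclic irr w0 u; exists (pi' a (basis_vec R ord0)).
  by rewrite Th_a Th_basis [wn _](irr_one irr).
split.
- exact/rnorm_eq1.
- exists q.+1, pi'; split => //; apply/seteqP; split => a ka v.
    by apply: Th_inj; rewrite Th_a ka.
  by have [u ->] := Th_surj v; rewrite -Th_a ka Th0.
- exists q.+1, (fun j => wn (Posz j)) => u; have [v ->] := Th_surj u.
  by exists (fun j => v j 0).
Qed.

End PeriodicSupport.

(** * Hull, dimension and kernel *)

Section HullOfIrreducible.
Variables (R : realType) (S : dynsys).
Local Notation CX := (cfun R S).
Local Notation A := (ell1 CX).
Variables (E : lmodType R[i]) (pi : A -> E -> E).
Hypothesis irr : alg_irreducible pi.
Implicit Types (f g : CX) (a b : A) (x y : S).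

Let rep : representation pi. Proof. by case: irr. Qed.

Lemma rep_hull_dyn_transitive : dyn_transitive (rep_hull pi).
Proof. by move=> U V x y oU oV Xx Xy Ux Vy; exact: (rep_hull_transitive irr _ _ Xx Xy). Qed.

Lemma rep_hull_dyn_invariant : dyn_invariant (rep_hull pi).
Proof. by move=> n x; exact: rep_hull_invariant. Qed.

Lemma finite_rep_hull_classification : finite_set (rep_hull pi) ->
  exists x (z : R[i]), [/\ Per x, `|z| = 1, is_P_per x z (rep_ker pi) & finite_dimensional E].
Proof.
move=> fX; have [x Xx] := rep_hull_neq0 irr.
have XP y : rep_hull pi y -> Per y.
  move=> Xy; apply: sub_finite_set fX => _ [n _ <-].
  exact: rep_hull_dyn_invariant.
have [p xp] := per_has_period (XP x Xx).
have so : rep_hull pi `<=` dyn_orbit x.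
  (* Points of a finite hull are isolated: removing from [S] the other points of the hull leaves an
     open set that meets the hull in [z] alone. *)
  move=> y Xy; have cF z : closed (rep_hull pi `\ z).
    by apply: finite_closed; exact: finite_setD.
  have oF z : open (~` (rep_hull pi `\ z)) by exact: closed_openC.
  have [||k [z [Xz zx zy]]] := rep_hull_transitive irr (oF x) (oF y) Xx Xy.
  - by move=> [_ /=].
  - by move=> [_ /=].
  exists k => //.
  have -> : x = z by apply: contrapT => xz; apply: zx; split => // /esym.
  apply: contrapT => ky; apply: zy; split => //.
  exact: rep_hull_dyn_invariant.
have [z [z1 Pz fd]] := periodic_support_classification irr xp Xx so.
by exists x, z; split => //; exact: XP.
Qed.

(** Disjoint neighbourhoods of [n + 1] points of the hull yield [n + 1] nonzero vectors, each fixed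
    by its own bump and killed by the others, hence independent. *)
Lemma finite_dimensional_rep_hull : finite_dimensional E -> finite_set (rep_hull pi).
Proof.
move=> [n [e span]]; apply: contrapT => inf.
have [B BX nB] := infinite_set_fset n.+1 inf.
pose s := enum_fset B; have us : uniq s by exact: fset_uniq.
have ns : (n < size s)%N by [].
have [x0 Xx0] := rep_hull_neq0 irr.
pose xi (i : 'I_n.+1) := nth x0 s i.
have isz (i : 'I_n.+1) : (i < size s)%N by exact: leq_trans (ltn_ord i) ns.
have Xxi i : rep_hull pi (xi i) by apply: BX; exact: mem_nth.
have xi_inj i j : xi i = xi j -> i = j.
  by move/eqP; rewrite nth_uniq// => /eqP; exact: val_inj.
(* One function with value [i] at the [i]-th point gives all the disjoint neighbourhoods, since
   discs of radius 1/2 about distinct integers are disjoint. *)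
have [f fE] : exists f : CX, forall i : 'I_n.+1, f (xi i) = (i : nat)%:R.
  have sep (i : 'I_n.+1) : exists f : CX, forall j, f (xi j) = (j == i)%:R.
    have [f [f1 f0 _]] : exists f : CX, [/\ f (xi i) = 1, forall y,
        y \in [seq xi j | j <- enum 'I_n.+1 & j != i] -> f y = 0 & rnorm f <= 1].
      apply: separating_cfun => /mapP[j]; rewrite mem_filter => /andP[ji _] /xi_inj.
      by move=> ij; move: ji; rewrite ij eqxx.
    exists f => j; have [->//|ji] := eqVneq j i.
    by rewrite f0//; apply/mapP; exists j => //; rewrite mem_filter ji mem_enum.
  have [F FE] := choice sep.
  exists (\sum_(i < n.+1) ((i : nat)%:R : R[i]) *: F i) => j.
  rewrite cfun_sumE (bigD1 j)//= big1 => [|i ij].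
    by rewrite cfunZE FE eqxx mulr1 addr0.
  by rewrite cfunZE FE eq_sym (negbTE ij) mulr0.
pose U (i : 'I_n.+1) := [set y | rnorm (f y - (i : nat)%:R) < 1 / 2].
have oU i : open (U i).
  exact: (open_rnorm_lt (f - cfun_cst S (i : nat)%:R) (1 / 2)).
have Ux i : U i (xi i) by rewrite /U /= fE subrr rnorm0; lra.
have disj i j y : U i y -> U j y -> i = j.
  rewrite /U /= => iy jy; apply/val_inj/eqP/negPn/negP => ij.
  have : rnorm ((i : nat)%:R - (j : nat)%:R : R[i]) < 1.
    have -> : (i : nat)%:R - (j : nat)%:R = (f y - (j : nat)%:R) - (f y - (i : nat)%:R) :> R[i].
      by ring.
    by rewrite (le_lt_trans (rnormB _ _))//; lra.
  have -> : ((i : nat)%:R - (j : nat)%:R : R[i]) = ((i : nat)%:Z - (j : nat)%:Z)%:~R%:C.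
    by rewrite rmorph_int rmorphB.
  rewrite rnorm_real -intr_norm -[1]/(1%:~R) ltr_int.
  by move: ij => /= /eqP; lia.
have hu (i : 'I_n.+1) : exists ku : CX * E, [/\ pi (cfun_emb ku.1) ku.2 = ku.2,
    ku.2 <> 0 & forall y, ~ U i y -> ku.1 y = 0].
  have [k [[V [oV Vx k1]] k0 _]] := @cfun_bump R S (U i) (xi i) (oU i) (Ux i).
  have [h [[V' [_ V'x h1]] h0 _]] := @cfun_bump R S V (xi i) oV Vx.
  have [v hv] : exists v, pi (cfun_emb h) v <> 0.
    by apply: (rep_hull_witness (Xxi i)); rewrite h1//; exact/eqP/oner_neq0.
  exists (k, pi (cfun_emb h) v); split => //=.
  rewrite -(repM rep) cfun_emb_mul; congr (pi (cfun_emb _) _).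
  apply: cfunP => y; rewrite cfunME; have [Vy|Vy] := pselect (V y).
    by rewrite k1// mul1r.
  by rewrite h0// mulr0.
have [ku kuP] := choice hu.
have [c [[i ci] c0]] := spanned_dependent (fun i => (ku i).2) span.
have [_ ui _] := kuP i; apply: ui.
move/(congr1 (pi (cfun_emb (ku i).1))): c0; rewrite (rep0r rep) (rep_sumr rep).
rewrite (bigD1 i)//= big1 => [|j ji].
  rewrite addr0 (repZr rep); have [-> _ _] := kuP i.
  by move/eqP; rewrite scaler_eq0 (negbTE ci) => /eqP.
rewrite (repZr rep); have [<- _ Uj] := kuP j; have [_ _ Ui] := kuP i.
rewrite -(repM rep) cfun_emb_mul.
have -> : (ku i).1 * (ku j).1 = 0; last by rewrite cfun_emb0 (rep0l rep) scaler0.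
apply: cfunP => y; rewrite cfunME cfun0E.
have [iy|/Ui ->] := pselect (U i y); last by rewrite mul0r.
have [jy|/Uj ->] := pselect (U j y); last by rewrite mulr0.
by move: ji; rewrite (disj _ _ _ iy jy) eqxx.
Qed.

Lemma aper_separating_open y (t : seq int) : Aper y -> exists U : set S,
  [/\ open U, U y & forall n, n \in t -> n != 0 -> forall z, U z -> ~ U (dyn_iter (- n) z)].
Proof.
move=> yA; elim: t => [|n t [U [oU Uy Ut]]]; first by exists setT; split => //; exact: openT.
have [->|n0] := eqVneq n 0.
  exists U; split => // m; rewrite in_cons => /orP[/eqP ->|]; first by rewrite eqxx.
  exact: Ut.
have [f [f1 f0 _]] : exists f : CX, [/\ f y = 1,
    forall z, z \in [:: dyn_iter (- n) y] -> f z = 0 & rnorm f <= 1].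
  apply: separating_cfun => /=; rewrite inE => /eqP h.
  have /= := @aper_inj _ _ yA 0 (- n) h => /eqP.
  by rewrite eq_sym oppr_eq0 (negbTE n0).
exists (U `&` [set z | 1 / 2 < rnorm (f z)] `&`
  [set z | rnorm (f (dyn_iter (- n) z)) < 1 / 2]); split.
- apply: openI; first by apply: openI => //; exact: open_rnorm_gt.
  exact: (open_dyn_preimage (- n) (open_rnorm_lt f (1 / 2))).
- split; first by split => //=; rewrite f1 rnorm1; lra.
  by rewrite /= f0 ?mem_head// rnorm0; lra.
- move=> m; rewrite in_cons => /orP[/eqP ->|mt] m0 z [[Uz fz] fnz] [[Umz fmz] _].
    by move: fnz fmz => /= /lt_trans h /h; rewrite ltxx.
  exact: (Ut m mt m0 z Uz Umz).
Qed.

(* Sandwiching a between bumps h concentrated near y leaves h^2 a(0) up to a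
   small error, and the image of h^2 a(0) has a(0)(y) as approximate eigenvalue. *)
Lemma ker_coef0_aper a y : rep_ker pi a -> rep_hull pi y -> Aper y -> a 0 y = 0.
Proof.
move=> ka Xy yA; apply: contrapT => /eqP ay0.
(* Two errors of size [e] must together stay below [rnorm (a 0 y)]. *)
pose e := rnorm (a 0 y) / 4.
have ay1 := rnorm_gt0 ay0.
have e0 : 0 < e by rewrite divr_gt0.
have [s us hs] := ell1_approx a e0.
pose t := undup (0 :: s).
have ut : uniq t by exact: undup_uniq.
have t0 : 0 \in t by rewrite mem_undup mem_head.
have st : {subset s <= t} by move=> n ns; rewrite mem_undup in_cons ns orbT.
have {hs} := hs t ut st; set r := a - _ => hr.
have [U [oU Uy Ut]] := aper_separating_open t yA.
pose a' : CX := a 0 - cfun_cst S (a 0 y).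
pose U' := U `&` [set z | rnorm (a' z) < e].
have oU' : open U' by apply: openI => //; exact: open_rnorm_lt.
have U'y : U' y by split => //=; rewrite cfunBE /= subrr rnorm0.
have [h [[V [oV Vy h1]] h0 hle]] := @cfun_bump R S U' y oU' U'y.
(* The second bump, inside the region where [h] is 1, produces a nonzero vector [w] fixed by [h]. *)
have [k [[V' [_ V'y k1]] k0 _]] := @cfun_bump R S V y oV Vy.
have hk : h * k = k.
  apply: cfunP => z; rewrite cfunME; have [Vz|Vz] := pselect (V z).
    by rewrite h1// mul1r.
  by rewrite k0// mulr0.
have [u ku] : exists u, pi (cfun_emb k) u <> 0.
  by apply: (rep_hull_witness Xy); rewrite k1//; exact/eqP/oner_neq0.
set w := pi (cfun_emb k) u in ku.
have hw : pi (cfun_emb h) w = w by rewrite /w -(repM rep) cfun_emb_mul hk.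
(* The two factors [h] are supported in [U] and in its translate by [n], which are disjoint. *)
have offdiag n v : n \in t -> n != 0 ->
    pi (cfun_emb h) (pi (ell1_single n (a n)) (pi (cfun_emb h) v)) = 0.
  move=> nt n0; rewrite -!(repM rep) !ell1_single_mul alpha_id add0r addr0.
  have -> : h * a n * alpha n h = 0; last first.
    by rewrite single_split (repM rep) cfun_emb0 (rep0l rep).
  apply: cfunP => z; rewrite !cfunME alphaE cfun0E.
  have [Uz|/h0 ->] := pselect (U' z); last by rewrite !mul0r.
  rewrite (h0 (dyn_iter (- n) z)) ?mulr0// => -[Uz' _].
  by case: Uz => Uz _; exact: (Ut n nt n0 z Uz Uz').
have diag : pi (cfun_emb (a 0)) w = - pi (cfun_emb h ** r ** cfun_emb h) w.
  have : pi (cfun_emb h) (pi (r + \sum_(n <- t) ell1_single n (a n))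
      (pi (cfun_emb h) w)) = 0 by rewrite subrK ka (rep0r rep).
  rewrite (repDl rep) (repDr rep) (rep_suml rep) (rep_sumr rep) (bigD1_seq 0)//=.
  rewrite big1_seq => [|n /andP[n0 nt]]; last exact: offdiag.
  rewrite addr0 !(repM rep) hw addrC => /eqP; rewrite addr_eq0 => /eqP <-.
  rewrite -/(cfun_emb (a 0)) -[in RHS](repM rep) cfun_emb_mul mulrC -cfun_emb_mul.
  by rewrite (repM rep) hw.
have near_scalar : pi (cfun_emb (a 0)) w = a 0 y *: w + pi (cfun_emb (a' * h)) w.
  have a0E : a 0 = a' + a 0 y *: (1 : CX).
    by apply: cfunP => z; rewrite cfunDE cfunBE cfunZE cfun1E mulr1 subrK.
  rewrite {1}a0E cfun_embD (repDl rep) cfun_embZ (repZl rep) (irr_one irr) addrC.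
  by congr (_ + _); rewrite -cfun_emb_mul (repM rep) hw.
(* [w] is an eigenvector of [c] for the value [a 0 y]. The first term carries the truncation error,
   the second the oscillation of [a 0] on [U']; each has norm at most [e]. *)
pose c := - (cfun_emb h ** r ** cfun_emb h) - cfun_emb (a' * h).
have cw : pi c w = a 0 y *: w.
  by rewrite (repBl rep) (repNl rep) -diag near_scalar addrK.
have := irr_eigenvalue_le irr ku cw; apply/negP; rewrite -ltNge.
rewrite (le_lt_trans (rnormB _ _))// rnormN.
have hE : rnorm (cfun_emb h : A) <= 1 by rewrite rnorm_single.
have c1 : rnorm (cfun_emb h ** r ** cfun_emb h) <= e.
  rewrite (le_trans (rnorm_ell1_mul _ _))// -[leRHS]mulr1 ler_pM ?rnorm_ge0//.
  rewrite (le_trans (rnorm_ell1_mul _ _))// -[leRHS]mul1r ler_pM ?rnorm_ge0//.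
have c2 : rnorm (cfun_emb (a' * h) : A) <= e.
  rewrite rnorm_single rnorm_cfunE; apply: sup_norm_le => z; rewrite cfunME.
  have [[_ /= az]|/h0 ->] := pselect (U' z); last by rewrite mulr0 rnorm0 ltW.
  rewrite crnormM -[leRHS]mulr1 ler_pM ?rnorm_ge0 ?(ltW az)//.
  exact: le_trans (rnorm_eval _ _) hle.
have : e * 4 = rnorm (a 0 y) by rewrite /e divfK.
move: c1 c2; lra.
Qed.

Lemma aper_rep_ker x : Aper x -> rep_hull pi = closure (dyn_orbit x) ->
  rep_ker pi = [set a : A | forall n y, closure (dyn_orbit x) y -> a n y = 0].
Proof.
move=> xA XE; apply/seteqP; split => [a ka n|a h v]; last first.
  apply: (irr_annihilator_dense irr) => n; rewrite single_split (repM rep).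
  by apply: (rep_hull_vanish irr) => y; rewrite XE; exact: h.
apply: cfun_closure0 => _ [m _ <-].
(* Multiplication by [delta^-n] turns the value of [a n] at the [m]-th orbit point into the value of
   the coefficient 0 at the point of index [m - n]. *)
have kb : rep_ker pi (delta_pow R S (- n) ** a) by move=> v; rewrite (repM rep) ka (rep0r rep).
have := @ker_coef0_aper _ (dyn_iter (m - n) x) kb.
rewrite ell1_single_mulE mul1r alphaE -dyn_iterD.
rewrite (_ : 0 - - n = n); last by lia.
rewrite (_ : - - n + (m - n) = m); last by lia.
apply.
  by rewrite XE; apply: subset_closure; exact: orbit_iter.
move=> fin; apply: xA; apply: sub_finite_set fin => _ [k _ <-].
by exists (k - (m - n)); rewrite // -dyn_iterD subrK.
Qed.

End HullOfIrreducible.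

(** * Primitive ideals *)

Section PrimitiveIdeals.
Variables (R : realType) (S : dynsys).
Local Notation CX := (cfun R S).
Local Notation A := (ell1 CX).
Implicit Types (x y : S) (z : R[i]) (I J : set A).

Lemma per_orbit_closed x : Per x -> closure (dyn_orbit x) = dyn_orbit x.
Proof. by move=> xP; apply/esym; rewrite -closure_id; exact: finite_closed. Qed.

Lemma metrizable_set (Y : set S) : metrizable R S -> metrizable R Y.
Proof.
move=> [d [d0 ds dt dn]]; exists (fun u v => d (set_val u) (set_val v)); split => //.
- by move=> u v; split => [h|->]; [apply: val_inj; exact: (proj1 (d0 _ _) h)|exact: (proj2 (d0 _ _) erefl)].
- move=> u B; split.
    move=> /set_type_nbhsP[U [oU Uu UB]].
    have /dn[e e0 eU] : nbhs (set_val u) U by exact: open_nbhs_nbhs.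
    by exists e => // v /= uv; apply: UB; exact: eU.
  move=> [e e0 eB].
  have : nbhs (set_val u) [set v | d (set_val u) v < e] by apply/dn; exists e.
  rewrite nbhsE => -[U [oU Uu] Ue]; apply/set_type_nbhsP; exists U; split => // v /Ue.
  exact: eB.
Qed.

Section Infinite.
Variables (E : lmodType R[i]) (pi : A -> E -> E).
Hypothesis irr : alg_irreducible pi.

Lemma infinite_dimensional_rep_hull :
  ~ finite_dimensional E -> infinite_set (rep_hull pi).
Proof.
by move=> infE /(finite_rep_hull_classification irr)[x [z [_ _ _ /infE]]].
Qed.

Lemma finite_dimensional_ker : finite_dimensional E -> Pi_Per (rep_ker pi).
Proof.
move=> /(finite_dimensional_rep_hull irr)/(finite_rep_hull_classification irr).
by move=> [x [z [xP z1 xz _]]]; exists x, z.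
Qed.

Lemma infinite_dimensional_ker :
  ~ finite_dimensional E -> metrizable R (rep_hull pi) -> Pi_Aper (rep_ker pi).
Proof.
move=> /infinite_dimensional_rep_hull infX mX.
have [x Xx xX] := transitive_dense_orbit (@rep_hull_closed _ _ _ pi)
  (rep_hull_neq0 irr) (rep_hull_dyn_invariant irr) (rep_hull_dyn_transitive irr) mX.
(* A periodic orbit is closed, so it would be the whole hull, which is infinite. *)
have xA : Aper x.
  by move=> xP; apply: infX; rewrite -xX per_orbit_closed.
exists x; split => //; exists (@orbit_rep R S x); first exact: orbit_rep_is_pi_aper.
by rewrite (pi_aper_ker (@orbit_rep_is_pi_aper R S x)); exact: aper_rep_ker.
Qed.

Lemma all_periodic_finite_dimensional : Per = [set: S] -> finite_dimensional E.
Proof.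
move=> PX; apply: contrapT => /infinite_dimensional_rep_hull; apply.
apply: (transitive_all_periodic R (@rep_hull_closed _ _ _ pi) (rep_hull_neq0 irr)
  (rep_hull_dyn_invariant irr) (rep_hull_dyn_transitive irr)) => y _.
by rewrite PX.
Qed.

End Infinite.

Lemma Pi_Aper_sub_Pi_infty I : Pi_Aper I -> Pi_infty I.
Proof.
move=> [x [xA [pi pix ->]]]; exists (ell1 R[i]), pi; split => //.
  exact: pi_aper_irreducible pix xA.
exact: ell1C_infinite_dimensional.
Qed.

Lemma Pi_infty_sub_Pi_all I : Pi_infty I -> Pi_all I.
Proof. by move=> [E [pi [irr _ ->]]]; exists E, pi. Qed.

Lemma is_P_per_primitive x z I : is_P_per x z I -> Pi_all I.
Proof.
move=> [p [pi [xp pix ->]]]; exists 'cV[R[i]]_p, pi; split => //.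
exact: pi_per_irreducible xp pix.
Qed.

Definition ideal_hull I (Y : set S) :=
  forall f, I (cfun_emb f) <-> forall y, Y y -> f y = 0.

Lemma ideal_hullS I J (Y Z : set S) : closed Y -> ideal_hull I Y -> ideal_hull J Z ->
  I `<=` J -> Z `<=` Y.
Proof.
move=> cY IY JZ IJ; apply: (@closed_separated R) => // f fY.
by apply/JZ/IJ/IY.
Qed.

Lemma is_P_per_hull x z I : is_P_per x z I -> ideal_hull I (closure (dyn_orbit x)).
Proof.
move=> [p [pi [xp pix ->]]] f; split => [If|fx].
  by apply: cfun_closure0; exact: (proj1 (pi_per_ker_emb xp pix f)).
by apply: (proj2 (pi_per_ker_emb xp pix f)) => y xy; apply: fx; exact: subset_closure.
Qed.

Lemma is_P_aper_ker x I : is_P_aper x I ->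
  I = [set a : A | forall n y, closure (dyn_orbit x) y -> a n y = 0].
Proof. by move=> [pi pix ->]; exact: pi_aper_ker. Qed.

Lemma is_P_aper_hull x I : is_P_aper x I -> ideal_hull I (closure (dyn_orbit x)).
Proof.
move=> /is_P_aper_ker -> f; split => [/(_ 0)//|fx n y xy].
by rewrite ell1_singleE; case: eqP => _; [exact: fx|exact: cfun0E].
Qed.

Lemma is_P_per_maximal x z I J : is_P_per x z I -> Pi_all J -> I `<=` J -> J = I.
Proof.
move=> [p [pi [xp pix ->]]] [E [pi' [irr' ->]]] sub; apply/seteqP; split => //.
exact: pi_per_ker_maximal xp pix _ _ irr' sub.
Qed.

Lemma per_orbit_closure_minimal x : Per x ->
  minimal_orbit_closure (closure (dyn_orbit x)).
Proof.
move=> xP; split; first by exists x.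
move=> _ [y ->]; rewrite (per_orbit_closed xP) => yx.
have [n _ xn] : dyn_orbit x y by apply: yx; apply: subset_closure; exists 0.
have xy : dyn_orbit y = dyn_orbit x.
  apply/seteqP; split => _ [m _ <-].
    by exists (m + n) => //; rewrite -xn dyn_iterD.
  by exists (m - n) => //; rewrite -xn -dyn_iterD subrK.
by rewrite xy (per_orbit_closed xP).
Qed.

(** Produces a competitor in the maximality argument from any smaller orbit closure. For periodic
    [y] the scalar 1 is one choice among those of modulus 1. *)
Lemma primitive_at_orbit y : exists J, [/\ Pi_all J, ideal_hull J (closure (dyn_orbit y)) &
  [set a : A | forall n x, closure (dyn_orbit y) x -> a n x = 0] `<=` J].
Proof.
have [yP|yA] := pselect (Per y).
  have [p yp] := per_has_period yP; have [p0 py _] := yp.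
  have [q qE] : exists q, p = q.+1 by exists p.-1; rewrite prednK.
  rewrite qE in yp py.
  pose pi : A -> 'cV[R[i]]_q.+1 -> 'cV[R[i]]_q.+1 := per_rep y 1.
  have piP : is_pi_per y 1 pi by apply: per_rep_is_pi_per => //; exact: rnorm1.
  have yJ : is_P_per y 1 (rep_ker pi) by exists q.+1, pi.
  exists (rep_ker pi); split.
  - exact: is_P_per_primitive yJ.
  - exact: is_P_per_hull yJ.
  - move=> a h; apply: (pi_per_ker_sub yp piP) => n x yx; apply: h.
    exact: subset_closure.
have yJ : is_P_aper y (rep_ker (@orbit_rep R S y)).
  by exists (@orbit_rep R S y) => //; exact: orbit_rep_is_pi_aper.
exists (rep_ker (@orbit_rep R S y)); split.
- by apply/Pi_infty_sub_Pi_all/Pi_Aper_sub_Pi_infty; exists y.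
- exact: is_P_aper_hull.
- by rewrite (is_P_aper_ker yJ).
Qed.

End PrimitiveIdeals.

Theorem theorem4p18 (R : realType) (S : dynsys) :
  (metrizable R S \/ Per = [set: S] -> infinite_supports_metrizable R S) /\
  (infinite_supports_metrizable R S ->
   [/\ Pi_infty = Pi_Aper :> set (set (ell1 (cfun R S))),
       Pi_all = Pi_X :> set (set (ell1 (cfun R S))) &
       forall I : set (ell1 (cfun R S)), Pi_all I ->
         (maximal_primitive I <->
          exists Y : set S, minimal_orbit_closure Y /\ associated I Y)]).
Proof.
split=> [[mS|PX]|metr].
- by move=> E pi Y _ _ _; exact: metrizable_set.
(* When every point is periodic there is no infinite dimensional irreducible representation, and the
   condition holds vacuously. *)
- by move=> E pi Y irr infE _; case: infE; exact: all_periodic_finite_dimensional irr PX.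
have infty_aper : Pi_infty = Pi_Aper :> set (set (ell1 (cfun R S))).
  apply/seteqP; split => I; last exact: Pi_Aper_sub_Pi_infty.
  move=> [E [pi [irr infE ->]]]; apply: infinite_dimensional_ker => //.
  exact: metr irr infE (rep_support_hull irr).
have all_X : Pi_all = Pi_X :> set (set (ell1 (cfun R S))).
  apply/seteqP; split => I.
    move=> [E [pi [irr ->]]]; have [fd|infE] := pselect (finite_dimensional E).
      by left; exact: finite_dimensional_ker.
    by right; rewrite -infty_aper; exists E, pi.
  move=> [[x [z [_ _ xz]]]|IA]; first exact: is_P_per_primitive xz.
  by apply: Pi_infty_sub_Pi_all; rewrite infty_aper.
split => // I IA; split=> [[_ Imax]|[Y [[_ Ymin] IY]]].
  have : Pi_X I by rewrite -all_X.
  move=> [[x [z [xP z1 xz]]]|[x [xA xI]]].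
    exists (closure (dyn_orbit x)); split; first exact: per_orbit_closure_minimal.
    by left; exists x, z.
  exists (closure (dyn_orbit x)); split; last by right; exists x.
  split; first by exists x.
  move=> _ [y ->] yx; apply/seteqP; split => //.
  (* The ideal at [y] contains [I] because its orbit closure is smaller; maximality makes the ideals
     equal, and then their hulls agree. *)
  have [J [JA JY Jsub]] := primitive_at_orbit R y.
  have IJ : I `<=` J.
    rewrite (is_P_aper_ker xI) => a ax; apply: Jsub => n u yu; apply: ax.
    exact: yx.
  apply: ideal_hullS JY (is_P_aper_hull xI) _; first exact: closed_closure.
  by rewrite (Imax J JA IJ).
split => // J JA IJ.
case: IY => [[x [z [xP _ _ xz]]]|[x [xA YE xI]]].
  exact: is_P_per_maximal xz JA IJ.
have xY := is_P_aper_hull xI; rewrite -YE in xY.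
have cY : closed Y by rewrite YE; exact: closed_closure.
have sub y : ideal_hull J (closure (dyn_orbit y)) -> closure (dyn_orbit y) = Y.
  move=> yJ; apply: Ymin; first by exists y.
  exact: ideal_hullS cY xY yJ IJ.
have : Pi_X J by rewrite -all_X.
move=> [[y [z [yP _ yz]]]|[y [yA yJ]]].
  (* A periodic [y] is excluded: its finite orbit would be [Y], which contains the infinite orbit of
     [x]. *)
  have yY := sub y (is_P_per_hull yz).
  case: xA; apply: (@sub_finite_set _ _ (dyn_orbit y)); last exact: yP.
  rewrite -(per_orbit_closed yP) yY YE; exact: subset_closure.
have yY := sub y (is_P_aper_hull yJ).
by rewrite (is_P_aper_ker yJ) (is_P_aper_ker xI) yY YE.
Qed.
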